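(* Let $K$ be a totally real biquadratic field with ring of integers $\mathcal{O}_K$. Then there is no universal classical totally positive definite ternary quadratic form over $\mathcal{O}_K$.
   Context: A totally real biquadratic field is a field $K=\mathbb{Q}(\sqrt{p},\sqrt{q})$ with $p,q>1$ two different square-free integers (so $[K:\mathbb{Q}]=4$). An element $\alpha\in K$ is totally positive ($\alpha\succ 0$) if $\sigma(\alpha)>0$ for every embedding $\sigma$ of $K$ into $\mathbb{C}$ (these all have image in $\mathbb{R}$); $\mathcal{O}_K^+$ is the set of totally positive elements of $\mathcal{O}_K$. An $n$-ary quadratic form over $\mathcal{O}_K$ is $Q(x_1,\dots,x_n)=\sum_{1\le i\le j\le n}a_{ij}x_ix_j$ with $a_{ij}\in\mathcal{O}_K$; it is ternary if $n=3$; classical if $2$ divides $a_{ij}$ in $\mathcal{O}_K$ for all $i\ne j$; totally positive definite if $Q(\mathbf{x})\succ 0$ for all nonzero $\mathbf{x}\in\mathcal{O}_K^n$; universal if for every $\alpha\in\mathcal{O}_K^+$ there is $\mathbf{e}\in\mathcal{O}_K^n$ with $Q(\mathbf{e})=\alpha$. *)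

(* Defs.v *)
From HB Require Import structures.
From mathcomp Require Import all_boot all_order all_algebra all_field.

Set Implicit Arguments.
Unset Strict Implicit.
Unset Printing Implicit Defensive.

Import Order.TTheory GRing.Theory Num.Theory.
Local Open Scope ring_scope.

Definition squarefree (n : nat) : Prop :=
  forall d : nat, (d ^ 2 %| n)%N -> d = 1%N.

(* K = Q(sqrt p, sqrt q): rp and rq are square roots of p and q in K, and the
   smallest subfield of K containing them is K itself. *)
Definition totally_real_biquadratic (K : fieldExtType rat) : Prop :=
  exists (p q : nat) (rp rq : K),
    [/\ (1 < p)%N /\ (1 < q)%N, squarefree p /\ squarefree q, p <> q,
        rp ^+ 2 = p%:R /\ rq ^+ 2 = q%:R
      & <<1 & [:: rp; rq]>>%VS = {:K}%VS].

Section NumberField.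
Variable K : fieldExtType rat.

Definition in_OK (x : K) : Prop := integralOver (intr : int -> K) x.

(* K is algebraic over Q, so its embeddings into the complex numbers are its
   embeddings into algC.  In algC, 0 < z means that z is real and positive. *)
Definition totally_positive (x : K) : Prop :=
  forall sigma : {rmorphism K -> algC}, 0 < sigma x.

Section QuadraticForm.
Variables (n : nat) (a : 'M[K]_n).

(* The form sum_(i <= j) a_ij x_i x_j with coefficient matrix a; the entries
   a_ij with i > j play no role, here and below. *)
Definition qform (x : 'rV[K]_n) : K :=
  \sum_(i < n) \sum_(j < n | (i <= j)%N) a i j * x 0 i * x 0 j.

Definition in_OKn (x : 'rV[K]_n) : Prop := forall i, in_OK (x 0 i).

Definition qform_over_OK : Prop :=
  forall i j : 'I_n, (i <= j)%N -> in_OK (a i j).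

Definition classical : Prop :=
  forall i j : 'I_n, (i < j)%N -> exists2 b : K, in_OK b & a i j = 2 * b.

Definition totally_positive_definite : Prop :=
  forall x : 'rV[K]_n, in_OKn x -> x <> 0 -> totally_positive (qform x).

Definition universal : Prop :=
  forall alpha : K, in_OK alpha -> totally_positive alpha ->
    exists2 e : 'rV[K]_n, in_OKn e & qform e = alpha.

End QuadraticForm.
End NumberField.

(* Main.v *)
From Stdlib Require Import ZArith Znumtheory.
Require Import Defs.
From HB Require Import structures.
From mathcomp Require Import all_boot all_order all_algebra all_field.
From mathcomp Require Import zify ssrZ ring lra.

Set Implicit Arguments.
Unset Strict Implicit.
Unset Printing Implicit Defensive.

Import Order.TTheory GRing.Theory Num.Theory.
Local Open Scope ring_scope.

(** Suppose that a classical, totally positive definite, universal ternary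
form over the integers of K exists. It represents 1 at some vector v, and
since all scalar products are integral, every vector is the sum of an integral
multiple of v and an integral vector orthogonal to v. So the orthogonal
complement M of v has rank two, and every totally positive integer g is x^2 +
Q(y) with x an integer and y in M. Any three vectors of M have Gram
determinant 0, and B(y, z)^2 <= Q(y) Q(z) at every real place
([universal_binary]). A lattice of rank two turns out to be too small.

Let F be a quadratic subfield of K. Few integers have a square bounded at
every real place by a given small one, and if the other two radicals of K are
large they all lie in F. Following the possible representations of two well
chosen elements of F then yields independent y2, y3 in M whose Gram matrix has
entries in F and is bounded by an absolute constant ([tree]). Take now a
totally positive integer g outside F, and write g = x^2 + Q(y1). If every
integer b with b^2 <= C g at all places lies in F, where C is a bound for
Q(y2) and Q(y3), then x, B(y1, y2) and B(y1, y3) lie in F. The Gram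
determinant of y1, y2, y3 is 0, and it is a polynomial of degree one in Q(y1)
whose coefficients are in F and whose leading coefficient is the nonzero
determinant of y2, y3; hence Q(y1), and so g, lies in F ([core_refutation],
[F_refutation]).

It remains to find F and g. An integer outside F has a nonzero coordinate
along a radical that is not in F, so one of its conjugates is large
([captured_spread]). If F omits sqrt e, with e the smaller of the two possible
values, then the conjugates of g = k + sqrt e (or half of it), where k is next
to sqrt e, have product k^2 - e of size sqrt e only, and this is too small for
the square of an integer outside F once e is large. Writing the radicals of K
as sqrt (b c), sqrt (a c), sqrt (a b) with a, b, c pairwise coprime, either
all three are odd and congruent modulo 4 ([no_congruent]), or one of them, say
a, is distinguished modulo 4 ([no_distinguished]). In the latter case the
coordinates of integers satisfy congruences modulo 4 ([half_parity]), which
improve the bound enough to exclude, when b < c, all fields with a b >= 14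
apart from two. The remaining values of a b are 2, 3, 6, 7, 10 and 11, and for
each of them c is bounded by the argument for F generated by sqrt (a b).

What is left is a finite list of fields. For most of them an enumeration of
the integers with bounded square shows that the condition of the previous
argument still holds ([settled]). In the other ones the representations of
three elements are enumerated together with all possible scalar products, and
no Gram determinant vanishes ([tree_refutation]). *)

(** * Biquadratic fields as triples of integers *)

(** The binary integers Z are used throughout because they compute. *)
Definition zr {R : nzRingType} (z : Z) : R := (int_of_Z z)%:~R.
HB.instance Definition _ (R : nzRingType) :=
  GRing.RMorphism.copy (@zr R) (intmul 1 \o int_of_Z).

Arguments zr {R} z%_R.

Lemma zr_nat (R : nzRingType) n : zr (Z.of_nat n) = n%:R :> R.
Proof. by rewrite /zr (_ : int_of_Z (Z.of_nat n) = Posz n) //; lia. Qed.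

Lemma zr_rmorph (R S : nzRingType) (f : {rmorphism R -> S}) z : f (zr z) = zr z.
Proof. exact: rmorph_int. Qed.

Lemma zr_gt0 (R : numDomainType) z : (0 < zr z :> R) = (0 < z).
Proof. rewrite ltr0z; lia. Qed.
Lemma zr_ge0 (R : numDomainType) z : (0 <= zr z :> R) = (0 <= z).
Proof. rewrite ler0z; lia. Qed.
Lemma zr_le (R : numDomainType) y z : (zr y <= zr z :> R) = (y <= z).
Proof. rewrite ler_int; lia. Qed.
Lemma zr_lt (R : numDomainType) y z : (zr y < zr z :> R) = (y < z).
Proof. rewrite ltr_int; lia. Qed.
Lemma zr_inj (R : numDomainType) : injective (zr : Z -> R).
Proof. by move=> y z /intr_inj /(can_inj int_of_ZK). Qed.

Definition sqf (n : Z) : Prop := forall d, Z.divide (d * d)%R n -> Z.abs d = 1.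
Arguments sqf n%_R.

Definition radical_triple (a b c : Z) : Prop :=
  [/\ [/\ 0 < a, 0 < b & 0 < c], [/\ sqf (b * c), sqf (a * c) & sqf (a * b)]
    & [/\ 1 < b * c, 1 < a * c & 1 < a * b]].

Section Biquadratic.
Variable K : fieldExtType rat.

(** [P], [Q], [R] are the square roots of bc, ac, ab, which form a basis of K
over the rationals.  In this form the three quadratic subfields play symmetric
roles. *)
Definition radical_basis (a b c : Z) (P Q R : K) : Prop :=
  [/\ P ^+ 2 = zr (b * c), Q ^+ 2 = zr (a * c), R ^+ 2 = zr (a * b)
    & [/\ Q * R = zr a * P, P * R = zr b * Q, P * Q = zr c * R
    & forall x : K, exists u0 u1 u2 u3 : rat,
        x = u0%:A + u1%:A * P + u2%:A * Q + u3%:A * R]].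

Definition biquadratic_of (a b c : Z) : Prop :=
  radical_triple a b c /\ exists P Q R : K, radical_basis a b c P Q R.

Lemma radical_triple_swap12 a b c : radical_triple a b c -> radical_triple b a c.
Proof. by case=> [[a0 b0 c0] [h1 h2 h3] [k1 k2 k3]]; split; split=> //; rewrite mulrC. Qed.

Lemma radical_triple_swap23 a b c : radical_triple a b c -> radical_triple a c b.
Proof. by case=> [[a0 b0 c0] [h1 h2 h3] [k1 k2 k3]]; split; split=> //; rewrite mulrC. Qed.

Lemma radical_basis_swap12 a b c P Q R : radical_basis a b c P Q R -> radical_basis b a c Q P R.
Proof.
case=> [e1 e2 e3 [f1 f2 f3 g]].
split=> //; first by rewrite mulrC.
split=> //; first by rewrite mulrC.
move=> x; have [u0 [u1 [u2 [u3 ->]]]] := g x.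
by exists u0, u2, u1, u3; rewrite (addrAC u0%:A).
Qed.

Lemma radical_basis_swap23 a b c P Q R : radical_basis a b c P Q R -> radical_basis a c b P R Q.
Proof.
case=> [e1 e2 e3 [f1 f2 f3 g]].
split=> //; first by rewrite mulrC.
split=> //; first by rewrite mulrC.
move=> x; have [u0 [u1 [u2 [u3 ->]]]] := g x.
by exists u0, u1, u3, u2; rewrite addrAC.
Qed.

Lemma biquadratic_of_swap12 a b c : biquadratic_of a b c -> biquadratic_of b a c.
Proof.
case=> /radical_triple_swap12 h [P [Q [R /radical_basis_swap12 r]]]; split=> //.
by exists Q, P, R.
Qed.

Lemma biquadratic_of_swap23 a b c : biquadratic_of a b c -> biquadratic_of a c b.
Proof.
case=> /radical_triple_swap23 h [P [Q [R /radical_basis_swap23 r]]]; split=> //.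
by exists P, R, Q.
Qed.

Lemma sqf_of_nat n : (0 < n)%N -> squarefree n -> sqf (Z.of_nat n).
Proof.
move=> n0 h d [k hk].
have : (Z.abs_nat d ^ 2 %| n)%N.
  by apply/dvdnP; exists (Z.abs_nat k); apply: Nat2Z.inj; rewrite -mulnn !Nat2Z.inj_mul !Zabs2Nat.id_abs; nia.
by move/h; lia.
Qed.

(** A prime whose square divides the product divides only one factor. *)
Lemma squarefreeM m n : coprime m n -> squarefree m -> squarefree n -> squarefree (m * n).
Proof.
move=> co hm hn d hd; apply/eqP; apply/negPn/negP => d1.
have d0 : d != 0%N.
  apply: contraNneq d1 => d0; move: hd; rewrite d0 exp0n // dvd0n muln_eq0.
  by case/orP=> /eqP e0; [have := hm 0%N | have := hn 0%N]; rewrite e0 dvdn0 => /(_ isT).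
have [l pl ld] : exists2 l, prime l & (l %| d)%N.
  by exists (pdiv d); rewrite ?pdiv_dvd ?pdiv_prime // ltn_neqAle eq_sym d1 lt0n d0.
have : (l ^ 2 %| m * n)%N by apply: dvdn_trans hd; rewrite dvdn_exp2r.
have [lm|lm] := boolP (l %| m)%N.
  have ln : coprime (l ^ 2) n by rewrite coprimeXl // prime_coprime //; apply/negP => ln; have := dvdn_gcd l m n; rewrite lm ln (eqP co) dvdn1 => /eqP l1; rewrite l1 in pl.
  by rewrite mulnC Gauss_dvdr // => /hm l1; rewrite l1 in pl.
have {}lm : coprime (l ^ 2) m by rewrite coprimeXl // prime_coprime.
by rewrite Gauss_dvdr // => /hn l1; rewrite l1 in pl.
Qed.

Lemma squarefree_dvd m n : (m %| n)%N -> squarefree n -> squarefree m.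
Proof. by move=> mn h d dm; apply: h; apply: dvdn_trans mn. Qed.

Lemma adjoin_sqrt_repr (E : {subfield K}) (z : K) x :
  z ^+ 2 \in E -> x \in <<E; z>>%VS -> exists u v, [/\ u \in E, v \in E & x = u + v * z].
Proof.
move=> zE /Fadjoin_polyP[p pE ->].
elim/poly_ind: p pE => [|p d IH] pE.
  by exists 0, 0; rewrite horner0 mul0r addr0 mem0v.
have dE : d \in E by have /polyOverP/(_ 0%N) := pE; rewrite coefD coefMX coefC eqxx add0r.
have {}pE : p \is a polyOver E.
  apply/polyOverP => i; have /polyOverP/(_ i.+1) := pE.
  by rewrite coefD coefMX coefC /= addr0.
have [u [v [uE vE e]]] := IH pE.
exists (v * z ^+ 2 + d), u; split=> //.
  by rewrite rpredD // rpredM.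
rewrite hornerD hornerMX hornerC e; ring.
Qed.

(** With g the gcd of p and q, the triple is (q / g, p / g, g); the third
radical is sqrt p sqrt q / g. *)
Lemma totally_real_biquadratic_of :
  totally_real_biquadratic K -> exists a b c, biquadratic_of a b c.
Proof.
case=> p [q [rp [rq [[p1 q1] [sp sq] pq [ep eq] gen]]]].
set g := gcdn p q; have g0 : (0 < g)%N by rewrite gcdn_gt0 (ltnW p1).
have [p' Ep] : exists p', p = (p' * g)%N by apply/dvdnP/dvdn_gcdl.
have [q' Eq] : exists q', q = (q' * g)%N by apply/dvdnP/dvdn_gcdr.
have co : coprime p' q'.
  by rewrite /coprime -(eqn_pmul2r g0) muln_gcdl -Ep -Eq mul1n.
have sp' : squarefree p' by apply: squarefree_dvd sp; rewrite Ep dvdn_mulr.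
have sq' : squarefree q' by apply: squarefree_dvd sq; rewrite Eq dvdn_mulr.
have p'0 : (0 < p')%N by case: (p') Ep p1 => [->|].
have q'0 : (0 < q')%N by case: (q') Eq q1 => [->|].
have pq' : p' <> q' by move=> e; apply: pq; rewrite Ep Eq e.
have pq1 : (1 < q' * p')%N.
  rewrite ltn_neqAle muln_gt0 p'0 q'0 andbT eq_sym muln_eq1.
  rewrite andbT; apply/negP => /andP[/eqP u /eqP v]; apply: pq'; by rewrite u v.
have N2 (m n : nat) : Z.of_nat m * Z.of_nat n = Z.of_nat (m * n) by lia.
exists (Z.of_nat q'), (Z.of_nat p'), (Z.of_nat g); split.
  rewrite /radical_triple !N2 -Ep -Eq; split; first by split; lia.
    split; apply: sqf_of_nat => //; try lia.
    by apply: squarefreeM => //; rewrite coprime_sym.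
  by split; lia.
have g0' : (g%:R : K) != 0 by rewrite -(rmorph_nat (in_alg K)) fmorph_eq0 pnatr_eq0 -lt0n.
exists rp, rq, (rp * rq / g%:R); rewrite /radical_basis !N2 -Ep -Eq !zr_nat.
have e2 : rp ^+ 2 = p'%:R * g%:R by rewrite ep Ep natrM.
have e3 : rq ^+ 2 = q'%:R * g%:R by rewrite eq Eq natrM.
split=> //.
  rewrite expr_div_n exprMn e2 e3 natrM; field; exact: g0'.
split.
- by rewrite mulrA mulrCA -expr2 e3; field; exact: g0'.
- by rewrite mulrA mulrA -expr2 e2; field; exact: g0'.
- by field; exact: g0'.
move=> x.
have /= : x \in <<1 & [:: rp; rq]>>%VS by rewrite gen memvf.
rewrite adjoin_cons adjoin_seq1.
case/adjoin_sqrt_repr => [|u [v [uE vE ->]]].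
  by rewrite eq rpred_nat.
have R1 y : y \in <<1; rp>>%VS -> exists r s : rat, y = r%:A + s%:A * rp.
  case/adjoin_sqrt_repr => [|r [s [/vlineP[r' ->] /vlineP[s' ->] ->]]].
    by rewrite ep rpred_nat.
  by exists r', s'.
have [u0 [u1 ->]] := R1 _ uE; have [v0 [v1 ->]] := R1 _ vE.
exists u0, u1, v0, (v1 * g%:R).
have -> : (v1 * g%:R)%:A = v1%:A * g%:R :> K.
  by rewrite -[LHS]/(in_alg K _) rmorphM rmorph_nat.
move: (u0%:A) (u1%:A) (v0%:A) (v1%:A) => x0 x1 y0 y1.
by field; exact: g0'.
Qed.
End Biquadratic.

(** * Independence of the radicals and embeddings *)

(** The square of the denominator of s divides m. *)
Lemma sqf_rat_int (m n : Z) (s : rat) :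
  sqf m -> zr m * s ^+ 2 = zr n -> exists k : Z, s = zr k.
Proof.
move=> hm e.
have zi (x : int) : zr (Z_of_int x) = x%:~R :> rat by rewrite /zr Z_of_intK.
have d0 := denq_neq0 s.
have e1 : m * (Z_of_int (numq s) * Z_of_int (numq s)) = n * (Z_of_int (denq s) * Z_of_int (denq s)).
  apply: (@zr_inj rat); rewrite !rmorphM /= !zi -e -[in zr m * s ^+ 2](divq_num_den s).
  by field; rewrite intr_eq0.
have d1 : Z.abs (Z_of_int (denq s)) = 1.
  apply: hm.
  have co : coprime (`|denq s| ^ 2)%N (`|numq s| ^ 2)%N.
    by rewrite coprimeXl ?coprimeXr // coprime_sym coprime_num_den.
  have : (`|denq s| ^ 2 %| Z.abs_nat m)%N.
    rewrite -(Gauss_dvdl _ co); apply/dvdnP; exists (Z.abs_nat n).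
    rewrite -!mulnn; nia.
  move=> /dvdnP[k hk]; exists (Z.sgn m * Z.of_nat k).
  rewrite -mulnn in hk.
  move: (denq s) hk => d hk.
  have {hk} : Z.abs m = Z.of_nat k * (Z_of_int d * Z_of_int d) by nia.
  nia.
exists (Z_of_int (numq s)); rewrite zi.
have d2 : denq s = 1 by have := denq_gt0 s; lia.
by rewrite -{1}(divq_num_den s) d2 divr1.
Qed.

Lemma sqf_not_square (m : Z) (s : rat) : sqf m -> 1 < m -> s ^+ 2 <> zr m.
Proof.
move=> hm m1 e.
have [||k sk] := @sqf_rat_int 1 m s.
- by move=> d [k hk]; apply: Z.divide_1_r_abs; exists (k * d)%R; lia.
- by rewrite rmorph1 mul1r.
have : k ^+ 2 = m by apply: (@zr_inj rat); rewrite rmorphXn -e sk.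
move=> ek; have : Z.abs k = 1 by apply: hm; exists 1; rewrite -ek; ring.
nia.
Qed.

Section Embeddings.
Variables (K : fieldExtType rat) (a b c : Z) (P Q R : K).
Hypotheses (hg : radical_triple a b c) (hr : radical_basis a b c P Q R).

Let ev (u0 u1 u2 u3 : rat) : K := u0%:A + u1%:A * P + u2%:A * Q + u3%:A * R.

Let aD (u v : rat) : (u + v)%:A = u%:A + v%:A :> K. Proof. exact: (rmorphD (in_alg K)). Qed.
Let aB (u v : rat) : (u - v)%:A = u%:A - v%:A :> K. Proof. exact: (rmorphB (in_alg K)). Qed.
Let aN (u : rat) : (- u)%:A = - u%:A :> K. Proof. exact: (rmorphN (in_alg K)). Qed.
Let aM (u v : rat) : (u * v)%:A = u%:A * v%:A :> K. Proof. exact: (rmorphM (in_alg K)). Qed.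
Let aX (u : rat) n : (u ^+ n)%:A = u%:A ^+ n :> K. Proof. exact: (rmorphXn (in_alg K)). Qed.
Let aV (u : rat) : (u^-1)%:A = (u%:A)^-1 :> K. Proof. exact: (fmorphV (in_alg K)). Qed.
Let aZ (z : Z) : (zr z : rat)%:A = zr z :> K. Proof. exact: (zr_rmorph (in_alg K)). Qed.
Let a0 : (0 : rat)%:A = 0 :> K. Proof. exact: (rmorph0 (in_alg K)). Qed.
Let a1 : (1 : rat)%:A = 1 :> K. Proof. exact: (rmorph1 (in_alg K)). Qed.
Let aE := (aD, aB, aN, aM, aX, aV, aZ, a0, a1).

Lemma not_sqrt_rat (z : K) (m : Z) (u : rat) :
  sqf m -> 1 < m -> z ^+ 2 = zr m -> z <> u%:A.
Proof.
move=> hm m1 zm e; apply: (@sqf_not_square m u hm m1).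
apply: (fmorph_inj (in_alg K)); rewrite rmorphXn zr_rmorph -zm e.
by [].
Qed.

Lemma indep2 u v : u%:A + v%:A * P = 0 -> u = 0 /\ v = 0.
Proof.
case: hg => _ [h1 _ _] [k1 _ _]; case: hr => eP _ _ _.
have [->|v0] := eqVneq v 0.
  rewrite scale0r mul0r addr0 => /eqP; rewrite scaler_eq0 oner_eq0 orbF.
  by move/eqP.
move=> e; case: (@not_sqrt_rat P (b * c) (- u / v) h1 k1 eP).
have v0' : v%:A != 0 :> K by rewrite scaler_eq0 oner_eq0 orbF.
apply: (mulfI v0'); rewrite -[LHS]addr0 -[X in _ + X](subrr u%:A).
rewrite addrCA addrA e add0r.
by rewrite -aM mulrC divfK // aN.
Qed.

Lemma indep4 u0 u1 u2 u3 : ev u0 u1 u2 u3 = 0 -> [/\ u0 = 0, u1 = 0, u2 = 0 & u3 = 0].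
Proof.
move: (hg) (hr) => [[pa pb pc] [h1 h2 h3] [k1 k2 k3]] [eP eQ eR [f1 f2 f3 _]].
have z0 (z : Z) : 0 < z -> (zr z : K) != 0.
  move=> z0; rewrite -(zr_rmorph (in_alg K)) fmorph_eq0.
  by rewrite gt_eqF // zr_gt0.
have z0r (z : Z) : 0 < z -> (zr z : rat) != 0 by move=> h; rewrite gt_eqF // zr_gt0.
have ER : R = (zr c)^-1 * P * Q by rewrite -mulrA f3 mulKf // z0.
set w := u3 / zr c.
have -> : ev u0 u1 u2 u3 = (u0%:A + u1%:A * P) + (u2%:A + w%:A * P) * Q.
  rewrite /ev ER /w.
  by rewrite !aE; ring.
have [E|N] := eqVneq (u2%:A + w%:A * P) 0.
  rewrite E mul0r addr0 => /indep2[-> ->].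
  case/indep2: E => -> /eqP; rewrite mulf_eq0 invr_eq0 (negPf (z0r _ pc)) orbF.
  by move/eqP->.
move=> e.
(* otherwise Q lies in the field generated by P: multiply by the conjugate of N *)
set N' := u2%:A - w%:A * P.
have n0 : u2 ^+ 2 - w ^+ 2 * zr (b * c) != 0.
  apply: contra N => /eqP n0.
  have : (u2%:A + w%:A * P) * N' = 0.
    by rewrite -a0 -n0 /N' !aE -eP; ring.
  move/eqP; rewrite mulf_eq0 => /orP[//|/eqP].
  rewrite /N' -mulNr -scaleNr => /indep2[-> /eqP]; rewrite oppr_eq0 => /eqP->.
  by rewrite !scale0r mul0r addr0.
set n := (_ - _ : rat) in n0.
set x := (- (u0 * u2 - u1 * w * zr (b * c)) / n).
set y := (- (u1 * u2 - u0 * w) / n).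
have n0' : n%:A != 0 :> K by rewrite scaler_eq0 oner_eq0 orbF.
have nE : n%:A = (u2%:A + w%:A * P) * (u2%:A - w%:A * P).
  by rewrite /n !aE -eP; ring.
have QE : Q = x%:A + y%:A * P.
  apply: (mulfI n0').
  have E1 : (u2%:A + w%:A * P) * Q = - (u0%:A + u1%:A * P).
    by apply/eqP; rewrite -addr_eq0 addrC e.
  transitivity ((u2%:A - w%:A * P) * ((u2%:A + w%:A * P) * Q)).
    by rewrite nE; ring.
  rewrite E1 mulrDr mulrA -!aM.
  rewrite /x /y ![n * _]mulrC !divfK //.
  by rewrite !aE -eP; ring.
clearbody x y.
have : (x ^+ 2 + y ^+ 2 * zr (b * c) - zr (a * c))%:A + (2 * x * y)%:A * P = 0.
  by rewrite !aE -eQ -eP {1}QE; ring.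
case/indep2=> e1 /eqP; rewrite !mulf_eq0 /= => /orP[/eqP x0|/eqP y0].
- exfalso; apply: (@sqf_not_square (a * b) (y * zr b) h3 k3).
  have {}e1 : y ^+ 2 * zr (b * c) = zr (a * c).
    by apply/eqP; rewrite -subr_eq0; move: e1; rewrite x0 expr0n /= add0r => ->.
  apply: (mulIf (z0r _ pc)).
  move: e1; rewrite !rmorphM /= => e1.
  transitivity (zr b * (y ^+ 2 * (zr b * zr c)) : rat); first by ring.
  by rewrite e1; ring.
- exfalso; apply: (@sqf_not_square (a * c) x h2 k2).
  by apply/eqP; rewrite -subr_eq0; move: e1; rewrite y0 expr0n /= mul0r addr0 => ->.
Qed.

(** By independence a map that is defined on coordinates is a morphism as soon
as the images of the radicals multiply in the same way. *)
Lemma embedding (L : numFieldType) (ta tb tc : L) :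
  ta ^+ 2 = zr a -> tb ^+ 2 = zr b -> tc ^+ 2 = zr c ->
  exists f : {rmorphism K -> L}, [/\ f P = tb * tc, f Q = ta * tc & f R = ta * tb].
Proof.
move=> ea eb ec.
move: (hr) => [eP eQ eR [f1 f2 f3 span]].
have ex x : exists u : rat * rat * rat * rat, x == ev u.1.1.1 u.1.1.2 u.1.2 u.2.
  have [u0 [u1 [u2 [u3 ->]]]] := span x.
  by exists (u0, u1, u2, u3).
pose co x := xchoose (ex x).
have coP x : x = ev (co x).1.1.1 (co x).1.1.2 (co x).1.2 (co x).2.
  exact/eqP/(xchooseP (ex x)).
pose F (u : rat * rat * rat * rat) : L :=
  ratr u.1.1.1 + ratr u.1.1.2 * (tb * tc) + ratr u.1.2 * (ta * tc) + ratr u.2 * (ta * tb).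
pose f x := F (co x).
have fE u0 u1 u2 u3 : f (ev u0 u1 u2 u3) = F (u0, u1, u2, u3).
  rewrite /f; have := coP (ev u0 u1 u2 u3); case: (co _) => [[[v0 v1] v2] v3] /= e.
  have : ev (u0 - v0) (u1 - v1) (u2 - v2) (u3 - v3) = 0.
    move/eqP: e; rewrite -subr_eq0 /ev => /eqP <-.
    by rewrite !aB; ring.
  case/indep4=> /eqP + /eqP + /eqP + /eqP; rewrite !subr_eq0.
  by do 4!move/eqP->.
have fB : zmod_morphism f.
  move=> x y; rewrite [in LHS](coP x) [in LHS](coP y) /f.
  case: (co x) => [[[u0 u1] u2] u3]; case: (co y) => [[[v0 v1] v2] v3] /=.
  have -> : ev u0 u1 u2 u3 - ev v0 v1 v2 v3 = ev (u0 - v0) (u1 - v1) (u2 - v2) (u3 - v3).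
    by rewrite /ev !aB; ring.
  by rewrite -/(f _) fE /F /= !rmorphB; ring.
have fM : monoid_morphism f.
  split.
    have -> : (1 : K) = ev 1 0 0 0 by rewrite /ev !scale0r !mul0r !addr0 scale1r.
    by rewrite fE /F /= !rmorph0 rmorph1 !mul0r !addr0.
  move=> x y; rewrite [in LHS](coP x) [in LHS](coP y) /f.
  case: (co x) => [[[u0 u1] u2] u3]; case: (co y) => [[[v0 v1] v2] v3] /=.
  have -> : ev u0 u1 u2 u3 * ev v0 v1 v2 v3 =
    ev (u0 * v0 + zr b * zr c * u1 * v1 + zr a * zr c * u2 * v2 + zr a * zr b * u3 * v3)
       (u0 * v1 + u1 * v0 + zr a * (u2 * v3 + u3 * v2))
       (u0 * v2 + u2 * v0 + zr b * (u1 * v3 + u3 * v1))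
       (u0 * v3 + u3 * v0 + zr c * (u1 * v2 + u2 * v1)).
    rewrite /ev !aE.
    move: eP eQ eR; rewrite !rmorphM /= => eP eQ eR.
    rewrite -!eP -!eQ -!eR.
    transitivity (0 + (u0%:A * v0%:A + u1%:A * v1%:A * P ^+ 2 + u2%:A * v2%:A * Q ^+ 2 + u3%:A * v3%:A * R ^+ 2)
     + ((u0%:A * v1%:A + u1%:A * v0%:A) * P + (u2%:A * v3%:A + u3%:A * v2%:A) * (Q * R))
     + ((u0%:A * v2%:A + u2%:A * v0%:A) * Q + (u1%:A * v3%:A + u3%:A * v1%:A) * (P * R))
     + ((u0%:A * v3%:A + u3%:A * v0%:A) * R + (u1%:A * v2%:A + u2%:A * v1%:A) * (P * Q))).
      by ring.
    rewrite f1 f2 f3 eP eQ eR; ring.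
  rewrite -/(f _) fE /F /= !(rmorphD, rmorphM) /= !zr_rmorph -ea -eb -ec; ring.
pose g : {rmorphism K -> L} := HB.pack f
  (GRing.isZmodMorphism.Build K L f fB) (GRing.isMonoidMorphism.Build K L f fM).
exists g.
have e1 : P = ev 0 1 0 0 by rewrite /ev !scale0r scale1r !mul0r mul1r !addr0 add0r.
have e2 : Q = ev 0 0 1 0 by rewrite /ev !scale0r scale1r !mul0r mul1r !addr0 add0r.
have e3 : R = ev 0 0 0 1 by rewrite /ev !scale0r scale1r !mul0r mul1r !addr0 !add0r.
rewrite /g /= e1 e2 e3 !fE /F /= !(rmorph0, rmorph1).
by split; ring.
Qed.
End Embeddings.

(** * Integers in quarter coordinates *)

(** (x0 + x1 P + x2 Q + x3 R) / 4: every integer of K has this form with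
integers x0, ..., x3, and 4 is the least denominator that works for all K.
So [qmul] yields 16 times a product. *)
Record quad := Quad { q0 : Z; q1 : Z; q2 : Z; q3 : Z }.

Section QuadOps.
Local Open Scope Z_scope.
Variables a b c : Z.

Definition qadd (x y : quad) : quad :=
  Quad (q0 x + q0 y) (q1 x + q1 y) (q2 x + q2 y) (q3 x + q3 y).
Definition qsub (x y : quad) : quad :=
  Quad (q0 x - q0 y) (q1 x - q1 y) (q2 x - q2 y) (q3 x - q3 y).
Definition qscale (k : Z) (x : quad) : quad :=
  Quad (k * q0 x) (k * q1 x) (k * q2 x) (k * q3 x).
Definition qmul (x y : quad) : quad :=
  Quad (q0 x * q0 y + b * c * (q1 x * q1 y) + a * c * (q2 x * q2 y) + a * b * (q3 x * q3 y))
       (q0 x * q1 y + q1 x * q0 y + a * (q2 x * q3 y + q3 x * q2 y))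
       (q0 x * q2 y + q2 x * q0 y + b * (q1 x * q3 y + q3 x * q1 y))
       (q0 x * q3 y + q3 x * q0 y + c * (q1 x * q2 y + q2 x * q1 y)).

(** The conditions saying that x / 4 has an integral trace and an integral
norm over the field generated by P = sqrt m1. The trace is (x0 + x1 P) / 2,
its norm is the first condition divided by 4; the relative norm is (A / 8 + (T
/ 4) P) / 2 and the last condition is about its own norm. *)
Definition qint1 (m1 m2 m3 a x0 x1 x2 x3 : Z) : bool :=
  let A := x0 * x0 + m1 * (x1 * x1) - m2 * (x2 * x2) - m3 * (x3 * x3) in
  let T := x0 * x1 - a * (x2 * x3) in
  [&& (x0 * x0 - m1 * (x1 * x1)) mod 4 =? 0, A mod 8 =? 0, T mod 4 =? 0
    & ((A / 8) * (A / 8) - m1 * ((T / 4) * (T / 4))) mod 4 =? 0].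

Definition qint (x : quad) : bool :=
  let: Quad x0 x1 x2 x3 := x in
  [&& qint1 (b * c) (a * c) (a * b) a x0 x1 x2 x3,
      qint1 (a * c) (b * c) (a * b) b x0 x2 x1 x3
    & qint1 (a * b) (b * c) (a * c) c x0 x3 x1 x2].
End QuadOps.

Section IntegerP.
Local Open Scope Z_scope.
Lemma qint1P m1 m2 m3 a x0 x1 x2 x3 :
  qint1 m1 m2 m3 a x0 x1 x2 x3 <-> exists n A T N : Z,
    [/\ x0 * x0 - m1 * (x1 * x1) = 4 * n,
        x0 * x0 + m1 * (x1 * x1) - m2 * (x2 * x2) - m3 * (x3 * x3) = 8 * A,
        x0 * x1 - a * (x2 * x3) = 4 * T
      & A * A - m1 * (T * T) = 4 * N].
Proof.
rewrite /qint1; set n0 := x0 * x0 - _; set A0 := _ - m3 * _; set T0 := _ - a * _.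
clearbody n0 A0 T0; split.
  case/and4P=> /Z.eqb_eq m1' /Z.eqb_eq m2' /Z.eqb_eq m3' /Z.eqb_eq m4'.
  exists (n0 / 4), (A0 / 8), (T0 / 4), ((A0 / 8 * (A0 / 8) - m1 * (T0 / 4 * (T0 / 4))) / 4).
  by split; apply/Z.div_exact.
case=> n [A [T [N [-> -> -> eN]]]].
have D k m : 0 < m -> m * k / m = k by move=> m0; rewrite Z.mul_comm Z.div_mul //; lia.
have M k m : 0 < m -> (m * k) mod m = 0 by move=> m0; rewrite Z.mul_comm Z.mod_mul //; lia.
by apply/and4P; split; apply/Z.eqb_eq; rewrite ?D ?eN ?M.
Qed.
End IntegerP.

(** The conjugate of 4 times the element, at the place given by square roots
t = (ta, tb, tc) of a, b, c.  Changing the sign of at most one entry of t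
reaches the four places from any of them. *)
Definition cj (R : nzRingType) (t : R * R * R) (x : quad) : R :=
  zr (q0 x) + zr (q1 x) * (t.1.2 * t.2) + zr (q2 x) * (t.1.1 * t.2) + zr (q3 x) * (t.1.1 * t.1.2).

Definition sqrts (a b c : Z) (R : nzRingType) (t : R * R * R) : Prop :=
  [/\ t.1.1 ^+ 2 = zr a, t.1.2 ^+ 2 = zr b & t.2 ^+ 2 = zr c].

Section Conj.
Variables (a b c : Z) (R : comNzRingType) (t : R * R * R).
Lemma cjD x y : cj t (qadd x y) = cj t x + cj t y.
Proof. by rewrite /cj /qadd /=; ring. Qed.
Lemma cjB x y : cj t (qsub x y) = cj t x - cj t y.
Proof. by rewrite /cj /qsub /=; ring. Qed.
Lemma cjZ k x : cj t (qscale k x) = zr k * cj t x.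
Proof. by rewrite /cj /qscale /=; ring. Qed.
Lemma cjM x y : sqrts a b c t -> cj t (qmul a b c x y) = cj t x * cj t y.
Proof.
case: t => [[ta tb] tc] [/= ea eb ec].
rewrite /cj /qmul /=.
have EZ (u v : Z) : zr (Z.mul u v) = zr u * zr v :> R by ring.
have ED (u v : Z) : zr (Z.add u v) = zr u + zr v :> R by ring.
rewrite !(EZ, ED) -ea -eb -ec; ring.
Qed.
End Conj.

Lemma algR_sqrt (x : algR) : 0 <= x -> exists y : algR, 0 <= y /\ y ^+ 2 = x.
Proof.
move=> x0; have x0' : 0 <= algRval x by exact: x0.
have r : sqrtC (algRval x) \is Num.real by rewrite ger0_real // sqrtC_ge0.
exists (in_algR r); split; first by rewrite -[_ <= _]/(0 <= sqrtC _) sqrtC_ge0.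
by apply: val_inj; rewrite /= -expr2 sqrtCK.
Qed.

Lemma sqrts_exist a b c : 0 < a -> 0 < b -> 0 < c ->
  exists t : algR * algR * algR,
    [/\ sqrts a b c t, 0 < t.1.1, 0 < t.1.2 & 0 < t.2].
Proof.
have H z : 0 < z -> exists2 y : algR, 0 < y & y ^+ 2 = zr z.
  move=> z0; have [|y [y0 e]] := @algR_sqrt (zr z); first by rewrite zr_ge0 ltW.
  exists y => //; rewrite lt_def y0 andbT; apply/eqP => y0'.
  have : (0 < zr z :> algR) by rewrite zr_gt0.
  by rewrite -e y0' expr0n ltxx.
move=> /H[ta ? ?] /H[tb ? ?] /H[tc ? ?].
by exists (ta, tb, tc).
Qed.

Section Integrality.
Lemma integral_map (A B : nzRingType) (f : {rmorphism A -> B}) x :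
  integralOver (intr : int -> A) x -> integralOver (intr : int -> B) (f x).
Proof.
case=> p mp rp; exists p => //.
have -> : map_poly (intr : int -> B) p = map_poly f (map_poly (intr : int -> A) p).
  by rewrite -map_poly_comp; apply: eq_map_poly => z /=; rewrite rmorph_int.
exact: rmorph_root.
Qed.

(** The rational algebraic integers are the integers. *)
Lemma integral_rat_int (s : rat) :
  integralOver (intr : int -> algR) (ratr s) -> exists z : Z, s = zr z.
Proof.
move/(@integral_map _ _ algRval); rewrite fmorph_rat => -[p mp rp].
have : ratr s \in Aint.
  apply: (root_monic_Aint rp); first exact: monic_map.
  by apply/polyOverP => i; rewrite coef_map /= intr_int.
move=> /(Cint_rat_Aint _) H.
have /intrP[m e] : (ratr s : algC) \in Num.int by apply: H; apply/CratP; exists s.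
exists (Z_of_int m); rewrite /zr Z_of_intK.
by apply: (fmorph_inj (ratr : rat -> algC)); rewrite /= e ratr_int.
Qed.

Variables (K : fieldExtType rat) (a b c : Z) (P Q R : K).
Hypotheses (hg : radical_triple a b c) (hr : radical_basis a b c P Q R).

Definition evq (x : quad) : K := zr (q0 x) + zr (q1 x) * P + zr (q2 x) * Q + zr (q3 x) * R.

Let ev (u0 u1 u2 u3 : rat) : K := u0%:A + u1%:A * P + u2%:A * Q + u3%:A * R.

Lemma emb_alg (f : {rmorphism K -> algR}) (u : rat) : f (u%:A) = ratr u.
Proof. exact: (fmorph_eq_rat (f \o in_alg K)). Qed.

Lemma emb_ev (f : {rmorphism K -> algR}) u0 u1 u2 u3 :
  f (ev u0 u1 u2 u3) = ratr u0 + ratr u1 * f P + ratr u2 * f Q + ratr u3 * f R.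
Proof. by rewrite /ev !rmorphD !rmorphM !emb_alg. Qed.

Lemma emb_evq (f : {rmorphism K -> algR}) (t : algR * algR * algR) x :
  f P = t.1.2 * t.2 -> f Q = t.1.1 * t.2 -> f R = t.1.1 * t.1.2 -> f (evq x) = cj t x.
Proof. by move=> h1 h2 h3; rewrite /evq /cj !rmorphD !rmorphM /= !zr_rmorph h1 h2 h3. Qed.

Lemma integral_conj (x : K) (t : algR * algR * algR) u0 u1 u2 u3 :
  in_OK x -> x = ev u0 u1 u2 u3 -> sqrts a b c t ->
  integralOver (intr : int -> algR)
   (ratr u0 + ratr u1 * (t.1.2 * t.2) + ratr u2 * (t.1.1 * t.2) + ratr u3 * (t.1.1 * t.1.2)).
Proof.
case: t => [[ta tb] tc] hx ex [/= ea eb ec].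
have [f [<- <- <-]] := embedding hg hr ea eb ec.
by rewrite -emb_ev -ex; apply: integral_map.
Qed.

Let zrM (L : nzRingType) (u v : Z) : zr (u * v) = zr u * zr v :> L.
Proof. exact: rmorphM. Qed.
Let rX (L : numFieldType) (u : rat) n : ratr (u ^+ n) = ratr u ^+ n :> L.
Proof. exact: rmorphXn. Qed.
Let rD (L : numFieldType) (u v : rat) : ratr (u + v) = ratr u + ratr v :> L.
Proof. exact: rmorphD. Qed.
Let rB (L : numFieldType) (u v : rat) : ratr (u - v) = ratr u - ratr v :> L.
Proof. exact: rmorphB. Qed.
Let rN (L : numFieldType) (u : rat) : ratr (- u) = - ratr u :> L.
Proof. exact: rmorphN. Qed.
Let rM (L : numFieldType) (u v : rat) : ratr (u * v) = ratr u * ratr v :> L.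
Proof. exact: rmorphM. Qed.
Let rZ (L : numFieldType) (z : Z) : ratr (zr z) = zr z :> L.
Proof. exact: zr_rmorph. Qed.
Let rn (L : numFieldType) n : ratr (n%:R : rat) = n%:R :> L.
Proof. exact: ratr_nat. Qed.
Let rE := (rX, rD, rB, rN, rM, rZ, rn).

(** Symmetric expressions of the four conjugates are rational and integral. The
third and fourth come from the rational and irrational parts of the norm over
the field generated by P; the last is the norm over the rationals. *)
Lemma integral_traces (x : K) u0 u1 u2 u3 : in_OK x -> x = ev u0 u1 u2 u3 ->
  [/\ exists x0, 4 * u0 = zr x0,
      exists n, 4 * (u0 ^+ 2 - zr (b * c) * u1 ^+ 2) = zr n,
      exists A, 2 * (u0 ^+ 2 + zr (b * c) * u1 ^+ 2 - zr (a * c) * u2 ^+ 2 - zr (a * b) * u3 ^+ 2) = zr A,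
      exists T, zr (b * c) * (4 * (u0 * u1 - zr a * (u2 * u3))) ^+ 2 = zr T
    & exists N, (u0 ^+ 2 + zr (b * c) * u1 ^+ 2 - zr (a * c) * u2 ^+ 2 - zr (a * b) * u3 ^+ 2) ^+ 2
        - 4 * zr (b * c) * (u0 * u1 - zr a * (u2 * u3)) ^+ 2 = zr N].
Proof.
move=> hx ex; case: (hg) => [[pa pb pc] _ _].
have [[[ta tb] tc] [[/= ea eb ec] _ _ _]] := sqrts_exist pa pb pc.
have I t := @integral_conj x t u0 u1 u2 u3 hx ex.
have /= I1 := I (ta, tb, tc) (And3 ea eb ec).
have /= I2 := I (- ta, tb, tc) (And3 (etrans (sqrrN _) ea) eb ec).
have /= I3 := I (ta, - tb, tc) (And3 ea (etrans (sqrrN _) eb) ec).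
have /= I4 := I (ta, tb, - tc) (And3 ea eb (etrans (sqrrN _) ec)).
move: I1 I2 I3 I4.
set s1 := (X in integralOver _ X); move=> I1.
set s2 := (X in integralOver _ X); move=> I2.
set s3 := (X in integralOver _ X); move=> I3.
set s4 := (X in integralOver _ X); move=> I4.
have nn y (s : rat) : integralOver (intr : int -> algR) y -> y = ratr s -> exists z : Z, s = zr z.
  by move=> + e; rewrite e; apply: integral_rat_int.
split.
- apply: (nn (s1 + s2 + (s3 + s4))); first exact: (integral_add (integral_add I1 I2) (integral_add I3 I4)).
  by rewrite rM rn /s1 /s2 /s3 /s4; ring.
- apply: (nn ((s1 + s2) * (s3 + s4))); first exact: (integral_mul (integral_add I1 I2) (integral_add I3 I4)).
  by rewrite !(rE, zrM) -eb -ec /s1 /s2 /s3 /s4; ring.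
- apply: (nn (s1 * s2 + s3 * s4)); first exact: (integral_add (integral_mul I1 I2) (integral_mul I3 I4)).
  by rewrite !(rE, zrM) -ea -eb -ec /s1 /s2 /s3 /s4; ring.
- apply: (nn ((s1 * s2 - s3 * s4) * (s1 * s2 - s3 * s4))).
    have J := integral_sub (integral_mul I1 I2) (integral_mul I3 I4).
    exact: (integral_mul J J).
  by rewrite !(rE, zrM) -ea -eb -ec /s1 /s2 /s3 /s4; ring.
- apply: (nn (s1 * s2 * (s3 * s4))); first exact: (integral_mul (integral_mul I1 I2) (integral_mul I3 I4)).
  by rewrite !(rE, zrM) -ea -eb -ec /s1 /s2 /s3 /s4; ring.
Qed.
End Integrality.

Section Coordinates.
Variable K : fieldExtType rat.
Let ev (P Q R : K) (u0 u1 u2 u3 : rat) : K := u0%:A + u1%:A * P + u2%:A * Q + u3%:A * R.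

Let zrM (L : nzRingType) (u v : Z) : zr (u * v) = zr u * zr v :> L.
Proof. exact: rmorphM. Qed.

(** The trace of x over the field generated by P has an integral norm, so that
bc (4 u1)^2 is an integer, and bc is squarefree. *)
Lemma coord_int a b c P Q R (x : K) u0 u1 u2 u3 :
  radical_triple a b c -> radical_basis a b c P Q R -> in_OK x -> x = ev P Q R u0 u1 u2 u3 ->
  (exists x0, 4 * u0 = zr x0) /\ (exists x1, 4 * u1 = zr x1).
Proof.
move=> hg hr hx ex; have [[x0 e0] [n en] _ _ _] := integral_traces hg hr hx ex.
split; first by exists x0.
case: hg => _ [h1 _ _] _; apply: (sqf_rat_int (n := x0 * x0 - 4 * n) h1).
transitivity (zr x0 * zr x0 - 4 * zr n : rat); last by ring.
by rewrite -e0 -en !zrM; ring.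
Qed.

Lemma coord_qint1 a b c P Q R (x : K) u0 u1 u2 u3 x0 x1 x2 x3 :
  radical_triple a b c -> radical_basis a b c P Q R -> in_OK x -> x = ev P Q R u0 u1 u2 u3 ->
  4 * u0 = zr x0 -> 4 * u1 = zr x1 -> 4 * u2 = zr x2 -> 4 * u3 = zr x3 ->
  qint1 (b * c) (a * c) (a * b) a x0 x1 x2 x3.
Proof.
move=> hg hr hx ex e0 e1 e2 e3.
have [_ [n en] [A eA] [T eT] [N eN]] := integral_traces hg hr hx ex.
case: (hg) => _ [h1 _ _] _.
have [T' eT'] := sqf_rat_int h1 eT.
have E0 : (x0 * x0 - (b * c)%R * (x1 * x1) = 4 * n)%Z.
  apply: (@zr_inj rat); transitivity (zr x0 * zr x0 - zr (b * c) * (zr x1 * zr x1) : rat); first by ring.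
  by transitivity (4 * zr n : rat); [rewrite -e0 -e1 -en; ring | ring].
have EA : (x0 * x0 + (b * c)%R * (x1 * x1) - (a * c)%R * (x2 * x2) - (a * b)%R * (x3 * x3) = 8 * A)%Z.
  apply: (@zr_inj rat).
  transitivity (zr x0 * zr x0 + zr (b * c) * (zr x1 * zr x1) - zr (a * c) * (zr x2 * zr x2)
    - zr (a * b) * (zr x3 * zr x3) : rat); first by ring.
  by transitivity (8 * zr A : rat); [rewrite -e0 -e1 -e2 -e3 -eA; ring | ring].
have ET : (x0 * x1 - a * (x2 * x3) = 4 * T')%Z.
  apply: (@zr_inj rat); transitivity (zr x0 * zr x1 - zr a * (zr x2 * zr x3) : rat); first by ring.
  by transitivity (4 * zr T' : rat); [rewrite -e0 -e1 -e2 -e3 -eT'; ring | ring].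
have EN : (A * A - (b * c)%R * (T' * T') = 4 * N)%Z.
  apply: (@zr_inj rat); transitivity (zr A * zr A - zr (b * c) * (zr T' * zr T') : rat); first by ring.
  by transitivity (4 * zr N : rat); [rewrite -eA -eT' -eN; ring | ring].
by apply/qint1P; exists n, A, T', N.
Qed.

Lemma integral_coords a b c P Q R (x : K) :
  radical_triple a b c -> radical_basis a b c P Q R -> in_OK x ->
  exists q, qint a b c q /\ 4 * x = evq P Q R q.
Proof.
move=> hg hr hx.
have hg2 := radical_triple_swap12 hg; have hr2 := radical_basis_swap12 hr.
have hg3 := radical_triple_swap12 (radical_triple_swap23 hg); have hr3 := radical_basis_swap12 (radical_basis_swap23 hr).
have [u0 [u1 [u2 [u3 ex]]]] : exists u0 u1 u2 u3, x = ev P Q R u0 u1 u2 u3.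
  by case: hr => _ _ _ [_ _ _].
have ex2 : x = ev Q P R u0 u2 u1 u3 by rewrite ex /ev (addrAC u0%:A).
have ex3 : x = ev R P Q u0 u3 u1 u2 by rewrite ex /ev addrAC (addrAC u0%:A).
have [[x0 e0] [x1 e1]] := coord_int hg hr hx ex.
have [_ [x2 e2]] := coord_int hg2 hr2 hx ex2.
have [_ [x3 e3]] := coord_int hg3 hr3 hx ex3.
exists (Quad x0 x1 x2 x3); split.
  rewrite /qint (coord_qint1 hg hr hx ex e0 e1 e2 e3).
  have := coord_qint1 hg2 hr2 hx ex2 e0 e2 e1 e3.
  have := coord_qint1 hg3 hr3 hx ex3 e0 e3 e1 e2.
  rewrite (Z.mul_comm c b) (Z.mul_comm b a) (Z.mul_comm c a) => -> ->.
  by [].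
rewrite ex /evq /ev /=.
have z (u : rat) k : 4 * u = zr k -> 4 * u%:A = zr k :> K.
  by move=> e; rewrite -(zr_rmorph (in_alg K)) -e rmorphM rmorph_nat.
rewrite !mulrDr !mulrA !(z _ _ e0, z _ _ e1, z _ _ e2, z _ _ e3); ring.
Qed.

(** An element is a root of a quadratic polynomial whose coefficients, its
relative trace and norm, are integral by the same argument. *)
Lemma qint_integral a b c P Q R q :
  radical_triple a b c -> radical_basis a b c P Q R -> qint a b c q -> in_OK (evq P Q R q / 4 : K).
Proof.
move=> hg [eP eQ eR [f1 f2 f3 _]]; case: q => x0 x1 x2 x3 /and3P[+ _ _].
case/qint1P=> n [A [T [N [en eA eT eN]]]].
have eight : (8 : K) != 0 by rewrite -(rmorph_nat (in_alg K)) fmorph_eq0.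
have four : (4 : K) != 0 by rewrite -(rmorph_nat (in_alg K)) fmorph_eq0.
have two : (2 : K) != 0 by rewrite -(rmorph_nat (in_alg K)) fmorph_eq0.
have iz z : in_OK (zr z : K) by exact: integral_id.
have i0 : in_OK (0 : K) by have := iz Z0; rewrite rmorph0.
have i1 : in_OK (1 : K) by have := iz (Zpos xH); rewrite rmorph1.
have quadr (z s t : K) : in_OK s -> in_OK t -> z ^+ 2 - s * z + t = 0 -> in_OK z.
  move=> hs ht hz.
  pose p : {poly K} := 'X^2 + (t%:P - s *: 'X).
  have sp : (size (t%:P - s *: 'X)%R < size ('X^2 : {poly K}))%N.
    rewrite size_polyXn (leq_ltn_trans (size_polyD _ _)) // gtn_max size_polyN.
    rewrite (leq_ltn_trans (size_polyC_leq1 _)) //.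
    by rewrite (leq_ltn_trans (size_scale_leq _ _)) // size_polyX.
  apply: (@integral_root_monic _ _ _ z p).
  - by apply/monicP; rewrite /p lead_coefDl // lead_coefXn.
  - rewrite /root /p !hornerD hornerN hornerC hornerZ hornerXn hornerX; apply/eqP; rewrite -hz. by ring.
  - apply/integral_poly => i; rewrite /p !coefE.
    apply: integral_add; first by case: eqP => _ /=; [exact: i1 | exact: i0].
    apply: integral_sub; first by case: eqP => _; [exact: ht | exact: i0].
    by apply: integral_mul => //; case: eqP => _ /=; [exact: i1 | exact: i0].
have Z4 (u v m k : Z) : (u * u - m * (v * v) = 4 * k)%Z ->
    zr u * zr u - zr m * (zr v * zr v) = 4 * zr k :> K.
  move=> e; etransitivity; last first; [etransitivity; [exact: (congr1 (@zr K) e) | ring] | ring].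
have half (u v k : Z) : (u * u - (b * c)%R * (v * v) = 4 * k)%Z -> in_OK ((zr u + zr v * P) / 2).
  move=> /Z4; rewrite -eP => e.
  apply: (quadr _ (zr u) (zr k)) => //.
  have -> : zr k = (zr u * zr u - P ^+ 2 * (zr v * zr v)) / 4 :> K by rewrite e; field.
  by field; rewrite ?two ?four.
have ht := half _ _ _ en; have hn := half _ _ _ eN.
apply: (quadr _ _ _ ht hn).
have EA : zr x0 * zr x0 + P ^+ 2 * (zr x1 * zr x1) - Q ^+ 2 * (zr x2 * zr x2)
    - R ^+ 2 * (zr x3 * zr x3) = 8 * zr A :> K.
  rewrite eP eQ eR; etransitivity; last first; [etransitivity; [exact: (congr1 (@zr K) eA) | ring] | ring].
have ET : zr x0 * zr x1 - zr a * (zr x2 * zr x3) = 4 * zr T :> K.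
  etransitivity; last first; [etransitivity; [exact: (congr1 (@zr K) eT) | ring] | ring].
have -> : zr A + zr T * P = (zr x0 * zr x0 + P ^+ 2 * (zr x1 * zr x1) - Q ^+ 2 * (zr x2 * zr x2)
    - R ^+ 2 * (zr x3 * zr x3)) / 8 + (zr x0 * (zr x1 * P) - Q * R * (zr x2 * zr x3)) / 4.
  rewrite EA (_ : zr x0 * (zr x1 * P) - Q * R * (zr x2 * zr x3) = (zr x0 * zr x1 - zr a * (zr x2 * zr x3)) * P).
    by rewrite ET; field; rewrite four eight.
  by rewrite f1; ring.
by rewrite /evq /=; field; rewrite ?two ?four ?eight.
Qed.
End Coordinates.

(** * The binary lattice of a universal ternary form *)

Notation sqroots a b c := (@sqrts a b c algR).

Definition det3 (R : pzRingType) (a1 a2 a3 b12 b13 b23 : R) : R :=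
  a1 * (a2 * a3 - b23 * b23) - b12 * (b12 * a3 - b23 * b13) + b13 * (b12 * b23 - a2 * b13).

(** What the proof uses about the orthogonal complement M of a vector of norm
1: [G y z] is the scalar product of y and z in quarter coordinates.  The five
clauses are integrality, positivity, the Cauchy-Schwarz inequality, the
representation of totally positive integers by x^2 + Q(y), and rank at most
two. *)
Definition binary_universal (a b c : Z) : Prop :=
  exists (M : Type) (G : M -> M -> quad),
  [/\ forall y z, qint a b c (G y z),
      forall t y, sqroots a b c t -> 0 <= cj t (G y y),
      forall t y z, sqroots a b c t -> cj t (G y z) ^+ 2 <= cj t (G y y) * cj t (G z z),
      forall g, qint a b c g -> (forall t, sqroots a b c t -> 0 < cj t g) ->
        exists x y, qint a b c x /\ qscale 4 g = qadd (qmul a b c x x) (qscale 4 (G y y))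
    & forall t y1 y2 y3, sqroots a b c t ->
        det3 (cj t (G y1 y1)) (cj t (G y2 y2)) (cj t (G y3 y3))
             (cj t (G y1 y2)) (cj t (G y1 y3)) (cj t (G y2 y3)) = 0].

Section Positivity.
Variables (K : fieldExtType rat) (a b c : Z) (P Q R : K).
Hypotheses (hg : radical_triple a b c) (hr : radical_basis a b c P Q R).
Let ev := (evq P Q R).

Lemma evq_inj x y : ev x = ev y -> x = y.
Proof.
case: x y => x0 x1 x2 x3 [y0 y1 y2 y3] e.
have zA (z : Z) : zr z = (zr z)%:A :> K by exact: esym (zr_rmorph (in_alg K) z).
have := @indep4 K a b c P Q R hg hr (zr (x0 - y0)%R) (zr (x1 - y1)%R) (zr (x2 - y2)%R) (zr (x3 - y3)%R).
rewrite -!zA.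
have -> : zr (x0 - y0)%R + zr (x1 - y1)%R * P + zr (x2 - y2)%R * Q + zr (x3 - y3)%R * R = 0.
  by move/eqP: e; rewrite -subr_eq0 /ev /evq /= => /eqP <-; ring.
have Z0 (z w : Z) : zr (z - w)%R = 0 :> rat -> z = w.
  by move/eqP; rewrite rmorphB subr_eq0 => /eqP/(@zr_inj rat).
by case=> // /Z0-> /Z0-> /Z0-> /Z0->.
Qed.

Lemma evqM x y : ev (qmul a b c x y) = ev x * ev y.
Proof.
case: hr => eP eQ eR [f1 f2 f3 _]; rewrite /ev /evq /qmul /=.
have EZ (u v : Z) : zr (Z.mul u v) = zr u * zr v :> K by ring.
have ED (u v : Z) : zr (Z.add u v) = zr u + zr v :> K by ring.
move: eP eQ eR; rewrite !(EZ, ED) => eP eQ eR.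
rewrite -eP -eQ -eR.
transitivity (0 + (zr (q0 x) * zr (q0 y) + zr (q1 x) * zr (q1 y) * P ^+ 2 + zr (q2 x) * zr (q2 y) * Q ^+ 2 + zr (q3 x) * zr (q3 y) * R ^+ 2)
     + (zr (q0 x) * zr (q1 y) + zr (q1 x) * zr (q0 y)) * P + (zr (q2 x) * zr (q3 y) + zr (q3 x) * zr (q2 y)) * (zr a * P)
     + (zr (q0 x) * zr (q2 y) + zr (q2 x) * zr (q0 y)) * Q + (zr (q1 x) * zr (q3 y) + zr (q3 x) * zr (q1 y)) * (zr b * Q)
     + (zr (q0 x) * zr (q3 y) + zr (q3 x) * zr (q0 y)) * R + (zr (q1 x) * zr (q2 y) + zr (q2 x) * zr (q1 y)) * (zr c * R)).
  by ring.
by rewrite -f1 -f2 -f3; ring.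
Qed.

(** A complex embedding is determined by the signs of the images of P and Q,
which can be moved into the square roots of b and a; P Q = c R determines the
image of R. *)
Lemma embedding_of (s : {rmorphism K -> algC}) :
  exists t, sqroots a b c t /\ forall q, s (ev q) = algRval (cj t q).
Proof.
case: (hg) => [[a0 b0 c0] _ _]; case: (hr) => eP eQ eR [f1 f2 f3 _].
have [[[ta tb] tc] [[/= ea eb ec] pa pb pc]] := sqrts_exist a0 b0 c0.
have sq (x : K) (y : algR) (z : Z) : x ^+ 2 = zr z -> y ^+ 2 = zr z ->
    exists e : bool, s x = algRval ((-1) ^+ e * y).
  move=> ex ey; have : s x ^+ 2 = (algRval y) ^+ 2.
    by rewrite -rmorphXn ex zr_rmorph -rmorphXn ey zr_rmorph.
  move/eqP; rewrite eqf_sqr => /orP[/eqP->|/eqP->].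
    by exists false; rewrite mul1r.
  by exists true; rewrite mulN1r rmorphN.
have zz (u v : Z) : zr (Z.mul u v) = zr u * zr v :> algR by ring.
have [e1 h1] : exists e : bool, s P = algRval ((-1) ^+ e * (tb * tc)).
  by apply: (sq _ _ _ eP); rewrite exprMn eb ec -zz.
have [e2 h2] : exists e : bool, s Q = algRval ((-1) ^+ e * (ta * tc)).
  by apply: (sq _ _ _ eQ); rewrite exprMn ea ec -zz.
exists ((-1) ^+ e2 * ta, (-1) ^+ e1 * tb, tc); split.
  by split; rewrite /= ?exprMn ?sqrr_sign ?mul1r.
move=> q; rewrite /ev /evq /cj !rmorphD !rmorphM /= !zr_rmorph.
have s2 (e : bool) : (-1) ^+ e * (-1) ^+ e = 1 :> algR by rewrite -expr2 sqrr_sign.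
have h3 : s R = algRval ((-1) ^+ e2 * ta * ((-1) ^+ e1 * tb)).
  have c1 : zr c != 0 :> algC by rewrite gt_eqF // zr_gt0.
  apply: (mulfI c1); rewrite -[in LHS](zr_rmorph s) -rmorphM -f3 rmorphM h1 h2.
  by rewrite -[in RHS](zr_rmorph algRval) -!rmorphM -ec; congr algRval; ring.
by rewrite h1 h2 h3 !rmorphM /=; ring.
Qed.

Lemma totally_positive_evq q :
  (forall t, sqroots a b c t -> 0 < cj t q) -> totally_positive (ev q / 4).
Proof.
move=> h s; have [t [ht e]] := embedding_of s.
rewrite rmorphM fmorphV rmorph_nat e; apply: mulr_gt0; last by rewrite invr_gt0 ltr0n.
exact: (h t ht).
Qed.

Lemma embedding_real t : sqroots a b c t ->
  exists f : {rmorphism K -> algR}, forall x q, 4 * x = ev q -> f x *+ 4 = cj t q.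
Proof.
case: t => [[ta tb] tc] [/= ea eb ec].
have [f [h1 h2 h3]] := embedding hg hr ea eb ec.
exists f => x q e; rewrite -(@emb_evq K P Q R f (ta, tb, tc)) // -/ev -e rmorphM rmorph_nat.
by rewrite mulr_natl.
Qed.
End Positivity.

Section Form.
Variables (K : fieldExtType rat) (A : 'M[K]_3).
Hypotheses (hA : qform_over_OK A) (hC : classical A) (hP : totally_positive_definite A)
  (hU : universal A).

(** The symmetric matrix of the form, which is integral because the form is
classical. *)
Definition gram (i j : 'I_3) : K :=
  if (i < j)%N then A i j / 2 else if (j < i)%N then A j i / 2 else A i i.

Definition bil (x y : 'rV[K]_3) : K := \sum_i \sum_j gram i j * x 0 i * y 0 j.

Let two : (2 : K) != 0. Proof. by rewrite -(rmorph_nat (in_alg K)) fmorph_eq0. Qed.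

Lemma bilC x y : bil x y = bil y x.
Proof.
rewrite /bil exchange_big; apply: eq_bigr => i _; apply: eq_bigr => j _.
by rewrite /gram; case: ltngtP => [_|_|/val_inj ->]; rewrite mulrAC.
Qed.

Lemma bilDl k x y z : bil (k *: x + y) z = k * bil x z + bil y z.
Proof.
rewrite /bil mulr_sumr -big_split; apply: eq_bigr => i _ /=.
rewrite mulr_sumr -big_split; apply: eq_bigr => j _ /=.
by rewrite !mxE; ring.
Qed.

Lemma bilBl x k y z : bil (x - k *: y) z = bil x z - k * bil y z.
Proof. by rewrite addrC -scaleNr bilDl; ring. Qed.

Lemma bilBr x k y z : bil z (x - k *: y) = bil z x - k * bil z y.
Proof. by rewrite bilC bilBl ![bil _ z]bilC. Qed.

Lemma bilZl k x z : bil (k *: x) z = k * bil x z.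
Proof.
have -> : k *: x = k *: x + 0 by rewrite addr0.
rewrite bilDl; have -> : bil 0 z = 0; last by rewrite addr0.
by rewrite /bil big1 // => i _; rewrite big1 // => j _; rewrite !mxE mulr0 mul0r.
Qed.

Lemma bil0l z : bil 0 z = 0.
Proof. by rewrite -(scale0r 0) bilZl mul0r. Qed.

Lemma bil_qform x : bil x x = qform A x.
Proof.
have -> : qform A x = \sum_(i < 3) \sum_(j < 3) (if (i <= j)%N then A i j * x 0 i * x 0 j else 0).
  by apply: eq_bigr => i _; rewrite big_mkcond.
rewrite /bil !big_ord_recl !big_ord0 /gram /=.
by field.
Qed.

Lemma gram_integral i j : in_OK (gram i j).
Proof.
rewrite /gram; case: ltngtP => [ij|ji|_].
- by have [b hb ->] := hC ij; rewrite mulrAC divff // mul1r.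
- by have [b hb ->] := hC ji; rewrite mulrAC divff // mul1r.
- exact: hA (leqnn i).
Qed.

Lemma integral_sum (I : finType) (F : I -> K) :
  (forall i, in_OK (F i)) -> in_OK (\sum_i F i).
Proof.
move=> h; elim/big_rec: _ => [|i x _ hx]; first exact: integral0.
by apply: integral_add => //; apply: h.
Qed.

Lemma bil_integral x y : in_OKn x -> in_OKn y -> in_OK (bil x y).
Proof.
move=> hx hy; apply: integral_sum => i; apply: integral_sum => j.
apply: integral_mul; last exact: hy.
by apply: integral_mul; [exact: gram_integral | exact: hx].
Qed.

Lemma in_OKn_lin (x : 'rV[K]_3) (k : K) (y : 'rV[K]_3) : in_OKn x -> in_OK k -> in_OKn y -> in_OKn (x - k *: y).
Proof.
move=> hx hk hy i; rewrite !mxE; apply: integral_sub; first exact: hx.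
by apply: integral_mul; [exact: hk | exact: hy].
Qed.

Lemma bil_pos (f : {rmorphism K -> algR}) x : in_OKn x -> x != 0 -> 0 < f (bil x x).
Proof.
move=> hx /eqP x0; rewrite bil_qform.
exact: (hP hx x0 (algRval \o f)).
Qed.

Lemma bil_ge0 (f : {rmorphism K -> algR}) x : in_OKn x -> 0 <= f (bil x x).
Proof.
move=> hx; have [->|x0] := eqVneq x 0; first by rewrite bil0l rmorph0.
exact/ltW/bil_pos.
Qed.

(** The form is nonnegative at B(y,y) x - B(x,y) y, where its value is
B(y,y) (B(x,x) B(y,y) - B(x,y)^2). *)
Lemma bil_CS (f : {rmorphism K -> algR}) x y : in_OKn x -> in_OKn y ->
  f (bil x y) ^+ 2 <= f (bil x x) * f (bil y y).
Proof.
move=> hx hy; have [->|y0] := eqVneq y 0.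
  by rewrite bilC !bil0l rmorph0 expr0n mulr0.
have py := bil_pos f hy y0.
set z := bil y y *: x - bil x y *: y.
have hz : in_OKn z.
  apply: in_OKn_lin => // [i|]; last exact: bil_integral.
  by rewrite mxE; apply: integral_mul; [exact: bil_integral | exact: hx].
have := bil_ge0 f hz.
have -> : bil z z = bil y y * (bil x x * bil y y - bil x y ^+ 2).
  have E w : bil z w = bil y y * bil x w - bil x y * bil y w by rewrite /z bilBl bilZl.
  by rewrite E (bilC x z) (bilC y z) !E (bilC y x); ring.
by rewrite rmorphM rmorphB rmorphM rmorphXn pmulr_rge0 // subr_ge0.
Qed.

(** Four vectors of a space of dimension three are dependent. The coefficient
of v in the relation is 0, by taking the product with v, so the other three
form a nonzero vector in the kernel of the Gram matrix. *)
Lemma det3_eq0 (v : 'rV[K]_3) (y1 y2 y3 : 'rV[K]_3) : bil v v = 1 ->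
  bil y1 v = 0 -> bil y2 v = 0 -> bil y3 v = 0 ->
  det3 (bil y1 y1) (bil y2 y2) (bil y3 y3) (bil y1 y2) (bil y1 y3) (bil y2 y3) = 0.
Proof.
move=> vv h1 h2 h3.
pose V : 'M[K]_(4, 3) := \matrix_(i < 4) [:: v; y1; y2; y3]`_i.
have /rowV0Pn[u uk u0] : kermx V != 0.
  rewrite -mxrank_eq0 mxrank_ker subn_eq0 -ltnNge.
  by apply: leq_ltn_trans (rank_leq_col V) _.
have uV : u *m V = 0 by apply/sub_kermxP.
have e : u 0 0 *: v + (u 0 1 *: y1 + (u 0 2%:R *: y2 + u 0 3%:R *: y3)) = 0.
  rewrite -uV mulmx_sum_row !big_ord_recl big_ord0 addr0 !rowK /=.
  congr (_ + (_ + (_ + _))); congr (u 0 _ *: _); exact: val_inj.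
have E w : u 0 0 * bil v w + (u 0 1 * bil y1 w + (u 0 2%:R * bil y2 w + u 0 3%:R * bil y3 w)) = 0.
  by rewrite -(bilZl _ y3) -!bilDl e bil0l.
have := E v; rewrite vv h1 h2 h3 !mulr0 !addr0 mulr1 => c0.
have := E y1; rewrite c0 mul0r add0r (bilC y2 y1) (bilC y3 y1) => E1.
have := E y2; rewrite c0 mul0r add0r (bilC y3 y2) => E2.
have := E y3; rewrite c0 mul0r add0r => E3.
set d := det3 _ _ _ _ _ _.
apply/eqP; apply: contraNT u0 => d0.
have zero (k : K) : d * k = 0 -> k = 0 by move/eqP; rewrite mulf_eq0 (negPf d0) => /eqP.
have c1 : u 0 1 = 0.
  apply: zero; rewrite /d /det3.
  pose m11 := bil y2 y2 * bil y3 y3 - bil y2 y3 * bil y2 y3.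
  pose m12 := bil y1 y3 * bil y2 y3 - bil y1 y2 * bil y3 y3.
  pose m13 := bil y1 y2 * bil y2 y3 - bil y1 y3 * bil y2 y2.
  by rewrite -[RHS](addr0 0) -[X in _ = X + _](mulr0 m11) -[X in _ = _ + X](addr0 0)
     -[X in _ = _ + (X + _)](mulr0 m12) -[X in _ = _ + (_ + X)](mulr0 m13)
     -{1}E1 -{1}E2 -E3 /m11 /m12 /m13; ring.
have c2 : u 0 2%:R = 0.
  move: E1 E2 E3; rewrite c1 !mul0r !add0r => E1 E2 E3.
  apply: zero; rewrite /d /det3.
  pose m21 := bil y1 y3 * bil y2 y3 - bil y1 y2 * bil y3 y3.
  pose m22 := bil y1 y1 * bil y3 y3 - bil y1 y3 * bil y1 y3.
  pose m23 := bil y1 y3 * bil y1 y2 - bil y1 y1 * bil y2 y3.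
  by rewrite -[RHS](addr0 0) -[X in _ = X + _](mulr0 m21) -[X in _ = _ + X](addr0 0)
     -[X in _ = _ + (X + _)](mulr0 m22) -[X in _ = _ + (_ + X)](mulr0 m23)
     -{1}E1 -{1}E2 -E3 /m21 /m22 /m23; ring.
have c3 : u 0 3%:R = 0.
  move: E1 E2 E3; rewrite c1 c2 !mul0r !add0r => E1 E2 E3.
  apply: zero; rewrite /d /det3.
  pose m31 := bil y1 y2 * bil y2 y3 - bil y2 y2 * bil y1 y3.
  pose m32 := bil y1 y2 * bil y1 y3 - bil y1 y1 * bil y2 y3.
  pose m33 := bil y1 y1 * bil y2 y2 - bil y1 y2 * bil y1 y2.
  by rewrite -[RHS](addr0 0) -[X in _ = X + _](mulr0 m31) -[X in _ = _ + X](addr0 0)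
     -[X in _ = _ + (X + _)](mulr0 m32) -[X in _ = _ + (_ + X)](mulr0 m33)
     -{1}E1 -{1}E2 -E3 /m31 /m32 /m33; ring.
apply/eqP/rowP => i; rewrite mxE.
case: i => [[|[|[|[|//]]]] hi]; [rewrite -c0|rewrite -c1|rewrite -c2|rewrite -c3];
  by congr (u 0 _); apply: val_inj.
Qed.

(** M is the orthogonal complement of a vector v of norm 1.  If e represents g
then g = x^2 + Q(e - x v) with x = B(e, v), an integer. *)
Lemma universal_binary a b c : biquadratic_of K a b c -> binary_universal a b c.
Proof.
case=> hg [P [Q [R hr]]].
have [v hv ev1] : exists2 v, in_OKn v & bil v v = 1.
  have [|s|v hv e] := hU (alpha := 1); first exact: integral1.
    by rewrite rmorph1 ltr01.
  by exists v; rewrite ?bil_qform.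
pose M := {y : 'rV[K]_3 | in_OKn y /\ bil y v = 0}.
have hM (y z : M) : exists u : Z * Z * Z * Z,
    let q := Quad u.1.1.1 u.1.1.2 u.1.2 u.2 in
    qint a b c q && (4 * bil (sval y) (sval z) == evq P Q R q).
  have [[x0 x1 x2 x3] [h1 h2]] := integral_coords hg hr (bil_integral (svalP y).1 (svalP z).1).
  by exists (x0, x1, x2, x3); apply/andP; split; [exact: h1 | exact/eqP].
pose G (y z : M) : quad := let u := xchoose (hM y z) in Quad u.1.1.1 u.1.1.2 u.1.2 u.2.
have GP y z : qint a b c (G y z) /\ 4 * bil (sval y) (sval z) = evq P Q R (G y z).
  by have /andP[-> /eqP] := xchooseP (hM y z).
have emb t : sqroots a b c t -> exists f : {rmorphism K -> algR},
    forall y z, f (bil (sval y) (sval z)) *+ 4 = cj t (G y z).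
  move=> /(embedding_real hg hr)[f hf]; exists f => y z.
  by apply: hf; have [_ ->] := GP y z.
exists M, G; split.
- by move=> y z; have [] := GP y z.
- move=> t y /emb[f hf]; rewrite -hf pmulrn_lge0 //; apply: bil_ge0.
  by case: (svalP y).
- move=> t y z /emb[f hf]; rewrite -!hf.
  have := bil_CS f (svalP y).1 (svalP z).1.
  move: (f _) (f _) (f _) => r s w h; nra.
- move=> g ig pg.
  have [e he eg] := hU (qint_integral hg hr ig) (totally_positive_evq hg hr pg).
  have ix : in_OK (bil e v) by apply: bil_integral.
  have [x [ox ex]] := integral_coords hg hr ix.
  have hy : in_OKn (e - bil e v *: v) /\ bil (e - bil e v *: v) v = 0.
    split; first exact: in_OKn_lin.
    by rewrite bilBl ev1 mulr1 subrr.
  exists x, (exist _ _ hy : M); split=> //.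
  have [_ /=] := GP (exist _ _ hy : M) (exist _ _ hy : M).
  set q := G _ _.
  rewrite bilBl !bilBr ev1 (bilC v e) bil_qform eg => eq4.
  apply: (evq_inj hg hr).
  have eZ k y : evq P Q R (qscale k y) = zr k * evq P Q R y by rewrite /evq /=; ring.
  have z4 : zr 4%R = 4 :> K by rewrite rmorph_nat.
  have eD y z : evq P Q R (qadd y z) = evq P Q R y + evq P Q R z.
    have ED (u w : Z) : zr (Z.add u w) = zr u + zr w :> K by ring.
    by rewrite /evq /qadd /= !ED; ring.
  rewrite eD !eZ (evqM hr) -ex -[zr _]/(zr 4%R) z4 -eq4.
  by field; rewrite -(rmorph_nat (in_alg K)) fmorph_eq0.
- move=> t y1 y2 y3 /emb[f hf]; rewrite -!hf.
  have := det3_eq0 ev1 (svalP y1).2 (svalP y2).2 (svalP y3).2.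
  move=> /(congr1 f); rewrite rmorph0 /det3 !(rmorphD, rmorphB, rmorphM) => e.
  by rewrite -[RHS](mulr0 64) -e; ring.
Qed.
End Form.

(** * Enumeration of the integers with bounded square *)

Definition tuple_of_quad (x : quad) : Z * Z * Z * Z := (q0 x, q1 x, q2 x, q3 x).
Definition quad_of_tuple (u : Z * Z * Z * Z) : quad := Quad u.1.1.1 u.1.1.2 u.1.2 u.2.
Lemma tuple_of_quadK : cancel tuple_of_quad quad_of_tuple.
Proof. by case. Qed.
HB.instance Definition _ := Equality.copy quad (can_type tuple_of_quadK).

(** Conjunctions that stop at the first failure also under call by value. *)
Fixpoint lall (T : Type) (p : T -> bool) (s : seq T) : bool :=
  if s is x :: s' then if p x then lall p s' else false else true.
Fixpoint lhas (T : Type) (p : T -> bool) (s : seq T) : bool :=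
  if s is x :: s' then if p x then true else lhas p s' else false.
Lemma lallP (T : eqType) (p : T -> bool) s : lall p s -> forall x, x \in s -> p x.
Proof.
elim: s => //= y s IH; case: ifP => // py /IH {}IH x.
by rewrite inE => /predU1P[->|/IH].
Qed.
Lemma lhasP (T : Type) (p : T -> bool) s : lhas p s -> exists x, p x.
Proof. by elim: s => //= y s IH; case: ifP => // py _; exists y. Qed.

Section Checker.
Local Open Scope Z_scope.

(** Radicals are approximated from below by integers divided by [scl]. *)
Definition scl : Z := 4096.

Fixpoint zrange2 (lo : Z) (n : nat) : seq Z :=
  if n is n'.+1 then lo :: zrange2 (lo + 2) n' else [::].
Definition zseq2 (par : bool) (lo hi : Z) : seq Z :=
  let lo' := if Bool.eqb (Z.odd lo) par then lo else lo + 1 in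
  if lo' <=? hi then zrange2 lo' (Z.to_nat ((hi - lo') / 2 + 1)) else [::].

Lemma mem_zseq2 lo hi x : lo <= x <= hi -> x \in zseq2 (Z.odd x) lo hi.
Proof.
move=> h; rewrite /zseq2.
have [lo' [-> h' [k ek]]] : exists lo', [/\ (if Bool.eqb (Z.odd lo) (Z.odd x) then lo else lo + 1) = lo',
    lo' <= x & exists k, x = lo' + 2 * k].
  case: (boolP (Bool.eqb (Z.odd lo) (Z.odd x))) => [/Bool.eqb_prop e|/negP ne].
    exists lo; split=> //; first by case: h.
    have : Z.even (x - lo) by rewrite Z.even_sub -!Z.negb_odd e; case: (Z.odd x).
    by move/Z.even_spec => [k ek]; exists k; lia.
  have e : Z.odd lo = ~~ Z.odd x.
    by move: ne; case: (Z.odd lo); case: (Z.odd x) => // ne; exfalso; apply: ne.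
  have : Z.even (x - (lo + 1)).
    by rewrite Z.even_sub Z.even_add -!Z.negb_odd e; case: (Z.odd x).
  move/Z.even_spec => [k ek]; exists (lo + 1); split=> //; last by exists k; lia.
  have : lo <> x by move=> elo; move: e; rewrite elo; case: (Z.odd x).
  by lia.
have -> : (lo' <=? hi) = true by lia.
have k0 : 0 <= k by lia.
have : k < Z.of_nat (Z.to_nat ((hi - lo') / 2 + 1)).
  have : k <= (hi - lo') / 2 by apply: Z.div_le_lower_bound; lia.
  by lia.
move: (Z.to_nat _) => n; rewrite {x h h'}ek => hk.
elim: n lo' k k0 hk => [|n IH] lo' k k0 hk; first by exfalso; lia.
rewrite [zrange2 _ _]/= inE; have [k00|k1] : k = 0 \/ 1 <= k by lia.
  by apply/orP; left; apply/eqP; lia.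
apply/orP; right; have -> : lo' + 2 * k = (lo' + 2) + 2 * (k - 1) by lia.
by apply: IH; [lia | move: hk; rewrite Nat2Z.inj_succ; lia].
Qed.

Variables a b c : Z.
Let w1 := Z.sqrt (b * c * (scl * scl)).
Let w2 := Z.sqrt (a * c * (scl * scl)).
Let w3 := Z.sqrt (a * b * (scl * scl)).

(** An upper bound of [scl] times a conjugate of y; the last summand accounts
for the rounding of the three radicals, each of which is off by less than 1. *)
Definition upper_with (w1 w2 w3 e1 e2 e3 : Z) (y : quad) : Z :=
  scl * q0 y + e1 * q1 y * w1 + e2 * q2 y * w2 + e3 * q3 y * w3
  + (Z.abs (q1 y) + Z.abs (q2 y) + Z.abs (q3 y)).
Definition upper (e1 e2 e3 : Z) (y : quad) : Z := upper_with w1 w2 w3 e1 e2 e3 y.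
Definition root_bound_with (w1 w2 w3 e1 e2 e3 : Z) (y : quad) : Z :=
  Z.sqrt (scl * upper_with w1 w2 w3 e1 e2 e3 y) + 1.
Definition root_bound (e1 e2 e3 : Z) (y : quad) : Z :=
  root_bound_with w1 w2 w3 e1 e2 e3 y.

Definition cdiv (x y : Z) : Z := - ((- x) / y).

(** The four coordinates of an integer have the same parity, and are odd only if
the squares of all three radicals are 1 modulo 4. *)
Definition parities : seq bool :=
  if [&& (b * c) mod 4 =? 1, (a * c) mod 4 =? 1 & (a * b) mod 4 =? 1] then [:: false; true] else [:: false].

Definition qint1_lazy (m1 m2 m3 a x0 x1 x2 x3 : Z) : bool :=
  if (x0 * x0 - m1 * (x1 * x1)) mod 4 =? 0 then
    let A := x0 * x0 + m1 * (x1 * x1) - m2 * (x2 * x2) - m3 * (x3 * x3) in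
    if A mod 8 =? 0 then
      let T := x0 * x1 - a * (x2 * x3) in
      if T mod 4 =? 0 then ((A / 8) * (A / 8) - m1 * ((T / 4) * (T / 4))) mod 4 =? 0 else false
    else false
  else false.
Definition qint_lazy (x : quad) : bool :=
  let: Quad x0 x1 x2 x3 := x in
  if qint1_lazy (b * c) (a * c) (a * b) a x0 x1 x2 x3 then
    if qint1_lazy (a * c) (b * c) (a * b) b x0 x2 x1 x3 then
      qint1_lazy (a * b) (b * c) (a * c) c x0 x3 x1 x2
    else false
  else false.
Lemma qint_lazyE x : qint_lazy x = qint a b c x.
Proof. by case: x. Qed.

(** Contains the integers x with x^2 <= y at the four places.  Each conjugate of
x is bounded in absolute value by some B_i, hence each of the four terms of x by
the mean of the B_i.  Given x2 and x3, the four bounds become two intervals for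
x0 + x1 P and x0 - x1 P. *)
Definition sqlist_with (pars : seq bool) (w1 w2 w3 : Z) (y : quad) : seq quad :=
  let B0 := root_bound_with w1 w2 w3 1 1 1 y in
  let B1 := root_bound_with w1 w2 w3 1 (-1) (-1) y in
  let B2 := root_bound_with w1 w2 w3 (-1) 1 (-1) y in
  let B3 := root_bound_with w1 w2 w3 (-1) (-1) 1 y in
  let T := B0 + B1 + B2 + B3 in
  let h1 := T / (4 * w1) in
  let h2 := T / (4 * w2) in
  let h3 := T / (4 * w3) in
  let d := h1 + h2 + h3 in
  let D0 := B0 + d in let D1 := B1 + d in let D2 := B2 + d in let D3 := B3 + d in
  flatten [seq flatten [seq flatten [seq
    (let t := x2 * w2 + x3 * w3 in
     let s := x2 * w2 - x3 * w3 in
     let lo1 := Z.max (- D0 - t) (- D1 + t) in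
     let hi1 := Z.min (D0 - t) (D1 + t) in
     let lo2 := Z.max (- D2 - s) (- D3 + s) in
     let hi2 := Z.min (D2 - s) (D3 + s) in
     flatten [seq
       (let u := x1 * w1 in
        [seq x <- [seq Quad x0 x1 x2 x3
                  | x0 <- zseq2 par (cdiv (Z.max (lo1 - u) (lo2 + u)) scl)
                               (Z.min (hi1 - u) (hi2 + u) / scl)]
        | qint_lazy x])
     | x1 <- (if lo1 <=? hi1 then if lo2 <=? hi2 then
               zseq2 par (cdiv (lo1 - hi2) (2 * w1)) ((hi1 - lo2) / (2 * w1)) else [::] else [::])])
    | x2 <- zseq2 par (- h2) h2] | x3 <- zseq2 par (- h3) h3] | par <- pars].
Definition sqlist (y : quad) : seq quad := sqlist_with parities w1 w2 w3 y.

(** What the bound of one conjugate by B says about the approximated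
conjugate, up to a rounding error d. *)
Definition near (B : Z) (d : Z) (e1 e2 e3 : Z) (x : quad) : Prop :=
  Z.abs (scl * q0 x + e1 * q1 x * w1 + e2 * q2 x * w2 + e3 * q3 x * w3) <= B + d.

Hypotheses (a0 : 0 < a) (b0 : 0 < b) (c0 : 0 < c).
Hypotheses (h1 : (b * c) mod 4 <> 0) (h2 : (a * c) mod 4 <> 0) (h3 : (a * b) mod 4 <> 0).

(** Modulo 4 a square is 0 or 1, and x0^2 = m x_i^2 where m, the square of
the i-th radical, is not 0. *)
Lemma qint_parity x : qint a b c x ->
  [/\ Z.odd (q0 x) \in parities, Z.odd (q1 x) = Z.odd (q0 x), Z.odd (q2 x) = Z.odd (q0 x)
    & Z.odd (q3 x) = Z.odd (q0 x)].
Proof.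
case: x => x0 x1 x2 x3 /and3P[/qint1P[n1 [_ [_ [_ [e1 _ _ _]]]]] /qint1P[n2 [_ [_ [_ [e2 _ _ _]]]]]
  /qint1P[n3 [_ [_ [_ [e3 _ _ _]]]]]] /=.
have sq m y n : m mod 4 <> 0 -> x0 * x0 - m * (y * y) = 4 * n ->
    Z.odd y = Z.odd x0 /\ (Z.odd x0 -> (m mod 4 =? 1) = true).
  move=> hm e.
  have dm z d : 0 < d -> exists k r, z = d * k + r /\ 0 <= r < d.
    move=> d0; exists (z / d), (z mod d); split; last exact: Z.mod_pos_bound.
    by apply: Z.div_mod; lia.
  have [|k0 [r0 [E0 R0']]] := dm x0 2; first by [].
  have [|k1 [r1 [E1 R1']]] := dm y 2; first by [].
  have [|k2 [r2 [E2 R2']]] := dm m 4; first by [].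
  have M2 : m mod 4 = r2 by rewrite E2 Z.add_comm Z.mul_comm Z_mod_plus_full Z.mod_small.
  have R0 : r0 = 0 \/ r0 = 1 by lia.
  have R1 : r1 = 0 \/ r1 = 1 by lia.
  have R2 : r2 = 1 \/ r2 = 2 \/ r2 = 3 by lia.
  have od k r : r = 0 \/ r = 1 -> Z.odd (2 * k + r) = (r =? 1).
    by move=> [] ->; rewrite Z.odd_add Z.odd_mul.
  rewrite E0 E1 !od //.
  have F : r0 * r0 - r2 * (r1 * r1) = 4 * (n - k0 * k0 - k0 * r0 + k2 * (y * y) + r2 * (k1 * k1 + k1 * r1)).
    by move: e; rewrite E0 E1 E2; lia.
  have : exists z, r0 * r0 - r2 * (r1 * r1) = 4 * z by eexists; exact: F.
  move=> [z Fz].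
  rewrite M2.
  by case: R0 Fz => ->; case: R1 => ->; case: R2 => [|[]] -> Fz; split=> //; lia.
have [o1 i1] := sq _ _ _ h1 e1; have [o2 i2] := sq _ _ _ h2 e2; have [o3 i3] := sq _ _ _ h3 e3.
split=> //; rewrite /parities.
case: (boolP (Z.odd x0)) => od; last by case: ifP; rewrite !inE.
by rewrite i1 // i2 // i3.
Qed.

Lemma w_gt0 m : 0 < m -> 0 < Z.sqrt (m * (scl * scl)).
Proof.
by move=> m0; apply/Z.sqrt_pos; rewrite /scl; lia.
Qed.

Lemma abs_bounds t u B C : Z.abs (t + u) <= B -> Z.abs (t - u) <= C ->
  Z.max (- B - u) (- C + u) <= t /\ t <= Z.min (B - u) (C + u).
Proof. clear; lia. Qed.

Lemma mem_sqlist y x : qint a b c x ->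
  let B0 := root_bound 1 1 1 y in
  let B1 := root_bound 1 (-1) (-1) y in
  let B2 := root_bound (-1) 1 (-1) y in
  let B3 := root_bound (-1) (-1) 1 y in
  let d := Z.abs (q1 x) + Z.abs (q2 x) + Z.abs (q3 x) in
  near B0 d 1 1 1 x -> near B1 d 1 (-1) (-1) x ->
  near B2 d (-1) 1 (-1) x -> near B3 d (-1) (-1) 1 x ->
  let T := B0 + B1 + B2 + B3 in
  4 * w1 * Z.abs (q1 x) <= T -> 4 * w2 * Z.abs (q2 x) <= T -> 4 * w3 * Z.abs (q3 x) <= T ->
  x \in sqlist y.
Proof.
move=> ix B0 B1 B2 B3 d n0 n1 n2 n3 T k1 k2 k3.
have p1 : 0 < w1 by apply: w_gt0; nia.
have p2 : 0 < w2 by apply: w_gt0; nia.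
have p3 : 0 < w3 by apply: w_gt0; nia.
have H w z : 0 < w -> 4 * w * Z.abs z <= T -> Z.abs z <= T / (4 * w).
  by move=> w0 h; apply: Z.div_le_lower_bound; lia.
have {}k1 := H _ _ p1 k1; have {}k2 := H _ _ p2 k2; have {}k3 := H _ _ p3 k3.
rewrite /sqlist /sqlist_with -!/(root_bound _ _ _ _) -/B0 -/B1 -/B2 -/B3 -/T.
move: (T / (4 * w1)) (T / (4 * w2)) (T / (4 * w3)) k1 k2 k3 => g1 g2 g3 k1 k2 k3.
case: x ix @d n0 n1 n2 n3 k1 k2 k3 => x0 x1 x2 x3 ix; rewrite /near [q0 _]/= [q1 _]/= [q2 _]/= [q3 _]/=.
move=> n0 n1 n2 n3 k1 k2 k3.
have {}n0 : Z.abs (scl * x0 + x1 * w1 + (x2 * w2 + x3 * w3)) <= B0 + (g1 + g2 + g3) by lia.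
have {}n1 : Z.abs (scl * x0 + x1 * w1 - (x2 * w2 + x3 * w3)) <= B1 + (g1 + g2 + g3) by lia.
have {}n2 : Z.abs (scl * x0 - x1 * w1 + (x2 * w2 - x3 * w3)) <= B2 + (g1 + g2 + g3) by lia.
have {}n3 : Z.abs (scl * x0 - x1 * w1 - (x2 * w2 - x3 * w3)) <= B3 + (g1 + g2 + g3) by lia.
have [op o1 o2 o3] := qint_parity ix; rewrite [q0 _]/= [q1 _]/= [q2 _]/= [q3 _]/= in op o1 o2 o3.
apply/flatten_mapP; exists (Z.odd x0) => //.
apply/flatten_mapP; exists x3; first by rewrite -o3; apply: mem_zseq2; lia.
apply/flatten_mapP; exists x2; first by rewrite -o2; apply: mem_zseq2; lia.
move: (x2 * w2) (x3 * w3) n0 n1 n2 n3 => y2 y3 n0 n1 n2 n3.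
have := abs_bounds n2 n3; have := abs_bounds n0 n1; clear n0 n1 n2 n3.
set lo1 := Z.max _ _; set hi1 := Z.min _ _; set lo2 := Z.max _ _; set hi2 := Z.min _ _.
clearbody lo1 hi1 lo2 hi2 => -[l1 l2] [l3 l4].
have lh1 : (lo1 <=? hi1) = true by lia.
have lh2 : (lo2 <=? hi2) = true by lia.
rewrite lh1 lh2.
have cd u v z : 0 < v -> u <= v * z -> cdiv u v <= z.
  move=> v0 uz; rewrite /cdiv; have : - z <= - u / v by apply: Z.div_le_lower_bound; lia.
  by lia.
have fd u v z : 0 < v -> v * z <= u -> z <= u / v by move=> v0 uz; apply: Z.div_le_lower_bound; lia.
have s0 : 0 < scl by [].
apply/flatten_mapP; exists x1.
  by rewrite -o1; apply: mem_zseq2; split; [apply: cd; lia | apply: fd; lia].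
rewrite mem_filter qint_lazyE ix andTb; apply/mapP; exists x0 => //.
move: (x1 * w1) l1 l2 l3 l4 => u l1 l2 l3 l4.
by apply: mem_zseq2; split; [apply: cd => //; lia | apply: fd => //; lia].
Qed.
End Checker.

Section Approximation.
Variable R : realFieldType.
Implicit Types (p q r v : R).

Lemma zrZD x y : zr (Z.add x y) = zr x + zr y :> R. Proof. exact: (rmorphD zr). Qed.
Lemma zrZM x y : zr (Z.mul x y) = zr x * zr y :> R. Proof. exact: (rmorphM zr). Qed.
Lemma zrZB x y : zr (Z.sub x y) = zr x - zr y :> R. Proof. exact: (rmorphB zr). Qed.
Lemma zrZN x : zr (Z.opp x) = - zr x :> R. Proof. exact: (rmorphN zr). Qed.
Lemma zrZabs x : zr (Z.abs x) = `|zr x| :> R.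
Proof.
have [h|h] : (0 <= x) \/ (x <= 0) by lia.
  by rewrite ger0_norm ?zr_ge0 //; congr zr; lia.
by rewrite ler0_norm -?rmorphN ?oppr_ge0 -?[_ <= 0]oppr_ge0 -?rmorphN ?zr_ge0; [congr zr|]; lia.
Qed.

Lemma sqrt_approx (m s : Z) p : 0 <= m -> 0 < s -> 0 <= p -> p ^+ 2 = zr m ->
  zr (Z.sqrt (Z.mul m (Z.mul s s))) <= zr s * p <= zr (Z.sqrt (Z.mul m (Z.mul s s))) + 1.
Proof.
move=> m0 s0 p0 pm; have := Z.sqrt_spec (Z.mul m (Z.mul s s)).
have := Z.sqrt_nonneg (Z.mul m (Z.mul s s)).
move: (Z.sqrt _) => w w0 []; first by nia.
have -> : Z.succ w = w + 1 by lia.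
move=> /Z.leb_le h1 /Z.ltb_lt h2.
have {}h1 : w * w <= m * (s * s) by lia.
have {}h2 : m * (s * s) < (w + 1) * (w + 1) by lia.
have sp : 0 <= zr s * p by rewrite mulr_ge0 // zr_ge0 ltW.
have e : (zr s * p) ^+ 2 = zr (m * (s * s)) by rewrite exprMn pm !rmorphM /= expr2 mulrC.
have w0' : 0 <= zr w :> R by rewrite zr_ge0; lia.
apply/andP; split.
  rewrite -(ler_pXn2r (n := 2)) ?nnegrE // e expr2 -rmorphM zr_le; lia.
rewrite -(ler_pXn2r (n := 2)) ?nnegrE ?addr_ge0 // e.
by rewrite -[1](rmorph1 zr) -rmorphD expr2 -rmorphM zr_le; lia.
Qed.

Lemma lin_err (x w : Z) v : zr w <= v <= zr w + 1 -> `|zr x * v - zr x * zr w| <= `|zr x| :> R.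
Proof.
move=> /andP[h1 h2]; rewrite -mulrBr normrM ler_piMr //.
by rewrite ger0_norm; lra.
Qed.

Lemma root_le (S U : Z) v w : 0 < S -> v ^+ 2 <= w -> zr S * w <= zr U ->
  `|zr S * v| <= zr (Z.add (Z.sqrt (Z.mul S U)) 1).
Proof.
move=> S0 vw wU; have S0' : 0 < zr S :> R by rewrite zr_gt0.
have h : (zr S * v) ^+ 2 <= zr (S * U) by rewrite exprMn rmorphM /= expr2; nra.
have SU : 0 <= S * U by rewrite -(zr_ge0 R); apply: le_trans h; exact: sqr_ge0.
have [|_] := Z.sqrt_spec (Z.mul S U); first by lia.
have := Z.sqrt_nonneg (Z.mul S U); move: (Z.sqrt _) => s s0 hs.
have s1 : 0 <= zr (Z.add s 1) :> R by rewrite zr_ge0; lia.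
rewrite -(ler_pXn2r (n := 2)) ?nnegrE // real_normK ?num_real //.
by apply: le_trans h _; rewrite expr2 -rmorphM zr_le; lia.
Qed.
Lemma lin3_err (e1 e2 e3 y1 y2 y3 z1 z2 z3 n1 n2 n3 : R) :
  `|e1| = 1 -> `|e2| = 1 -> `|e3| = 1 ->
  `|y1 - z1| <= n1 -> `|y2 - z2| <= n2 -> `|y3 - z3| <= n3 ->
  `|(e1 * y1 + e2 * y2 + e3 * y3) - (e1 * z1 + e2 * z2 + e3 * z3)| <= n1 + n2 + n3.
Proof.
move=> h1 h2 h3 k1 k2 k3.
have -> : (e1 * y1 + e2 * y2 + e3 * y3) - (e1 * z1 + e2 * z2 + e3 * z3) =
  e1 * (y1 - z1) + e2 * (y2 - z2) + e3 * (y3 - z3) by ring.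
apply: le_trans (ler_normD _ _) _; apply: lerD; last by rewrite normrM h3 mul1r.
by apply: le_trans (ler_normD _ _) _; apply: lerD; rewrite normrM ?h1 ?h2 mul1r.
Qed.

Lemma approx_upper (s e1 e2 e3 x0 x1 x2 x3 p q r w1 w2 w3 n : R) :
  `|(e1 * (x1 * (s * p)) + e2 * (x2 * (s * q)) + e3 * (x3 * (s * r))) -
    (e1 * (x1 * w1) + e2 * (x2 * w2) + e3 * (x3 * w3))| <= n ->
  s * (x0 + e1 * x1 * p + e2 * x2 * q + e3 * x3 * r) <=
  s * x0 + e1 * x1 * w1 + e2 * x2 * w2 + e3 * x3 * w3 + n.
Proof.
rewrite ler_norml => /andP[_]; rewrite lerBlDl => h.
have -> : s * (x0 + e1 * x1 * p + e2 * x2 * q + e3 * x3 * r) =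
  s * x0 + (e1 * (x1 * (s * p)) + e2 * (x2 * (s * q)) + e3 * (x3 * (s * r))) by ring.
by apply: le_trans (lerD (lexx _) h) _; rewrite !mulrA !addrA.
Qed.

Lemma approx_norm (s e1 e2 e3 x0 x1 x2 x3 p q r w1 w2 w3 n B : R) :
  `|(e1 * (x1 * (s * p)) + e2 * (x2 * (s * q)) + e3 * (x3 * (s * r))) -
    (e1 * (x1 * w1) + e2 * (x2 * w2) + e3 * (x3 * w3))| <= n ->
  `|s * (x0 + e1 * x1 * p + e2 * x2 * q + e3 * x3 * r)| <= B ->
  `|s * x0 + e1 * x1 * w1 + e2 * x2 * w2 + e3 * x3 * w3| <= B + n.
Proof.
rewrite distrC => h1 h2; apply: le_trans (le_trans (ler_normD _ _) (lerD h2 h1)).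
by rewrite le_eqVlt; apply/orP; left; apply/eqP; congr Num.norm; ring.
Qed.

Lemma sum4_le s x y1 y2 y3 (B0 B1 B2 B3 : R) : 0 <= s ->
  `|s * (x + y1 + y2 + y3)| <= B0 -> `|s * (x + y1 - y2 - y3)| <= B1 ->
  `|s * (x - y1 + y2 - y3)| <= B2 -> `|s * (x - y1 - y2 + y3)| <= B3 ->
  [/\ 4 * (s * `|y1|) <= B0 + B1 + B2 + B3, 4 * (s * `|y2|) <= B0 + B1 + B2 + B3
    & 4 * (s * `|y3|) <= B0 + B1 + B2 + B3].
Proof.
move=> s0; rewrite !ler_norml => /andP[? ?] /andP[? ?] /andP[? ?] /andP[? ?].
have N (y : R) (B : R) : 4 * (s * y) <= B -> - (4 * (s * y)) <= B -> 4 * (s * `|y|) <= B.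
  by move=> h1 h2; case: (ger0P y) => h; lra.
by split; apply: N; lra.
Qed.

Lemma coord_le (s w x p y B : R) : 0 <= w -> w <= s * p -> 0 <= p -> y = x * p ->
  4 * (s * `|y|) <= B -> 4 * w * `|x| <= B.
Proof.
move=> w0 wp p0 ->; rewrite normrM (ger0_norm p0); apply: le_trans.
rewrite -mulrA ler_wpM2l //.
by rewrite [_ * p]mulrC mulrA ler_wpM2r.
Qed.
End Approximation.

Section Sqlist.
Variables a b c : Z.
Hypothesis hg : radical_triple a b c.

Lemma sqf_mod4 n : sqf n -> Z.modulo n 4 <> Z0.
Proof.
move=> hn e; have := hn (Zpos 2); have -> : Z.abs (Zpos 2) = 2 by [].
by move=> H; have : (2 : Z) = 1 by apply: H; apply/Z.mod_divide.
Qed.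

(** The four real places are given by the signs of P, Q, R, with product 1. *)
Definition signs : seq (Z * Z * Z) := [:: (1, 1, 1); (1, -1, -1); (-1, 1, -1); (-1, -1, 1)].
Definition lin (p q r : algR) (e1 e2 e3 : Z) (x : quad) : algR :=
  zr (q0 x) + zr e1 * zr (q1 x) * p + zr e2 * zr (q2 x) * q + zr e3 * zr (q3 x) * r.

Lemma conj_signs : exists p q r : algR,
  [/\ [/\ 0 < p, 0 < q & 0 < r],
      [/\ p ^+ 2 = zr (b * c), q ^+ 2 = zr (a * c) & r ^+ 2 = zr (a * b)],
      forall e1 e2 e3, (e1, e2, e3) \in signs ->
        exists2 t, sqroots a b c t & forall x, cj t x = lin p q r e1 e2 e3 x
    & forall t, sqroots a b c t -> exists e1 e2 e3,
        (e1, e2, e3) \in signs /\ forall x, cj t x = lin p q r e1 e2 e3 x].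
Proof.
case: (hg) => [[a0 b0 c0] _ _].
have [[[ta tb] tc] [[/= ea eb ec] pa pb pc]] := sqrts_exist a0 b0 c0.
exists (tb * tc), (ta * tc), (ta * tb); split.
- by split; rewrite mulr_gt0.
- by split; rewrite exprMn ?ea ?eb ?ec rmorphM.
- move=> e1 e2 e3; rewrite !inE => /or4P[] /eqP[-> -> ->].
  + exists (ta, tb, tc) => // x; rewrite /cj /lin /= rmorph1; ring.
  + exists (- ta, tb, tc) => [|x]; first by split; rewrite /= ?sqrrN.
    by rewrite /cj /lin /= rmorphN1 rmorph1; ring.
  + exists (ta, - tb, tc) => [|x]; first by split; rewrite /= ?sqrrN.
    by rewrite /cj /lin /= rmorphN1 rmorph1; ring.
  + exists (ta, tb, - tc) => [|x]; first by split; rewrite /= ?sqrrN.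
    by rewrite /cj /lin /= rmorphN1 rmorph1; ring.
- case=> [[sa sb] sc] [/= ha hb hc].
  have sg (u v : algR) z : u ^+ 2 = zr z -> v ^+ 2 = zr z -> u = v \/ u = - v.
    by move=> <- /eqP; rewrite eq_sym eqf_sqr => /orP[] /eqP; [left | right].
  case: (sg _ _ _ ha ea) => ->; case: (sg _ _ _ hb eb) => ->; case: (sg _ _ _ hc ec) => ->.
  + by exists 1, 1, 1; split=> // x; rewrite /cj /lin /= rmorph1; ring.
  + by exists (-1), (-1), 1; split=> // x; rewrite /cj /lin /= rmorphN1 rmorph1; ring.
  + by exists (-1), 1, (-1); split=> // x; rewrite /cj /lin /= rmorphN1 rmorph1; ring.
  + by exists 1, (-1), (-1); split=> // x; rewrite /cj /lin /= rmorphN1 rmorph1; ring.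
  + by exists 1, (-1), (-1); split=> // x; rewrite /cj /lin /= rmorphN1 rmorph1; ring.
  + by exists (-1), 1, (-1); split=> // x; rewrite /cj /lin /= rmorphN1 rmorph1; ring.
  + by exists (-1), (-1), 1; split=> // x; rewrite /cj /lin /= rmorphN1 rmorph1; ring.
  + by exists 1, 1, 1; split=> // x; rewrite /cj /lin /= rmorph1; ring.
Qed.

Lemma approx_upper_le p q r : 0 <= p -> 0 <= q -> 0 <= r ->
  p ^+ 2 = zr (b * c) -> q ^+ 2 = zr (a * c) -> r ^+ 2 = zr (a * b) ->
  forall y e1 e2 e3, (e1, e2, e3) \in signs ->
  zr scl * lin p q r e1 e2 e3 y <= zr (upper a b c e1 e2 e3 y).
Proof.
move=> p0 q0' r0 ep eq er y e1 e2 e3 he.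
case: (hg) => [[a0 b0 c0] _ _].
have S0 : 0 < scl by [].
have P1 := sqrt_approx (s := scl) (ltW (mulr_gt0 b0 c0)) S0 p0 ep.
have P2 := sqrt_approx (s := scl) (ltW (mulr_gt0 a0 c0)) S0 q0' eq.
have P3 := sqrt_approx (s := scl) (ltW (mulr_gt0 a0 b0)) S0 r0 er.
have [u1 u2 u3] : [/\ `|zr e1| = 1 :> algR, `|zr e2| = 1 :> algR & `|zr e3| = 1 :> algR].
  by move: he; rewrite !inE => /or4P[] /eqP[-> -> ->]; rewrite ?rmorphN1 ?rmorph1 ?normrN1 ?normr1.
have := lin3_err u1 u2 u3 (lin_err (q1 y) P1) (lin_err (q2 y) P2) (lin_err (q3 y) P3).
by rewrite /upper /upper_with !(zrZD, zrZM) !zrZabs; apply: approx_upper.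
Qed.

(** The four conjugates of x are bounded by real square roots; here they are
compared with the integral approximations that define the list. *)
Lemma sqlistP x y : qint a b c x ->
  (forall t, sqroots a b c t -> cj t x ^+ 2 <= cj t y) -> x \in sqlist a b c y.
Proof.
case: (hg) => [[a0 b0 c0] [/sqf_mod4 s1 /sqf_mod4 s2 /sqf_mod4 s3] _].
have [a0' b0' c0'] : [/\ Z.lt 0 a, Z.lt 0 b & Z.lt 0 c] by split; lia.
move=> ix hxy; have [p [q [r [[p0 q0' r0] [ep eq er] ex _]]]] := conj_signs.
move/ltW in p0; move/ltW in q0'; move/ltW in r0.
have {hxy ex} h e1 e2 e3 : (e1, e2, e3) \in signs -> lin p q r e1 e2 e3 x ^+ 2 <= lin p q r e1 e2 e3 y.
  by move=> /ex[t ht hl]; rewrite -!hl; apply: hxy.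
rewrite /signs /lin in h.
have S0 : 0 < scl by [].
have P1 := sqrt_approx (s := scl) (ltW (mulr_gt0 b0 c0)) S0 p0 ep.
have P2 := sqrt_approx (s := scl) (ltW (mulr_gt0 a0 c0)) S0 q0' eq.
have P3 := sqrt_approx (s := scl) (ltW (mulr_gt0 a0 b0)) S0 r0 er.
have sgn (e1 e2 e3 : Z) : (e1, e2, e3) \in [:: (1, 1, 1); (1, -1, -1); (-1, 1, -1); (-1, -1, 1)] ->
  [/\ `|zr e1| = 1 :> algR, `|zr e2| = 1 :> algR & `|zr e3| = 1 :> algR].
  by rewrite !inE => /or4P[] /eqP[-> -> ->]; rewrite ?rmorphN1 ?rmorph1 ?normrN1 ?normr1.
have N (e1 e2 e3 : Z) : (e1, e2, e3) \in [:: (1, 1, 1); (1, -1, -1); (-1, 1, -1); (-1, -1, 1)] ->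
  `|zr scl * (zr (q0 x) + zr e1 * zr (q1 x) * p + zr e2 * zr (q2 x) * q + zr e3 * zr (q3 x) * r)|
   <= zr (root_bound a b c e1 e2 e3 y) :> algR.
  move=> he; apply: (root_le S0 (h _ _ _ he)).
  exact: approx_upper_le p0 q0' r0 ep eq er y _ _ _ he.
have n0 := N 1 1 1 isT; have n1 := N 1 (-1) (-1) isT.
have n2 := N (-1) 1 (-1) isT; have n3 := N (-1) (-1) 1 isT.
have E1 := lin_err (q1 x) P1; have E2 := lin_err (q2 x) P2; have E3 := lin_err (q3 x) P3.
move: n0 n1 n2 n3; rewrite !(rmorphN1, rmorph1).
have near_of (e1 e2 e3 B : Z) : (e1, e2, e3) \in [:: (1, 1, 1); (1, -1, -1); (-1, 1, -1); (-1, -1, 1)] ->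
   `|zr scl * (zr (q0 x) + zr e1 * zr (q1 x) * p + zr e2 * zr (q2 x) * q + zr e3 * zr (q3 x) * r)|
     <= zr B :> algR ->
   near a b c B (Z.add (Z.add (Z.abs (q1 x)) (Z.abs (q2 x))) (Z.abs (q3 x))) e1 e2 e3 x.
  move=> he hB; rewrite /near; apply/Z.leb_le; rewrite -[Z.leb _ _]/(_ <= _ :> Z).
  rewrite -(zr_le algR) zrZabs !(zrZD, zrZM) !zrZabs.
  have [u1 u2 u3] := sgn _ _ _ he.
  exact: (approx_norm (lin3_err u1 u2 u3 E1 E2 E3)).
move=> n0 n1 n2 n3.
have [] : [/\ near a b c (root_bound a b c 1 1 1 y) (Z.add (Z.add (Z.abs (q1 x)) (Z.abs (q2 x))) (Z.abs (q3 x))) 1 1 1 x,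
  near a b c (root_bound a b c 1 (-1) (-1) y) (Z.add (Z.add (Z.abs (q1 x)) (Z.abs (q2 x))) (Z.abs (q3 x))) 1 (-1) (-1) x,
  near a b c (root_bound a b c (-1) 1 (-1) y) (Z.add (Z.add (Z.abs (q1 x)) (Z.abs (q2 x))) (Z.abs (q3 x))) (-1) 1 (-1) x
  & near a b c (root_bound a b c (-1) (-1) 1 y) (Z.add (Z.add (Z.abs (q1 x)) (Z.abs (q2 x))) (Z.abs (q3 x))) (-1) (-1) 1 x].
  by split; apply: near_of; rewrite // ?rmorphN1 ?rmorph1.
move=> k0 k1 k2 k3.
have S0' : 0 <= zr scl :> algR by rewrite zr_ge0.
have m0 : `|zr scl * (zr (q0 x) + zr (q1 x) * p + zr (q2 x) * q + zr (q3 x) * r)|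
   <= zr (root_bound a b c 1 1 1 y) :> algR by move: n0; rewrite !mul1r.
have m1 : `|zr scl * (zr (q0 x) + zr (q1 x) * p - zr (q2 x) * q - zr (q3 x) * r)|
   <= zr (root_bound a b c 1 (-1) (-1) y) :> algR by move: n1; rewrite !mul1r !mulN1r !mulNr.
have m2 : `|zr scl * (zr (q0 x) - zr (q1 x) * p + zr (q2 x) * q - zr (q3 x) * r)|
   <= zr (root_bound a b c (-1) 1 (-1) y) :> algR by move: n2; rewrite !mul1r !mulN1r !mulNr.
have m3 : `|zr scl * (zr (q0 x) - zr (q1 x) * p - zr (q2 x) * q + zr (q3 x) * r)|
   <= zr (root_bound a b c (-1) (-1) 1 y) :> algR by move: n3; rewrite !mul1r !mulN1r !mulNr.
have [l1 l2 l3] := sum4_le S0' m0 m1 m2 m3.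
have wn m : 0 <= zr (Z.sqrt m) :> algR by rewrite zr_ge0; apply/Z.leb_le/Z.sqrt_nonneg.
have four : zr (Zpos 4) = 4 :> algR by [].
have fin (m z A B C D : Z) : 4 * zr m * `|zr z| <= zr A + zr B + zr C + zr D :> algR ->
    Z.le (Z.mul (Z.mul 4 m) (Z.abs z)) (Z.add (Z.add (Z.add A B) C) D).
  move=> hz; apply/Z.leb_le; rewrite -[Z.leb _ _]/(_ <= _ :> Z) -(zr_le algR).
  by rewrite (zrZM _ (Z.mul _ _)) (zrZM _ _ m) four (zrZD _ _ D) (zrZD _ _ C) zrZD zrZabs.
refine (mem_sqlist a0' b0' c0' s1 s2 s3 ix k0 k1 k2 k3 _ _ _); apply: fin.
- by case/andP: P1 => P1 _; apply: (coord_le (wn _) P1 p0 (erefl _) l1).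
- by case/andP: P2 => P2 _; apply: (coord_le (wn _) P2 q0' (erefl _) l2).
- by case/andP: P3 => P3 _; apply: (coord_le (wn _) P3 r0 (erefl _) l3).
Qed.
End Sqlist.

(** * Refutation by a tree of representations *)

Section Tree.
Variables a b c : Z.

Definition qzero (x : quad) : bool := x == Quad 0 0 0 0.

(** g - x^2 in quarter coordinates, for all integers x with x^2 <= g: one of
these is a value of the form on M. The division by 4 is exact. *)
Definition residue (g x : quad) : quad :=
  let n := qsub (qscale 4 g) (qmul a b c x x) in
  Quad (Z.div (q0 n) 4) (Z.div (q1 n) 4) (Z.div (q2 n) 4) (Z.div (q3 n) 4).
Definition residues (g : quad) : seq quad :=
  undup [seq residue g x | x <- sqlist a b c (qscale 4 g)].

(** A conjugate of y is positive if the upper bound for that of - y is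
negative. *)
Definition positive (e1 e2 e3 : Z) (y : quad) : bool :=
  Z.ltb (upper a b c e1 e2 e3 (qscale (-1) y)) 0.
Definition admissible (g : quad) : bool :=
  [&& qint a b c g, positive 1 1 1 g, positive 1 (-1) (-1) g,
      positive (-1) 1 (-1) g & positive (-1) (-1) 1 g].

Definition gram3 (A1 A2 A3 B12 B13 B23 : quad) : quad :=
  let m := qmul a b c in
  qadd (qsub (m A1 (qsub (m A2 A3) (m B23 B23))) (m B12 (qsub (m B12 A3) (m B23 B13))))
       (m B13 (qsub (m B12 B23) (m A2 B13))).

(** [A1], [A2], [A3] are values of the form on M at y1, y2, y3, and [B12],
[B13], [B23] the scalar products, which are among the integers whose square is
at most the product of the two values. The elements to represent may depend on
the values found before: y2 comes from [g1], y3 from [g2] or [g2'], and y1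
from any element of [G3] that gives a contradiction. *)
Definition refutes3 (A2 A3 B23 g : quad) : bool :=
  if admissible g then
    lall (fun A1 =>
      let L2 := sqlist a b c (qmul a b c A1 A2) in
      let L3 := sqlist a b c (qmul a b c A1 A3) in
      lall (fun B12 => lall (fun B13 => ~~ qzero (gram3 A1 A2 A3 B12 B13 B23)) L3) L2)
    (residues g)
  else false.

Definition refutes2 (G3 : seq quad) (A2 g : quad) : bool :=
  if admissible g then
    lall (fun A3 =>
      lall (fun B23 => lhas (refutes3 A2 A3 B23) G3) (sqlist a b c (qmul a b c A2 A3)))
    (residues g)
  else false.

Definition refutes1 (G3 : seq quad) (g2 g2' g1 : quad) : bool :=
  if admissible g1 then
    lall (fun A2 => refutes2 G3 A2 (if A2 == Quad 4 0 0 0 then g2 else g2')) (residues g1)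
  else false.

Hypothesis hg : radical_triple a b c.

Lemma positiveP p q r e1 e2 e3 y : 0 < p -> 0 < q -> 0 < r ->
  p ^+ 2 = zr (b * c) -> q ^+ 2 = zr (a * c) -> r ^+ 2 = zr (a * b) ->
  (e1, e2, e3) \in signs -> positive e1 e2 e3 y -> 0 < lin p q r e1 e2 e3 y.
Proof.
move=> /ltW p0 /ltW q0' /ltW r0 ep eq er he; rewrite /positive => /Z.ltb_lt hy.
case: (hg) => [[a0 b0 c0] _ _]; have S0 : 0 < scl by [].
have := approx_upper_le hg p0 q0' r0 ep eq er (qscale (-1) y) he => H.
have {}hy : zr (upper a b c e1 e2 e3 (qscale (-1) y)) < 0 :> algR.
  by rewrite -[0](rmorph0 zr) zr_lt; apply/Z.ltb_lt.
have : zr scl * lin p q r e1 e2 e3 (qscale (-1) y) < 0 by apply: le_lt_trans H hy.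
have -> : lin p q r e1 e2 e3 (qscale (-1) y) = - lin p q r e1 e2 e3 y.
  have n1 : zr (Zneg xH) = -1 :> algR by rewrite -(rmorphN1 zr).
  by rewrite /lin /qscale; cbn [q0 q1 q2 q3]; rewrite !zrZM n1; ring.
by rewrite mulrN oppr_lt0 pmulr_rgt0 // zr_gt0.
Qed.

Lemma admissibleP g : admissible g -> qint a b c g /\ forall t, sqroots a b c t -> 0 < cj t g.
Proof.
case/and5P => ig h0 h1 h2 h3; split=> // t ht.
have [p [q [r [[p0 q0' r0] [ep eq er] _ /(_ t ht)[e1 [e2 [e3 [he ->]]]]]]]] := conj_signs hg.
apply: positiveP => //.
by move: he; rewrite !inE => /or4P[] /eqP[-> -> ->].
Qed.

Lemma qzeroP x : (forall t, sqroots a b c t -> cj t x = 0) -> qzero x.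
Proof.
move=> h; have [p [q [r [[p0 q0' r0] _ ex _]]]] := conj_signs hg.
have {ex} h e1 e2 e3 : (e1, e2, e3) \in signs -> lin p q r e1 e2 e3 x = 0.
  by move=> /ex[t ht <-]; apply: h.
have h0 := h 1 1 1 isT; have h1 := h 1 (-1) (-1) isT.
have h2 := h (-1) 1 (-1) isT; have h3 := h (-1) (-1) 1 isT.
move: h0 h1 h2 h3; rewrite /lin !(rmorphN1, rmorph1) !mulN1r !mul1r.
case: x {h} => x0 x1 x2 x3 /= h0 h1 h2 h3.
have z u v : 0 < v -> 4 * (zr u * v) = 0 :> algR -> u = 0.
  move=> v0 /eqP; rewrite !mulf_eq0 pnatr_eq0 (gt_eqF v0) orbF /= => /eqP e.
  by apply: (@zr_inj algR); rewrite e rmorph0.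
have -> : x0 = 0 by apply: (z _ 1) => //; lra.
have -> : x1 = 0 by apply: (z _ p) => //; lra.
have -> : x2 = 0 by apply: (z _ q) => //; lra.
have -> : x3 = 0 by apply: (z _ r) => //; lra.
exact: eqxx.
Qed.

Lemma tree_refutation G3 g2 g2' g1 : binary_universal a b c -> ~~ refutes1 G3 g2 g2' g1.
Proof.
case=> M [G [Gi Gpos GCS Grep Gdet]]; apply/negP => hr.
have rep g : admissible g -> exists y, G y y \in residues g.
  move=> /admissibleP[ig pg]; have [x [y [ix e]]] := Grep g ig pg.
  exists y; rewrite mem_undup; apply/mapP; exists x.
    apply: (sqlistP hg ix) => t ht; rewrite e cjD cjZ (cjM _ _ ht) -expr2 lerDl.
    by apply: mulr_ge0; [rewrite zr_ge0 | apply: Gpos].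
  rewrite /residue e; case: (G y y) (qmul a b c x x) => y0 y1 y2 y3 [z0 z1 z2 z3].
  rewrite /qsub /qadd /qscale; cbn [q0 q1 q2 q3].
  have E u v : Z.div (Z.sub (Z.add u (Z.mul 4 v)) u) 4 = v.
    by rewrite Z.add_simpl_l Z.mul_comm Z.div_mul.
  by rewrite !E.
have gram y z : G y z \in sqlist a b c (qmul a b c (G y y) (G z z)).
  by apply: (sqlistP hg (Gi y z)) => t ht; rewrite (cjM _ _ ht); apply: GCS.
move: hr; rewrite /refutes1; case: ifP => // /rep[y2 h2] /lallP/(_ _ h2).
move: (if _ then _ else _) => g; rewrite /refutes2; case: ifP => // /rep[y3 h3].
move=> /lallP/(_ _ h3)/lallP/(_ _ (gram y2 y3))/lhasP[g'].
rewrite /refutes3; case: ifP => // /rep[y1 h1] /lallP/(_ _ h1).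
move=> /lallP/(_ _ (gram y1 y2))/lallP/(_ _ (gram y1 y3))/negP; apply.
apply: qzeroP => t ht; rewrite -[RHS](Gdet t y1 y2 y3 ht) /gram3 /det3.
by rewrite !(cjD, cjB, cjM _ _ ht).
Qed.
End Tree.

(** * Elements used for explicit fields *)

Section Certificates.
Local Open Scope Z_scope.

(** k + sqrt m, or (k + sqrt m) / 2 when that can be integral, with k minimal. *)
Definition small_pair (m : Z) : Z * Z :=
  let k := Z.sqrt m + 1 in
  if m mod 4 =? 1 then (2 * (if Z.odd k then k else k + 1), 2) else (4 * k, 4).

(** The element y1 comes from one of these.  Their conjugates have a small
product, which leaves few possible scalar products. *)
Definition small_elements (a b c : Z) : seq quad :=
  let: (u1, v1) := small_pair (b * c) in
  let: (u2, v2) := small_pair (a * c) in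
  let: (u3, v3) := small_pair (a * b) in
  [:: Quad u3 0 0 (- v3); Quad u1 (- v1) 0 0; Quad u2 0 (- v2) 0;
      Quad u3 0 0 v3; Quad u1 v1 0 0; Quad u2 0 v2 0].

(** Elements of the field generated by sqrt p, where p = ab. The last one is
represented first, by x^2 + Q(y2); then the first one if Q(y2) = 1, and the
second one otherwise. *)
Definition standard_tree (p : Z) : quad * quad * quad :=
  if p =? 2 then (Quad 12 0 0 0, Quad 12 0 0 0, Quad 8 0 0 4)
  else if p =? 3 then (Quad 16 0 0 4, Quad 16 0 0 4, Quad 8 0 0 4)
  else if p =? 5 then (Quad 14 0 0 2, Quad 10 0 0 2, Quad 8 0 0 0)
  else if p =? 10 then (Quad 12 0 0 0, Quad 28 0 0 0, Quad 8 0 0 0)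
  else (Quad 12 0 0 0, Quad 20 0 0 0, Quad 8 0 0 0).

(** Fields for which the elements above do not suffice, with elements that do. *)
Definition special : seq (Z * Z * Z * (seq quad * quad * quad * quad)) :=
 [:: ((2, 1, 3), ([:: Quad 12 (-4) 2 (-6)], Quad 16 4 0 0, Quad 16 4 0 0, Quad 8 0 0 4));
     ((2, 1, 5), ([:: Quad 10 (-2) 2 (-2)], Quad 12 0 0 0, Quad 12 0 0 0, Quad 8 0 0 4));
     ((3, 1, 5), ([:: Quad 10 (-2) 2 (-2)], Quad 16 0 0 4, Quad 16 0 0 4, Quad 8 0 0 4));
     ((2, 3, 5), ([:: Quad 12 0 0 (-4); Quad 12 0 (-2) (-2)], Quad 12 0 0 0, Quad 12 0 0 4, Quad 8 0 0 0));
     ((6, 1, 5), ([:: Quad 12 0 0 (-4); Quad 10 (-2) 0 0], Quad 12 0 0 4, Quad 12 0 0 4, Quad 8 0 0 0));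
     ((7, 1, 5), ([:: Quad 12 0 0 (-4)], Quad 12 0 0 4, Quad 12 0 0 4, Quad 8 0 0 0));
     ((2, 5, 7), ([:: Quad 16 0 0 (-4); Quad 16 0 (-2) (-2)], Quad 12 0 0 0, Quad 16 0 0 4, Quad 8 0 0 0));
     ((10, 1, 3), ([:: Quad 8 (-4) 0 0; Quad 12 (-4) 2 (-2)], Quad 16 0 0 4, Quad 16 0 0 4, Quad 8 0 0 0));
     ((10, 1, 7), ([:: Quad 12 (-4) 0 0], Quad 12 0 0 0, Quad 16 0 0 4, Quad 8 0 0 0));
     ((11, 1, 5), ([:: Quad 14 (-2) 0 0; Quad 10 (-2) 0 0], Quad 16 0 0 4, Quad 16 0 0 4, Quad 8 0 0 0));
     ((3, 7, 11), ([:: Quad 10 0 0 (-2); Quad 11 1 (-1) (-1)], Quad 12 0 0 0, Quad 20 0 0 0, Quad 8 0 0 0));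
     ((5, 13, 17), ([:: Quad 17 1 (-1) (-1)], Quad 12 0 0 0, Quad 20 0 0 0, Quad 8 0 0 0))].

Fixpoint assoc (T : Type) (k : Z * Z * Z) (s : seq (Z * Z * Z * T)) : option T :=
  if s is (k', v) :: s' then
    if (k.1.1 =? k'.1.1) && (k.1.2 =? k'.1.2) && (k.2 =? k'.2) then Some v else assoc k s'
  else None.

Definition refuted (p a b c : Z) : bool :=
  match assoc (a, b, c) special with
  | Some (G3, g2, g2', g1) => refutes1 a b c G3 g2 g2' g1
  | None => let: (g2, g2', g1) := standard_tree p in
            refutes1 a b c (small_elements a b c) g2 g2' g1
  end.

(** Divisibility by squares of primes up to 13; this admits all squarefree
numbers. *)
Definition sqf_test (n : Z) : bool :=
  if n mod 4 =? 0 then false else if n mod 9 =? 0 then false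
  else if n mod 25 =? 0 then false else if n mod 49 =? 0 then false
  else if n mod 121 =? 0 then false else ~~ (n mod 169 =? 0).

(** Conditions on a triple in which a is the distinguished entry. *)
Definition candidate (a b c : Z) : bool :=
  if Z.odd c then if Z.gcd (a * b) c =? 1 then
    if Z.odd a then ((b - c) mod 4 =? 0) else true
  else false else false.
End Certificates.

(** * Values in a quadratic subfield *)

(** F is the subfield generated by R = sqrt (ab). *)
Definition inF (x : quad) : Prop := q1 x = 0 /\ q2 x = 0.

Section Subfield.
Variables a b c : Z.
Hypothesis hg : radical_triple a b c.
Variables (M : Type) (G : M -> M -> quad).
Hypothesis (Gi : forall y z, qint a b c (G y z))
  (Gpos : forall t y, sqroots a b c t -> 0 <= cj t (G y y))
  (GCS : forall t y z, sqroots a b c t -> cj t (G y z) ^+ 2 <= cj t (G y y) * cj t (G z z))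
  (Grep : forall g, qint a b c g -> (forall t, sqroots a b c t -> 0 < cj t g) ->
        exists x y, qint a b c x /\ qscale 4 g = qadd (qmul a b c x x) (qscale 4 (G y y)))
  (Gdet : forall t y1 y2 y3, sqroots a b c t ->
        det3 (cj t (G y1 y1)) (cj t (G y2 y2)) (cj t (G y3 y3))
             (cj t (G y1 y2)) (cj t (G y1 y3)) (cj t (G y2 y3)) = 0).

Definition captured (Y : quad) : Prop := forall x, qint a b c x ->
  (forall t, sqroots a b c t -> cj t x ^+ 2 <= cj t Y) -> inF x.

(** Changing the sign of the root of c fixes R, hence F, and changes the signs
of P and Q. *)
Lemma cj_inF (t : algR * algR * algR) x : inF x -> cj (t.1.1, t.1.2, - t.2) x = cj t x.
Proof. by case: t => [[ta tb] tc] [h1 h2]; rewrite /cj h1 h2 /= rmorph0 !mul0r !addr0. Qed.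

(** If g = x^2 + Q(y1) then x and the products of y1 with y2 and y3 have squares
below C g, so they are in F.  Compare the Gram determinant at a place and at its
image under the conjugation that fixes F: only Q(y1) may change, and its
coefficient is not 0.  So Q(y1) and g are fixed by the conjugation. *)
Lemma core_refutation C g y2 y3 :
  qint a b c g -> (forall t, sqroots a b c t -> 0 < cj t g) -> ~ inF g ->
  (4 <= C)%R -> captured (qscale C g) ->
  inF (G y2 y2) -> inF (G y3 y3) -> inF (G y2 y3) ->
  (forall t, sqroots a b c t -> cj t (G y2 y2) <= zr C) ->
  (forall t, sqroots a b c t -> cj t (G y3 y3) <= zr C) ->
  (exists2 t, sqroots a b c t & cj t (G y2 y2) * cj t (G y3 y3) - cj t (G y2 y3) ^+ 2 != 0) ->
  False.
Proof.
move=> ig pg gF C4 cap F2 F3 F23 b2 b3 [t0 ht0 nz].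
have [x [y1 [ix e]]] := Grep ig pg.
have ey t : sqroots a b c t -> 4 * cj t g = cj t x ^+ 2 + 4 * cj t (G y1 y1).
  move=> ht; have /(congr1 (cj t)) := e; rewrite cjD !cjZ (cjM _ _ ht) expr2.
  by rewrite (_ : zr (Zpos 4) = 4).
have Fx : inF x.
  apply: cap => // t ht; rewrite cjZ; have := ey t ht; have := Gpos y1 ht; have := pg t ht.
  have : 4 <= zr C :> algR by rewrite -(zr_le algR) rmorph_nat in C4.
  move: (zr C) (cj t g) (cj t x) (cj t (G y1 y1)) => k u v w hk hu hw hv.
  have : 4 * u <= k * u by rewrite ler_pM2r.
  by lra.
have le1 t : sqroots a b c t -> cj t (G y1 y1) <= cj t g.
  by move=> ht; have := ey t ht; have := sqr_ge0 (cj t x); lra.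
have FB y : (forall t, sqroots a b c t -> cj t (G y y) <= zr C) -> inF (G y1 y).
  move=> hb; apply: cap => // t ht; apply: le_trans (GCS y1 y ht) _.
  rewrite cjZ mulrC; apply: ler_pM; [exact: Gpos | exact: Gpos | exact: hb | exact: le1].
have F12 := FB _ b2; have F13 := FB _ b3.
pose s (t : algR * algR * algR) := (t.1.1, t.1.2, - t.2).
have hs t : sqroots a b c t -> sqroots a b c (s t) by case=> ? ? ?; split; rewrite /= ?sqrrN.
have D1 := Gdet y1 y2 y3 ht0; have D2 := Gdet y1 y2 y3 (hs _ ht0).
move: D2; rewrite /s (cj_inF t0 F2) (cj_inF t0 F3) (cj_inF t0 F23) (cj_inF t0 F12) (cj_inF t0 F13) => D2.
have eqA : cj t0 (G y1 y1) = cj (s t0) (G y1 y1).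
  apply: (mulIf nz); move: D1 D2; rewrite /det3 -/(s t0).
  move: (cj t0 (G y1 y1)) (cj (s t0) (G y1 y1)) => u v D1 D2.
  by apply/eqP; rewrite -subr_eq0 -[X in _ == X](subrr 0) -{1}D1 -D2; apply/eqP; ring.
have eqg : cj t0 g = cj (s t0) g.
  have h0 := ey _ ht0; have h1 := ey _ (hs _ ht0); move: h0 h1 eqA; rewrite /s (cj_inF t0 Fx).
  move: (cj t0 g) (cj _ g) (cj t0 x) (cj t0 (G y1 y1)) (cj _ (G y1 y1)) => u v w k l h0 h1 e'.
  by rewrite -e' in h1; lra.
apply: gF; case: (ht0) => ea eb ec; case: (hg) => [[a0 b0 c0] _ _].
have ne (z : algR) m : 0 < m -> z ^+ 2 = zr m -> z != 0.
  by move=> m0 ez; apply: contraTneq (m0) => z0; rewrite -(zr_gt0 algR) -ez z0 expr0n ltxx.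
have na := ne _ _ a0 ea; have nb := ne _ _ b0 eb; have nc := ne _ _ c0 ec.
have z12 : zr (q1 g) * t0.1.2 + zr (q2 g) * t0.1.1 = 0.
  have : (zr (q1 g) * t0.1.2 + zr (q2 g) * t0.1.1) * t0.2 *+ 2 = 0.
    by move: eqg; rewrite /cj /s /= => eqg; rewrite -[RHS](subrr (cj t0 g)) /cj {2}eqg; ring.
  by move/eqP; rewrite mulrn_eq0 mulf_eq0 (negPf nc) orbF => /eqP.
(* squaring: q1^2 b = q2^2 a, so that a b is a square unless q1 = q2 = 0 *)
have sq : zr (q1 g) ^+ 2 * zr b = zr (q2 g) ^+ 2 * zr a :> algR.
  rewrite -ea -eb -!exprMn; have -> : zr (q1 g) * t0.1.2 = - (zr (q2 g) * t0.1.1).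
    by apply/eqP; rewrite -addr_eq0 z12.
  by rewrite sqrrN.
have sqZ : q1 g * q1 g * b = q2 g * q2 g * a.
  by apply: (@zr_inj algR); rewrite !rmorphM -!expr2.
case: (hg) => _ [_ _ h3] [_ _ k3].
have q20 : q2 g = 0.
  have [//|n2] := eqVneq (q2 g) 0.
  have := @sqf_not_square (a * b) (zr (q1 g * b) / zr (q2 g)) h3 k3; case.
  have n2' : zr (q2 g) != 0 :> rat.
    by apply: contraNneq n2 => e2; apply/eqP/(@zr_inj rat); rewrite e2 rmorph0.
  rewrite expr_div_n; apply: (mulIf (expf_neq0 2 n2')); rewrite divfK ?expf_neq0 //.
  rewrite -!rmorphXn -rmorphM; congr zr.
  by rewrite !expr2; transitivity (q1 g * q1 g * b * b); [ring | rewrite sqZ; ring].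
split=> //; move: sqZ; rewrite q20 !mul0r => /eqP; rewrite !mulf_eq0 orbb (gt_eqF b0) orbF.
by move/eqP.
Qed.
End Subfield.

Local Arguments Z.mul : simpl never.
Local Arguments Z.add : simpl never.
Local Arguments Z.sub : simpl never.

(** * Trees over a quadratic subfield *)

Section Tree2.
Local Open Scope Z_scope.
Variable p : Z.

(** Here (u, v) stands for (u + v sqrt p) / 4.  The quarter coordinates of an
integer of F are even. *)
Definition okF (x : Z * Z) : Prop :=
  exists k l n, x = (2 * k, 2 * l) /\ k * k - p * (l * l) = 4 * n.
(** Nonnegative at both places. *)
Definition geF (x : Z * Z) : Prop := 0 <= x.1 /\ p * (x.2 * x.2) <= x.1 * x.1.
Definition gtF (x : Z * Z) : Prop := 0 < x.1 /\ p * (x.2 * x.2) < x.1 * x.1.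
Definition mulF (x y : Z * Z) : Z * Z := (x.1 * y.1 + p * (x.2 * y.2), x.1 * y.2 + x.2 * y.1).
(** A is a possible value of the form at y when g = x^2 + Q(y) with x in F. *)
Definition valF (g A : Z * Z) : Prop := exists x,
  [/\ okF x, geF A, 4 * g.1 = (mulF x x).1 + 4 * A.1 & 4 * g.2 = (mulF x x).2 + 4 * A.2].
Definition leF (C : Z) (A : Z * Z) : Prop := geF (C - A.1, - A.2).

(** All ways of representing [g1] by x^2 + Q(y2), then [g2] (if Q(y2) = 1) or
[g2'] by x^2 + Q(y3), with x in F, give values at most C and, whatever the
scalar product of y2 and y3 in F is, a nonzero determinant. The bound D is for
the squares of the elements that have to be known to be in F: the two x and
the scalar product. *)
Definition tree (C D : Z) (g1 g2 g2' : Z * Z) : Prop :=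
  [/\ okF g1, okF g2, okF g2' & [/\ gtF g1, gtF g2 & gtF g2']] /\
  [/\ leF D (4 * g1.1, 4 * g1.2), leF D (4 * g2.1, 4 * g2.2) & leF D (4 * g2'.1, 4 * g2'.2)] /\
  forall A, valF g1 A -> leF C A /\
  forall B, valF (if A == (4, 0) then g2 else g2') B ->
   [/\ leF C B, leF D (mulF A B) & forall x, okF x -> mulF x x <> mulF A B].

Definition okFb (x : Z * Z) : bool := (x.1 * x.1 - p * (x.2 * x.2)) mod 16 =? 0.
Definition geFb (x : Z * Z) : bool := (0 <=? x.1) && (p * (x.2 * x.2) <=? x.1 * x.1).
Definition gtFb (x : Z * Z) : bool := (0 <? x.1) && (p * (x.2 * x.2) <? x.1 * x.1).
Definition subF (x y : Z * Z) : Z * Z := (x.1 - y.1, x.2 - y.2).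
Definition sqF (y : Z * Z) : seq (Z * Z) :=
  let h := Z.sqrt y.1 in let k := Z.sqrt (y.1 / p) in
  [seq x <- [seq (u, v) | u <- zseq2 false (- h) h, v <- zseq2 false (- k) k]
  | okFb x && geFb (subF y (mulF x x))].
Definition resF (g : Z * Z) : seq (Z * Z) :=
  [seq ((4 * g.1 - (mulF x x).1) / 4, (4 * g.2 - (mulF x x).2) / 4) | x <- sqF (4 * g.1, 4 * g.2)].
(** For a given p, [tree] is a finite computation. *)
Definition treeb (C D : Z) (g1 g2 g2' : Z * Z) : bool :=
  all (fun g => [&& Z.even g.1, Z.even g.2, okFb g, gtFb g & geFb (D - 4 * g.1, - (4 * g.2))]) [:: g1; g2; g2'] &&
  all (fun A => geFb (C - A.1, - A.2) &&
    all (fun B => [&& geFb (C - B.1, - B.2), geFb (D - (mulF A B).1, - (mulF A B).2)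
                    & all (fun x => mulF x x != mulF A B) (sqF (mulF A B))])
      (resF (if A == (4, 0) then g2 else g2'))) (resF g1).

Hypothesis p0 : 0 < p.

Lemma geFP x : reflect (geF x) (geFb x).
Proof. by apply: (iffP andP) => -[/Z.leb_le h /Z.leb_le k]. Qed.
Lemma gtFP x : reflect (gtF x) (gtFb x).
Proof. by apply: (iffP andP) => -[/Z.ltb_lt h /Z.ltb_lt k]. Qed.

Lemma okFP x : reflect (okF x) [&& Z.even x.1, Z.even x.2 & okFb x].
Proof.
apply: (iffP and3P) => [[/Z.even_spec[k hk] /Z.even_spec[l hl] /Z.eqb_eq h]|[k [l [n [-> e]]]]].
  case: x hk hl h => x y /= -> -> /Z.mod_divide[] // n h; exists k, l, n; split=> //; lia.
split; rewrite /= ?Z.even_mul //; apply/Z.eqb_eq/Z.mod_divide => //=.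
by exists n; lia.
Qed.

Lemma mem_sqF x y : okF x -> geF (subF y (mulF x x)) -> x \in sqF y.
Proof.
move=> hx hg; case: (hx) => k [l [n [ex _]]].
rewrite mem_filter; have /and3P[_ _ ->] := introT (okFP x) hx; rewrite (introT (geFP _) hg) /=.
case: hg => /= hg _; rewrite ex /= in hg.
have -> : x = (2 * k, 2 * l) by [].
have h1 : Z.abs (2 * k) <= Z.sqrt y.1 by apply/Z.sqrt_le_square; nia.
have h2 : Z.abs (2 * l) <= Z.sqrt (y.1 / p).
  have ? : Z.abs (2 * l) * Z.abs (2 * l) <= y.1 / p by apply: Z.div_le_lower_bound; nia.
  by apply/Z.sqrt_le_square => //; nia.
apply/allpairsP; exists (2 * k, 2 * l); split=> //=.
  by have := @mem_zseq2 (- Z.sqrt y.1) (Z.sqrt y.1) (2 * k); rewrite Z.odd_mul; apply; lia.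
by have := @mem_zseq2 (- Z.sqrt (y.1 / p)) (Z.sqrt (y.1 / p)) (2 * l); rewrite Z.odd_mul; apply; lia.
Qed.

Lemma mem_resF g A : valF g A -> A \in resF g.
Proof.
case=> x [ox gA e1 e2]; apply/mapP; exists x.
  apply: mem_sqF => //; case: gA => h1 h2; rewrite /subF /= e1 e2.
  by split=> /=; move: h1 h2; case: A {e1 e2} => u v /=; nia.
rewrite e1 e2; case: A {e1 e2 gA} => u v /=.
by rewrite !Z.add_simpl_l ![4 * _]Z.mul_comm !Z.div_mul.
Qed.

Lemma treebP C D g1 g2 g2' : treeb C D g1 g2 g2' -> tree C D g1 g2 g2'.
Proof.
case/andP=> /and4P[/and5P[a1 a2 a3 /gtFP a4 /geFP a5] /and5P[b1 b2 b3 /gtFP b4 /geFP b5] /and5P[c1 c2 c3 /gtFP c4 /geFP c5] _].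
move/allP=> h; split; first by split; last split; rewrite //; apply/okFP/and3P.
split; first by split.
move=> A /mem_resF/h/andP[/geFP hA /allP{}h]; split=> // B /mem_resF/h/and3P[/geFP hB /geFP hD /allP{}h].
split=> // x ox e; have := h x; rewrite e eqxx; move=> H; suff: false by []; apply: H.
apply: mem_sqF => //; rewrite e /subF !Z.sub_diag; split=> //=; lia.
Qed.
End Tree2.

(** * The trees that are used *)

Section Trees.
Local Open Scope Z_scope.
Lemma tree2 : tree 2 14 176 (8, 4) (12, 0) (12, 0).
Proof. by apply: treebP => //; vm_compute. Qed.
Lemma tree3 : tree 3 23 344 (8, 4) (16, 4) (16, 4).
Proof. by apply: treebP => //; vm_compute. Qed.
Lemma tree5 : tree 5 19 176 (8, 0) (14, 2) (10, 2).
Proof. by apply: treebP => //; vm_compute. Qed.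
Lemma tree10 : tree 10 28 224 (8, 0) (12, 0) (28, 0).
Proof. by apply: treebP => //; vm_compute. Qed.

(** The number n / 4 is at most 5. If the coefficient of sqrt p in x is not 0,
it is 1 / 2 up to sign, and p is 13 or 17; but then x^2 > 5 at one of the
places. *)
Lemma small_sq_rational p n x y : sqf p -> 6 <= p -> 0 <= n <= 20 -> okF p x ->
  geF p y -> 4 * n = (mulF p x x).1 + 4 * y.1 -> 0 = (mulF p x x).2 + 4 * y.2 ->
  x.2 = 0 /\ exists k, x.1 = 4 * k.
Proof.
move=> hp p6 hn [k [l [m [-> e]]]] /=; case: y => u v [/= u0 uv]; rewrite /mulF /= => e1 e2.
have p4 : p mod 4 <> 0 by apply: sqf_mod4.
have [l0|l0] : l = 0 \/ 1 <= l * l by nia.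
  have ek : k * k = 4 * m by nia.
  have : (Z.even k). 
    have : Z.even (k * k) by rewrite ek Z.even_mul.
    by rewrite Z.even_mul orbb.
  by move=> /Z.even_spec[j ej]; split; [lia | exists j; lia].
exfalso; have en : n = k * k + p * (l * l) + u by lia.
have kk : 0 <= k * k by exact: Z.square_nonneg.
have l1 : l * l < 4.
  by move: (l * l) (k * k) l0 kk en => l2 k2 *; nia.
have {l1} ll : l * l = 1.
  have [->|->] : l = 1 \/ l = -1 by nia.
    by [].
  by [].
have eu : u = n - k * k - p by rewrite ll in en; lia.
have ev : v * v = 4 * (k * k).
  have -> : v = - (2 * (k * l)) by lia.
  have -> : - (2 * (k * l)) * - (2 * (k * l)) = 4 * (k * k) * (l * l) by ring.
  by rewrite ll; ring.
rewrite ev eu in uv; rewrite ll in e; rewrite eu in u0.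
have {ev e1 e2 en u v eu u0} kp : k * k + p <= n by lia.
have p9 : p <> 9.
  by move=> p9; have := hp 3; rewrite p9 => H; have : Z.abs 3 = 1 by apply: H; exists 1.
have p4' : forall j, p <> 4 * j by move=> j ej; apply: p4; rewrite ej Z.mul_comm Z.mod_mul.
have p_1 := p4' (k * k - m); have p_0 := p4' (- m); have p_4 := p4' (1 - m).
have : k * k = 0 \/ k * k = 1 \/ k * k = 4 \/ k * k = 9.
  have : k = 0 \/ k = 1 \/ k = 2 \/ k = 3 \/ k = -1 \/ k = -2 \/ k = -3 by nia.
  by lia.
case=> [ek|[ek|[ek|ek]]]; rewrite ek in e kp uv; [lia| |lia|lia].
have : p = 13 \/ p = 17 by lia.
by case=> ep; rewrite ep in uv kp; nia.
Qed.

(** In terms of rational integers, 2 is 2 + 0 or 1 + 1; after the value 1, the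
element 3 is 3 + 0 or 2 + 1, and after the value 2, the element 5 is 5 + 0, 4
+ 1 or 1 + 4. The determinants are 3, 2 and 10, 8, 2 minus squares in F. For p
= 10 the number 10 is a square in F. *)
Lemma tree_large p : sqf p -> 6 <= p -> p <> 10 -> tree p 20 176 (8, 0) (12, 0) (20, 0).
Proof.
move=> hp p6 p10.
have V n A : 0 <= n <= 20 -> valF p (n, 0) A -> A.2 = 0 /\ exists k, n = 4 * (k * k) + A.1 /\ 0 <= A.1.
  move=> hn [x [ox gA e1 e2]].
  have [x0 [k ek]] := small_sq_rational hp p6 hn ox gA e1 e2.
  move: e1 e2; rewrite /mulF /= x0 ek => e1 e2; split; first by lia.
  by exists k; split; [lia | case: gA].
have ok n : okF p (4 * n, 0) by exists (2 * n), 0, (n * n); split; [congr pair |]; lia.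
have gt n : 0 < n -> gtF p (n, 0) by move=> n0; split=> /=; nia.
split; first by split; last split; first [exact: (ok 2) | exact: (ok 3) | exact: (ok 5) | exact: gt].
split; first by split; rewrite /leF /geF /=; lia.
have S k n m : n = 4 * (k * k) + m -> 0 <= m -> n <= 20 -> k * k = 0 \/ k * k = 1 \/ k * k = 4.
  move=> h1 h2 h3; have : k = 0 \/ k = 1 \/ k = 2 \/ k = -1 \/ k = -2 by nia.
  by lia.
have le C n : n <= C -> leF p C (n, 0) by move=> h; split=> /=; nia.
have ns n : n = 2 \/ n = 3 \/ n = 8 \/ n = 10 -> forall x, okF p x -> mulF p x x <> (16 * n, 0).
  move=> hn x [k [l [m [-> e]]]] [] e1 e2.
  have : k = 0 \/ l = 0 by nia.
  case=> z; rewrite z in e e1.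
    have el : p * (l * l) = 4 * n by lia.
    have lr : l = 0 \/ l = 1 \/ l = 2 \/ l = -1 \/ l = -2 by nia.
    have [|[|]] : l * l = 0 \/ l * l = 1 \/ l * l = 4 by lia.
    + by move=> l2; rewrite l2 in el; lia.
    + move=> l2; have : p mod 4 = 0 by rewrite (_ : p = n * 4) ?Z.mod_mul //; lia.
      exact: sqf_mod4.
    + move=> l2; rewrite l2 in el; have p8 : p = 8 by lia.
      by apply: (sqf_mod4 hp); rewrite p8.
  have ek : Z.abs k * Z.abs k = 4 * n by lia.
  have := Z.abs_nonneg k; move: (Z.abs k) ek => j ek j0.
  have : j = 0 \/ j = 1 \/ j = 2 \/ j = 3 \/ j = 4 \/ j = 5 \/ j = 6 \/ j = 7 by nia.
  by lia.
have res n A : 0 <= n <= 20 -> valF p (n, 0) A ->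
    exists m, A = (m, 0) /\ 0 <= m <= n /\ (n = m \/ n = m + 4 \/ n = m + 16).
  case: A => m m' hn /(V _ _ hn)[/= -> [k [e m0]]]; exists m; split=> //.
  by have := S k n m e m0; lia.
move=> A /res[]; first by []. move=> m [-> [hm1 hm]]; split; first by apply: le; lia.
have nn n1 n2 n : n1 * n2 = 16 * n -> mulF p (n1, 0) (n2, 0) = (16 * n, 0).
  by move=> e; rewrite /mulF /= e; congr pair; ring.
have leD n : n <= 11 -> leF p 176 (16 * n, 0) by move=> h; apply: le; lia.
have done n B (mB : B.1 <= 20) (B0 : B.2 = 0) : n = 2 \/ n = 3 \/ n = 8 \/ n = 10 -> m * B.1 = 16 * n ->
   [/\ leF p 20 B, leF p 176 (mulF p (m, 0) B) & forall x, okF p x -> mulF p x x <> mulF p (m, 0) B].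
  case: B mB B0 => B1 B2 /= mB -> hn e; rewrite (nn _ _ _ e).
  by split; [exact: le | apply: leD; lia | exact: ns].
move=> B; have [e|e] : m = 4 \/ m = 8 by lia.
  rewrite e eqxx => /res[]; first by []. move=> m' [-> [hm1' hm']].
  rewrite -e; have [e'|e'] : m' = 12 \/ m' = 8 by lia.
    by apply: (done 3) => /=; lia.
  by apply: (done 2) => /=; lia.
rewrite e => /res[]; first by []. move=> m' [-> [hm1' hm']]; rewrite -e.
have [e'|[e'|e']] : m' = 20 \/ m' = 16 \/ m' = 4 by lia.
- by apply: (done 10) => /=; lia.
- by apply: (done 8) => /=; lia.
- by apply: (done 2) => /=; lia.
Qed.
End Trees.

Section SubfieldTree.
Variables a b c : Z.
Hypothesis hg : radical_triple a b c.
Local Notation p := (a * b)%R.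
Definition quadF (x : Z * Z) : quad := Quad x.1 0 0 x.2.

Lemma qint1_F (p m1 m2 d : Z) x : okF p x ->
  qint1 m1 m2 p d x.1 0 0 x.2 /\ qint1 p m1 m2 d x.1 x.2 0 0.
Proof.
case=> k [l [n [-> e]]]; split; apply/qint1P.
  exists (Z.mul k k), (Z.mul 2 n), Z0, (Z.mul n n) => /=; split; lia.
exists (Z.mul 4 n), (Z.add (Z.mul 2 n) (Z.mul p (Z.mul l l))), (Z.mul k l), (Z.mul n n) => /=.
have ek : Z.mul k k = Z.add (Z.mul 4 n) (Z.mul p (Z.mul l l)) by lia.
split; [lia | lia | lia |].
have -> : Z.mul (Z.mul k l) (Z.mul k l) = Z.mul (Z.mul k k) (Z.mul l l) by lia.
by rewrite ek; lia.
Qed.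

Lemma quadF_ok x : okF p x -> qint a b c (quadF x).
Proof.
move=> ox; rewrite /quadF.
have h1 m1 m2 d := proj1 (qint1_F m1 m2 d ox).
have h2 m1 m2 d := proj2 (qint1_F m1 m2 d ox).
by apply/and3P; split; [exact: h1 | exact: h1 | exact: h2].
Qed.

End SubfieldTree.

Section OkF.
Local Open Scope Z_scope.
(** Repeated division by 2 of a number whose square is divisible by 256. *)
Lemma square_4 z m : z * z = 4 * m -> exists w, z = 2 * w /\ w * w = m.
Proof.
move=> e; have : Z.even (z * z) by rewrite e Z.even_mul.
by rewrite Z.even_mul orbb => /Z.even_spec[w ew]; exists w; split; lia.
Qed.

Lemma okF_qint1 (q m1 m2 d : Z) x : q mod 4 <> 0 -> qint1 q m1 m2 d x.1 x.2 0 0 -> okF q x.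
Proof.
case: x => x y q4 /qint1P[n [A [T [N [/= _ e1 e2 e3]]]]].
have {}e1 : x * x + q * (y * y) = 8 * A by lia.
have {}e2 : x * y = 4 * T by lia.
have e4 : (x * x - q * (y * y)) * (x * x - q * (y * y)) = 4 * (4 * (4 * (4 * N))).
  have -> : (x * x - q * (y * y)) * (x * x - q * (y * y)) =
    (x * x + q * (y * y)) * (x * x + q * (y * y)) - 4 * q * ((x * y) * (x * y)) by ring.
  by rewrite e1 e2; lia.
have [z1 [f1 /square_4[z2 [f2 /square_4[z3 [f3 /square_4[z4 [f4 _]]]]]]]] := square_4 e4.
have {e4 f1 f2 f3 f4 e3} f : x * x - q * (y * y) = 16 * z4 by lia.
have od z : exists k, z = 2 * k \/ z = 2 * k + 1.
  by exists (z / 2); have := Z.div_mod z 2; have := Z.mod_pos_bound z 2; lia.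
have [k [ek|ek]] := od x; have [l [el|el]] := od y.
- by exists k, l, z4; split; [rewrite ek el | move: f; rewrite ek el; lia].
- exfalso; apply: q4; apply/Z.mod_divide => //; exists (k * k - q * (l * l + l) - 4 * z4).
  by move: f; rewrite ek el; lia.
- by exfalso; move: f; rewrite ek el; lia.
- by exfalso; move: f e1; rewrite ek el; lia.
Qed.
End OkF.

Section Signs.
Local Open Scope ring_scope.
Variables (p : Z) (w : algR).
Hypothesis ew : w ^+ 2 = zr p.

Lemma geF_conj u v : (0 <= zr u + zr v * w) && (0 <= zr u - zr v * w) = geFb p (u, v).
Proof.
have -> : geFb p (u, v) = (0 <= u) && (p * (v * v) <= u * u)%Z by [].
rewrite -(zr_ge0 algR) -(zr_le algR) !zrZM -ew.
move: (zr u) (zr v) => {}u {}v.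
have -> : w ^+ 2 * (v * v) = (v * w) ^+ 2 by ring.
rewrite -expr2.
move: (v * w) => z; apply/idP/idP => /andP[h1 h2].
  by rewrite -[X in _ && X]subr_ge0 subr_sqr mulr_ge0 // andbT; lra.
rewrite -subr_ge0 subr_sqr in h2.
by apply/andP; split; nra.
Qed.
Lemma gtF_conj u v : (0 < zr u + zr v * w) && (0 < zr u - zr v * w) = gtFb p (u, v).
Proof.
have -> : gtFb p (u, v) = (0 < u) && (p * (v * v) < u * u)%Z by [].
rewrite -(zr_gt0 algR) -(zr_lt algR) !zrZM -ew.
move: (zr u) (zr v) => {}u {}v.
have -> : w ^+ 2 * (v * v) = (v * w) ^+ 2 by ring.
rewrite -expr2.
move: (v * w) => z; apply/idP/idP => /andP[h1 h2].
  by rewrite -[X in _ && X]subr_gt0 subr_sqr mulr_gt0 // andbT; lra.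
rewrite -subr_gt0 subr_sqr in h2.
by apply/andP; split; nra.
Qed.
End Signs.

Section Refutation.
Local Open Scope ring_scope.
Variables a b c : Z.
Hypothesis hg : radical_triple a b c.
Local Notation p := (a * b).

Lemma okF_inF x : qint a b c x -> inF x -> okF p (q0 x, q3 x).
Proof.
case: (hg) => _ [_ _ /sqf_mod4 h] _; case: x => x0 x1 x2 x3 /and3P[_ _ i3] [/= e1 e2].
by rewrite e1 e2 in i3; exact: (@okF_qint1 _ _ _ _ (x0, x3) h i3).
Qed.

Lemma cj_quadF t x : cj t (quadF x) = zr x.1 + zr x.2 * (t.1.1 * t.1.2) :> algR.
Proof. by rewrite /cj /quadF /= !rmorph0 !mul0r !addr0. Qed.

Lemma inF_quadF x : inF x -> x = quadF (q0 x, q3 x).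
Proof. by case: x => ? ? ? ? [/= -> ->]. Qed.

Lemma subfield_root : exists w : algR, [/\ w ^+ 2 = zr p, 
  exists2 t, sqroots a b c t & t.1.1 * t.1.2 = w, exists2 t, sqroots a b c t & t.1.1 * t.1.2 = - w
  & forall t, sqroots a b c t -> t.1.1 * t.1.2 = w \/ t.1.1 * t.1.2 = - w].
Proof.
case: (hg) => [[a0 b0 c0] _ _].
have [[[ta tb] tc] [[/= ea eb ec] pa pb pc]] := sqrts_exist a0 b0 c0.
exists (ta * tb); split.
- by rewrite exprMn ea eb rmorphM.
- by exists (ta, tb, tc).
- by exists (- ta, tb, tc); rewrite ?mulNr //; split; rewrite /= ?sqrrN.
- case=> [[sa sb] sc] [/= ha hb hc].
  have /eqP : (sa * sb) ^+ 2 = (ta * tb) ^+ 2 by rewrite !exprMn ha hb ea eb.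
  by rewrite eqf_sqr => /orP[] /eqP; [left | right].
Qed.

Lemma geF_cj x : (forall t, sqroots a b c t -> 0 <= cj t (quadF x)) <-> geF p x.
Proof.
have [w [ew [t ht et] [t' ht' et'] hw]] := subfield_root; split=> [h|].
  apply/geFP; case: x h => u v h; rewrite -(geF_conj ew).
  by have := h _ ht; have := h _ ht'; rewrite !cj_quadF et et' /= mulrN => -> ->.
move=> /geFP; case: x => u v; rewrite -(geF_conj ew) => /andP[h1 h2] s hs.
by rewrite cj_quadF /=; case: (hw _ hs) => ->; rewrite ?mulrN.
Qed.

Lemma gtF_cj x : gtF p x -> forall t, sqroots a b c t -> 0 < cj t (quadF x).
Proof.
have [w [ew _ _ hw]] := subfield_root.
move=> /gtFP; case: x => u v; rewrite -(gtF_conj ew) => /andP[h1 h2] s hs.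
by rewrite cj_quadF /=; case: (hw _ hs) => ->; rewrite ?mulrN.
Qed.

Lemma quadFM x y : qmul a b c (quadF x) (quadF y) = quadF (mulF p x y).
Proof. by rewrite /qmul /quadF /mulF /=; congr Quad; rewrite !(Z.mul_0_r, Z.mul_0_l, Z.add_0_r). Qed.

(** The representations of the elements of the tree take place in F by the
bound D, so the tree produces y2 and y3 as needed. *)
Lemma F_refutation C D g1 g2 g2' g : binary_universal a b c -> tree p C D g1 g2 g2' ->
  (4 <= C) -> qint a b c g -> (forall t, sqroots a b c t -> 0 < cj t g) -> ~ inF g ->
  captured a b c (qscale C g) -> captured a b c (Quad D 0 0 0) -> False.
Proof.
case=> M [G [Gi Gpos GCS Grep Gdet]] [[o1 o2 o3 [p1 p2 p3]] [[d1 d2 d3] T]] C4 ig pg gF capC capD.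
have cjZr n t : cj t (Quad n 0 0 0) = zr n :> algR by rewrite (cj_quadF t (n, 0)) rmorph0 mul0r addr0.
have leD A : leF p D A -> forall t, sqroots a b c t -> cj t (quadF A) <= zr D.
  move=> /geF_cj h t ht; have := h t ht; rewrite !cj_quadF /= zrZB zrZN mulNr.
  by lra.
have leC A : leF p C A -> forall t, sqroots a b c t -> cj t (quadF A) <= zr C.
  move=> /geF_cj h t ht; have := h t ht; rewrite !cj_quadF /= zrZB zrZN mulNr.
  by lra.
have four : zr (Zpos 4) = 4 :> algR by [].
have rep h : okF p h -> gtF p h -> leF p D (Z.mul 4 h.1, Z.mul 4 h.2) ->
    exists y A, G y y = quadF A /\ valF p h A.
  move=> oh ph dh; have [x [y [ix e]]] := Grep _ (quadF_ok c oh) (gtF_cj ph).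
  have Fx : inF x.
    apply: capD => // t ht; rewrite cjZr; apply: le_trans (leD _ dh t ht).
    rewrite cj_quadF /= !zrZM; have := congr1 (cj t) e; rewrite cjD !cjZ (cjM _ _ ht) !cj_quadF /= -expr2 four.
    by have := Gpos t y ht; lra.
  have ex := inF_quadF Fx.
  have e' : qscale 4 (quadF h) = qadd (quadF (mulF p (q0 x, q3 x) (q0 x, q3 x))) (qscale 4 (G y y)).
    by rewrite -quadFM -ex.
  have Fy : inF (G y y).
    by move: e'; case: (G y y) => y0 y1 y2 y3 [_ h1 h2 _]; split=> /=; lia.
  exists y, (q0 (G y y), q3 (G y y)); split; first exact: inF_quadF.
  exists (q0 x, q3 x); split; first exact: okF_inF.
  - by apply/geF_cj => t ht; rewrite -inF_quadF //; apply: Gpos.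
  - by case: e'.
  - by case: e'.
have [y2 [A [eA vA]]] := rep _ o1 p1 d1.
have [lA TA] := T A vA.
have [y3 [B [eB vB]]] : exists y B, G y y = quadF B /\ valF p (if A == (Z.of_nat 4, Z0) then g2 else g2') B.
  by case: ifP => _; apply: rep.
have [lB lAB ns] := TA B vB.
have F23 : inF (G y2 y3).
  apply: capD => // t ht; rewrite cjZr; apply: le_trans (leD _ lAB t ht).
  by rewrite -quadFM (cjM _ _ ht) -eA -eB; apply: GCS.
have o23 := okF_inF (Gi y2 y3) F23.
have {}ns := ns _ o23; set z := (q0 _, q3 _) in ns.
apply: (core_refutation hg Gi Gpos GCS Grep Gdet ig pg gF C4 capC (y2 := y2) (y3 := y3)) => //.
- by rewrite eA.
- by rewrite eB.
- by rewrite eA; apply: leC.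
- by rewrite eB; apply: leC.
have cjz t : sqroots a b c t -> cj t (G y2 y2) * cj t (G y3 y3) - cj t (G y2 y3) ^+ 2 =
   zr ((mulF p A B).1 - (mulF p z z).1) + zr ((mulF p A B).2 - (mulF p z z).2) * (t.1.1 * t.1.2).
  move=> ht; rewrite eA eB (inF_quadF F23) -/z expr2 -!(cjM _ _ ht) !quadFM !cj_quadF !rmorphB /=.
  by ring.
have [w [ew [t ht et] [t' ht' et'] _]] := subfield_root.
have := cjz _ ht; have := cjz _ ht'; rewrite et et'.
set u := _ - (mulF _ z z).1; set v := _ - (mulF _ z z).2 => h' h.
have [h0|] := eqVneq (cj t (G y2 y2) * cj t (G y3 y3) - cj t (G y2 y3) ^+ 2) 0; last by exists t.
have [h0'|] := eqVneq (cj t' (G y2 y2) * cj t' (G y3 y3) - cj t' (G y2 y3) ^+ 2) 0; last by exists t'.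
case: ns; rewrite h0 in h; rewrite h0' in h'.
have zz (s : algR) k : s != 0 -> zr k * s = 0 -> k = 0.
  move=> s0 /eqP; rewrite mulf_eq0 (negPf s0) orbF => /eqP e.
  by apply: (@zr_inj algR); rewrite e rmorph0.
have w0 : w != 0.
  case: (hg) => [[a0 b0 _] _ _]; apply: contraTneq (mulr_gt0 a0 b0) => z0.
  by rewrite -(zr_gt0 algR) -ew z0 expr0n ltxx.
have u0 : u = 0 by apply: (zz 1); rewrite ?oner_neq0 //; lra.
have v0 : v = 0 by apply: (zz w) => //; lra.
case: (mulF p z z) (mulF p A B) @u @v u0 v0 {h h'} => z1 z2 [m1 m2] /= u0 v0.
by congr pair; lia.
Qed.
End Refutation.

(** * Small squares lie in a quadratic subfield *)

Section Real.
Variable R : rcfType.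
Implicit Types x y z s : R.

Lemma norm_sum_le x y s : `|x + y| <= s -> `|x - y| <= s -> `|x| + `|y| <= s.
Proof.
rewrite !ler_norml => /andP[? ?] /andP[? ?].
by case: (ger0P x) => ?; case: (ger0P y) => ?; lra.
Qed.

(** y0, ..., y3 are the terms of an element along 1, P, Q, R. The first two
conjugates are bounded by sqrt b1 and the last two by sqrt b2, so that |y0 +
y1| + |y2 + y3| and |y0 - y1| + |y2 - y3| are bounded by the same numbers; add
the two. *)
Lemma conj_norm_le (y0 y1 y2 y3 b1 b2 : R) :
  (y0 + y1 + y2 + y3) ^+ 2 <= b1 -> (y0 + y1 - y2 - y3) ^+ 2 <= b1 ->
  (y0 - y1 + y2 - y3) ^+ 2 <= b2 -> (y0 - y1 - y2 + y3) ^+ 2 <= b2 ->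
  4 * (`|y1| + `|y2|) ^+ 2 <= b1 + b2 + 2 * Num.sqrt (b1 * b2).
Proof.
move=> h1 h2 h3 h4.
have p1 : 0 <= b1 := le_trans (sqr_ge0 _) h1.
have p2 : 0 <= b2 := le_trans (sqr_ge0 _) h3.
have S z b : z ^+ 2 <= b -> `|z| <= Num.sqrt b by move=> h; rewrite -sqrtr_sqr ler_wsqrtr.
have k1 : `|y0 + y1| + `|y2 + y3| <= Num.sqrt b1.
  apply: norm_sum_le; apply: S; first by have -> : y0 + y1 + (y2 + y3) = y0 + y1 + y2 + y3 by ring.
  by have -> : y0 + y1 - (y2 + y3) = y0 + y1 - y2 - y3 by ring.
have k2 : `|y0 - y1| + `|y2 - y3| <= Num.sqrt b2.
  apply: norm_sum_le; apply: S; first by have -> : y0 - y1 + (y2 - y3) = y0 - y1 + y2 - y3 by ring.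
  by have -> : y0 - y1 - (y2 - y3) = y0 - y1 - y2 + y3 by ring.
have k3 : 2 * (`|y1| + `|y2|) <= Num.sqrt b1 + Num.sqrt b2.
  have := ler_normB (y0 + y1) (y0 - y1); have := ler_normD (y2 + y3) (y2 - y3).
  have -> : y0 + y1 - (y0 - y1) = 2 * y1 by ring.
  have -> : y2 + y3 + (y2 - y3) = 2 * y2 by ring.
  by rewrite !normrM (ger0_norm (ler0n _ 2)); lra.
have -> : b1 + b2 + 2 * Num.sqrt (b1 * b2) = (Num.sqrt b1 + Num.sqrt b2) ^+ 2.
  by rewrite sqrtrM // sqrrD !sqr_sqrtr // mulr_natl; ring.
have -> : 4 * (`|y1| + `|y2|) ^+ 2 = (2 * (`|y1| + `|y2|)) ^+ 2 by ring.
by apply: lerXn2r k3; rewrite nnegrE ?addr_ge0 ?mulr_ge0 ?addr_ge0 ?sqrtr_ge0 ?normr_ge0 ?ler0n.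
Qed.

Lemma sqrt_bound (x y : Z) : 0 < x -> zr x <= Num.sqrt (zr y) :> R -> x * x <= y.
Proof.
move=> x0; have {}x0 : 0 < zr x :> R by rewrite zr_gt0.
case: (lerP 0 (zr y : R)) => [y0 h|y0]; last by rewrite (ler0_sqrtr (ltW y0)) leNgt x0.
rewrite -(zr_le R) rmorphM -expr2 -(sqr_sqrtr y0).
by apply: lerXn2r h; rewrite nnegrE ?sqrtr_ge0 // ltW.
Qed.

Lemma sum_sq_ge (y1 y2 m : R) : 0 <= y1 -> 0 <= y2 ->
  [\/ m <= y1 ^+ 2, m <= y2 ^+ 2 | m <= 4 * y1 ^+ 2 /\ m <= 4 * y2 ^+ 2] -> m <= (y1 + y2) ^+ 2.
Proof.
move=> p1 p2; have p12 := mulr_ge0 p1 p2; have s1 := sqr_ge0 y1; have s2 := sqr_ge0 y2.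
have -> : (y1 + y2) ^+ 2 = y1 ^+ 2 + y2 ^+ 2 + 2 * (y1 * y2) by ring.
case=> [?|?|[h1 h2]]; [lra|lra|].
case: (lerP y1 y2) => h.
  have : y1 ^+ 2 <= y1 * y2 by rewrite expr2 ler_wpM2l.
  have : y1 ^+ 2 <= y2 ^+ 2 by rewrite ler_pXn2r.
  by lra.
have : y2 ^+ 2 <= y1 * y2 by rewrite expr2 ler_wpM2r // ltW.
have : y2 ^+ 2 <= y1 ^+ 2 by rewrite ler_pXn2r // ltW.
by lra.
Qed.
End Real.

Section Captured.
Variables a b c : Z.
Hypothesis hg : radical_triple a b c.

(** When bc <= ac this bounds the sum of the terms of x along P and Q from
below by w sqrt (bc): one coordinate is at least w or both are at least w / 2. *)
Definition spread (w : Z) : Prop := forall x, qint a b c x -> ~ inF x ->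
  [\/ w <= Z.abs (q1 x), w <= Z.abs (q2 x)
    | w <= Z.mul 2 (Z.abs (q1 x)) /\ w <= Z.mul 2 (Z.abs (q2 x))].

(** With m = 2 w^2 e this says that (u + v sqrt e)(u - v sqrt e) < (m - u)^2,
the negation of the upper bound for w^2 e that [conj_norm_le] gives for
elements with square at most u + v sqrt e. *)
Definition below (e w u v : Z) : bool :=
  let m := Z.mul (Z.mul 2 (Z.mul w w)) e in
  Z.ltb u m && Z.ltb (Z.sub (Z.mul u u) (Z.mul e (Z.mul v v))) (Z.mul (Z.sub m u) (Z.sub m u)).

(** For x outside F, [spread] bounds the sum of the terms along P and Q from
below, and [conj_norm_le] bounds it from above. *)
Lemma captured_spread (w u v : Z) : b <= a -> 0 <= w -> spread w -> below (b * c) w u v ->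
  captured a b c (Quad u v 0 0).
Proof.
move=> ba w0 hw /andP[/Z.ltb_lt h1 /Z.ltb_lt h2] x ix hx.
have [//|nF] : inF x \/ ~ inF x.
  by rewrite /inF; case: (eqVneq (q1 x) 0) => [->|/eqP]; case: (eqVneq (q2 x) 0) => [->|/eqP]; tauto.
exfalso; have lb := hw x ix nF.
have [P [Q [R [[P0 Q0 R0] [eP eQ eR] ex _]]]] := conj_signs hg.
have {ex} h e1 e2 e3 : (e1, e2, e3) \in signs ->
    lin P Q R e1 e2 e3 x ^+ 2 <= lin P Q R e1 e2 e3 (Quad u v 0 0).
  by move=> /ex[t ht hl]; rewrite -!hl; apply: hx.
have [k1 k2 k3 k4] : [/\
    (zr (q0 x) + zr (q1 x) * P + zr (q2 x) * Q + zr (q3 x) * R) ^+ 2 <= zr u + zr v * P,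
    (zr (q0 x) + zr (q1 x) * P - zr (q2 x) * Q - zr (q3 x) * R) ^+ 2 <= zr u + zr v * P,
    (zr (q0 x) - zr (q1 x) * P + zr (q2 x) * Q - zr (q3 x) * R) ^+ 2 <= zr u - zr v * P
  & (zr (q0 x) - zr (q1 x) * P - zr (q2 x) * Q + zr (q3 x) * R) ^+ 2 <= zr u - zr v * P].
  have := h 1 1 1 isT; have := h 1 (-1) (-1) isT.
  have := h (-1) 1 (-1) isT; have := h (-1) (-1) 1 isT.
  by rewrite /lin /= !(rmorphN1, rmorph1, rmorph0) !(mulN1r, mul1r, mulNr, mulr0, mul0r, oppr0, addr0).
have up := conj_norm_le k1 k2 k3 k4.
case: (hg) => [[a0 b0 c0] _ _].
have e0 : 0 <= b * c by rewrite ltW // mulr_gt0.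
have low : zr (Z.mul (Z.mul w w) (b * c)) <= (`|zr (q1 x) * P| + `|zr (q2 x) * Q|) ^+ 2.
  apply: sum_sq_ge => //; rewrite !real_normK ?num_real // !exprMn eP eQ.
  have H (y k m : Z) : 0 <= m -> b * c <= m -> w <= k * Z.abs y -> 0 <= k ->
      zr (Z.mul (Z.mul w w) (b * c)) <= zr k ^+ 2 * (zr y ^+ 2 * zr m) :> algR.
    move=> m0 em wy k0; rewrite !expr2 -!zrZM zr_le.
    have g1 : w * w <= k * Z.abs y * (k * Z.abs y) by apply: ler_pM.
    have g2 : w * w * (b * c) <= k * Z.abs y * (k * Z.abs y) * m.
      by apply: ler_pM => //; apply: mulr_ge0.
    have := Z.abs_square y; move: (Z.abs y) g2 => z g2 ez.
    apply: le_trans g2 _; rewrite le_eqVlt; apply/orP; left; apply/eqP.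
    have -> : k * z * (k * z) * m = k * k * (z * z) * m by ring.
    by rewrite (_ : z * z = y * y) //; ring.
  have eq : b * c <= a * c by rewrite ler_pM2r.
  have ej : 0 <= a * c by rewrite ltW // mulr_gt0.
  case: lb => [h1'|h1'|[h1' h2']].
  - by apply: Or31; have := H (q1 x) 1 _ e0 (lexx _); rewrite rmorph1 expr1n mul1r mul1r; apply.
  - by apply: Or32; have := H (q2 x) 1 _ ej eq; rewrite rmorph1 expr1n mul1r mul1r; apply.
  - apply: Or33; have e4 : 4 = zr (Zpos 2) ^+ 2 :> algR by rewrite -natrX.
    by rewrite e4; split; [exact: (H (q1 x) (Zpos 2) _ e0 (lexx _)) | exact: (H (q2 x) (Zpos 2) _ ej eq)].
have {low} up := le_trans (ler_wpM2l (ler0n _ 4) low) up.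
have Dn : (zr u + zr v * P) * (zr u - zr v * P) = zr (Z.sub (Z.mul u u) (Z.mul (b * c) (Z.mul v v))).
  by rewrite zrZB zrZM zrZM (zrZM _ v) -eP; ring.
rewrite Dn in up.
move: h1 h2; set m := Z.mul _ (b * c) => h1 h2.
have e4 : 4 * zr (Z.mul (Z.mul w w) (b * c)) = zr (Z.mul 2 m) :> algR.
  by rewrite (_ : 4 = zr (Zpos 4)) // -zrZM; congr zr; rewrite /m; move: (w * w) (b * c); clear; lia.
rewrite e4 zrZM in up.
have two : zr (Zpos 2) = 2 :> algR by [].
have {}up : zr (Z.sub m u) <= Num.sqrt (zr (Z.sub (Z.mul u u) (Z.mul (b * c) (Z.mul v v)))) :> algR.
  by rewrite zrZB; rewrite two in up; lra.
have mu : 0 < Z.sub m u by move: h1; clear; lia.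
by have := sqrt_bound mu up; move: h2; clear; lia.
Qed.

(** The coordinates of an integer have equal parities. *)
Lemma spread2 : spread 2.
Proof.
move=> x ix nF; case: (hg) => _ [/sqf_mod4 h1 /sqf_mod4 h2 /sqf_mod4 h3] _.
have [_ o1 o2 _] := qint_parity h1 h2 h3 ix.
move: o1 o2 nF; rewrite /inF; move: (q1 x) (q2 x) => y z.
case: (Z.odd (q0 x)) => [/Z.odd_spec[k ->] /Z.odd_spec[l ->] _|].
  by apply: Or33; lia.
move=> o1 o2; have := Z.negb_odd y; have := Z.negb_odd z; rewrite o1 o2.
move=> /esym/Z.even_spec[l ->] /esym/Z.even_spec[k ->] nF.
have [k0|k0] := Z.eq_dec k 0; last by apply: Or31; lia.
have [l0|l0] := Z.eq_dec l 0; last by apply: Or32; lia.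
by case: nF; rewrite k0 l0.
Qed.
End Captured.

Section Parity.
Local Open Scope Z_scope.

Lemma norm_even q z t n : q mod 4 = 2 \/ q mod 4 = 3 -> z * z - q * (t * t) = 4 * n ->
  exists z' t', z = 2 * z' /\ t = 2 * t'.
Proof.
move=> hq e; have od y : exists k, y = 2 * k \/ y = 2 * k + 1.
  by exists (y / 2); have := Z.div_mod y 2; have := Z.mod_pos_bound y 2; lia.
have [q' eq] : exists q', q = 4 * q' + 2 \/ q = 4 * q' + 3.
  by exists (q / 4); have := Z.div_mod q 4; lia.
have [k [ek|ek]] := od z; have [l [el|el]] := od t; first by exists k, l.
all: by exfalso; move: e; rewrite ek el; case: eq => ->; lia.
Qed.

(** The equations are those of [half_parity], with y0, ..., y3 the halves of the
coordinates. *)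
Lemma parity_core a P Q s p' q' s' a' y0 y1 y2 y3 u v w : s = 2 * s' + 1 -> a = 2 * a' + 1 ->
  (P = 4 * p' + 2 /\ Q = 4 * q' + 2) \/ (P = 4 * p' + 3 /\ Q = 4 * q' + 3) ->
  y0 * y0 - s * (y3 * y3) = 2 * u ->
  y0 * y0 - s * (y3 * y3) + (P * (y1 * y1) - Q * (y2 * y2)) = 4 * v ->
  y0 * y1 - a * (y2 * y3) = 2 * w -> exists m, y1 - y2 = 2 * m.
Proof.
move=> -> -> par2; have half y : exists k, y = 2 * k \/ y = 2 * k + 1.
  by exists (y / 2); have := Z.div_mod y 2; have := Z.mod_pos_bound y 2; lia.
have [k1 [-> | ->]] := half y1; have [k2 [-> | ->]] := half y2 => S S' T.
- by exists (k1 - k2); clear; lia.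
- exfalso; have [k0 e0] := half y0; have [k3 e3] := half y3; clear half.
  by case: par2 S' S T => -[-> ->]; case: e0 => ->; case: e3 => ->; clear; lia.
- exfalso; have [k0 e0] := half y0; have [k3 e3] := half y3; clear half.
  by case: par2 S' S T => -[-> ->]; case: e0 => ->; case: e3 => ->; clear; lia.
- by exists (k1 - k2); clear; lia.
Qed.

(** If bc and ac are 2 or 3 modulo 4, then z^2 - bc t^2 is a multiple of 4
only if z and t are even. This applies to the relative norms over the fields
of P and of Q, and gives congruences modulo 4 instead of 2. *)
Lemma half_parity a b c x : radical_triple a b c -> Z.odd (a * b) ->
  (b * c) mod 4 = 2 \/ (b * c) mod 4 = 3 -> (a * c) mod 4 = 2 \/ (a * c) mod 4 = 3 ->
  qint a b c x -> exists k l m, [/\ q1 x = 2 * k, q2 x = 2 * l & k - l = 2 * m].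
Proof.
move=> hg oab hP hQ ix.
case: (hg) => _ [/sqf_mod4 h1 /sqf_mod4 h2 /sqf_mod4 h3] _.
have [] := qint_parity h1 h2 h3 ix; rewrite /parities.
have -> : ((b * c) mod 4 =? 1) = false by apply/Z.eqb_neq; lia.
case: x ix => x0 x1 x2 x3 /and3P[/qint1P[n1 [A1 [T1 [N1 [_ e1 e2 e3]]]]]
  /qint1P[n2 [A2 [T2 [N2 [_ f1 f2 f3]]]]] _] /=; rewrite inE => /eqP o0 o1 o2 o3.
rewrite o0 in o1 o2 o3.
have ev y : Z.odd y = false -> exists k, y = 2 * k.
  by move=> oy; apply/Z.even_spec; rewrite -Z.negb_odd oy.
have [y0 E0] := ev _ o0; have [y1 E1] := ev _ o1; have [y2 E2] := ev _ o2; have [y3 E3] := ev _ o3.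
have [u1 [v1 [g1 g1']]] := norm_even hP e3; have [u2 [v2 [g2 g2']]] := norm_even hQ f3.
have [p' ep] : exists p', b * c = 4 * p' + 2 \/ b * c = 4 * p' + 3.
  by exists (b * c / 4); have := Z.div_mod (b * c) 4; lia.
have [q' eq] : exists q', a * c = 4 * q' + 2 \/ a * c = 4 * q' + 3.
  by exists (a * c / 4); have := Z.div_mod (a * c) 4; lia.
have [s' es] : exists s', a * b = 2 * s' + 1 by apply/Z.odd_spec.
have /andP[oa ob] : Z.odd a && Z.odd b by rewrite -Z.odd_mul.
have [a' ea] : exists a', a = 2 * a' + 1 by apply/Z.odd_spec.
have pq : Z.odd (b * c) = Z.odd (a * c) by rewrite !Z.odd_mul oa ob.
exists y1, y2.
have S : y0 * y0 - a * b * (y3 * y3) = 2 * (u1 + u2) by move: e1 f1; rewrite g1 g2 E0 E1 E2 E3; clear; lia.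
have S' : y0 * y0 - a * b * (y3 * y3) + (b * c * (y1 * y1) - a * c * (y2 * y2)) = 4 * u1.
  by move: e1; rewrite g1 E0 E1 E2 E3; clear; lia.
have T : y0 * y1 - a * (y2 * y3) = 2 * v1 by move: e2; rewrite g1' E0 E1 E2 E3; clear; lia.
have par2 : (b * c = 4 * p' + 2 /\ a * c = 4 * q' + 2) \/ (b * c = 4 * p' + 3 /\ a * c = 4 * q' + 3).
  move: ep eq pq; clear; case=> ->; case=> ->; rewrite !Z.odd_add !Z.odd_mul //= => _.
    by left.
  by right.
by have [m em] := parity_core es ea par2 S S' T; exists m.
Qed.

(** The coordinates along P and Q are both 2 modulo 4 or both 0 modulo 4. *)
Lemma spread4 a b c : radical_triple a b c -> Z.odd (a * b) ->
  (b * c) mod 4 = 2 \/ (b * c) mod 4 = 3 -> (a * c) mod 4 = 2 \/ (a * c) mod 4 = 3 ->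
  spread a b c 4.
Proof.
move=> hg oab hP hQ x ix; rewrite /inF.
have [k [l [m [-> -> e]]]] := half_parity hg oab hP hQ ix => nF.
have : (k = 0 /\ l = 0) \/ 2 <= Z.abs k \/ 2 <= Z.abs l \/ (1 <= Z.abs k /\ 1 <= Z.abs l) by lia.
case=> [[k0 l0]|[h|[h|[h h']]]].
- by case: nF; rewrite k0 l0.
- by apply: Or31; lia.
- by apply: Or32; lia.
- by apply: Or33; lia.
Qed.
End Parity.

(** * Infinite families of fields *)

Section Subfields.
Variables a b c : Z.
Hypothesis hg : radical_triple a b c.

Lemma qint1_F' (p m1 m2 d : Z) x : okF p x -> qint1 m1 p m2 d x.1 0 x.2 0.
Proof.
case=> k [l [n [-> e]]]; apply/qint1P.
by exists (Z.mul k k), (Z.mul 2 n), Z0, (Z.mul n n) => /=; split; lia.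
Qed.

Lemma okF_qint u v : okF (b * c) (u, v) -> qint a b c (Quad u v 0 0).
Proof.
move=> ox; apply/and3P; split.
- exact: (proj2 (qint1_F _ _ _ ox)).
- exact: (qint1_F' _ _ _ ox).
- exact: (qint1_F' _ _ _ ox).
Qed.

Lemma gtF_pos u v : gtF (b * c) (u, v) -> forall t, sqroots a b c t -> 0 < cj t (Quad u v 0 0).
Proof.
move=> /gtFP h t [e1 e2 e3].
have ew : (t.1.2 * t.2) ^+ 2 = zr (b * c) by rewrite exprMn e2 e3 rmorphM.
move: h; rewrite -(gtF_conj ew) => /andP[h _].
by rewrite /cj /= !rmorph0 !mul0r !addr0.
Qed.

Lemma subfields_refutation (w C D u v : Z) g1 g2 g2' : b <= a -> 0 <= w -> spread a b c w ->
  tree (a * b) C D g1 g2 g2' -> 4 <= C -> okF (b * c) (u, v) -> v <> 0 -> gtF (b * c) (u, v) ->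
  below (b * c) w (Z.mul C u) (Z.mul C v) -> below (b * c) w D 0 -> ~ binary_universal a b c.
Proof.
move=> ba w0 hw T C4 ou v0 gu hC hD U.
apply: (F_refutation hg U T C4 (okF_qint ou) (gtF_pos gu)).
- by case=> /= v0' _; apply: v0.
- by have := captured_spread hg ba w0 hw hC; rewrite /qscale /= !Z.mul_0_r.
- by apply: (captured_spread hg ba w0 hw hD).
Qed.
End Subfields.

Section Growth.
Local Open Scope Z_scope.

(** For fixed u and v the condition improves as e grows, so it is enough to
check it for a lower bound of e such as the square of its integral root. *)
Lemma below_mono e0 e w u v : e0 <= e -> below e0 w u v -> below e w u v.
Proof.
move=> he /andP[/Z.ltb_lt h1 /Z.ltb_lt h2].
have w2 : 0 <= 2 * (w * w) by nia.
have hm : 2 * (w * w) * e0 <= 2 * (w * w) * e by apply: Z.mul_le_mono_nonneg_l.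
move: h1 h2 hm; rewrite /below; move: (2 * (w * w) * e0) (2 * (w * w) * e) => m0 m h1 h2 hm.
apply/andP; split; apply/Z.ltb_lt; first by lia.
have : e0 * (v * v) <= e * (v * v) by apply: Z.mul_le_mono_nonneg_r => //; nia.
have : (m0 - u) * (m0 - u) <= (m - u) * (m - u) by apply: Z.mul_le_mono_nonneg; lia.
by lia.
Qed.

Lemma below_rational e w D : 0 < D -> D < w * w * e -> below e w D 0.
Proof.
move=> D0; rewrite /below; have -> : 2 * (w * w) * e = 2 * (w * w * e) by ring.
by move: (w * w * e) => m h; apply/andP; split; apply/Z.ltb_lt; nia.
Qed.

Lemma next_sqrt e : 0 < e -> exists r, [/\ 0 <= r, r * r <= e & e < (r + 1) * (r + 1)].
Proof.
move=> e0; exists (Z.sqrt e); have := Z.sqrt_spec e; have := Z.sqrt_nonneg e.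
by rewrite /Z.succ; split; lia.
Qed.

Lemma below_tail (w C j q r0 r : Z) : r0 <= r -> 
  (forall t, 0 <= t -> below ((r0 + t) * (r0 + t)) w (C * (q * (r0 + t + j))) (C * q)) ->
  below (r * r) w (C * (q * (r + j))) (C * q).
Proof. by move=> h H; have := H (r - r0); rewrite Zplus_minus; apply; lia. Qed.

(* both sides are polynomials in t, and their difference has nonnegative coefficients *)
Ltac below_poly t t0 := rewrite /below; apply/andP; split; apply/Z.ltb_lt;
  pose proof (Z.mul_nonneg_nonneg t t t0 t0) as t2;
  pose proof (Z.mul_nonneg_nonneg _ _ t2 t0) as t3;
  pose proof (Z.mul_nonneg_nonneg _ _ t3 t0) as t4; lia.

Lemma below_w4_20 r : 5 <= r -> below (r * r) 4 (20 * (4 * (r + 1))) (20 * 4).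
Proof. move=> h; apply: (below_tail h)=> t t0; below_poly t t0. Qed.
Lemma below_w4_23 r : 6 <= r -> below (r * r) 4 (23 * (4 * (r + 1))) (23 * 4).
Proof. move=> h; apply: (below_tail h)=> t t0; below_poly t t0. Qed.
Lemma below_w2_14 r : 11 <= r -> below (r * r) 2 (14 * (4 * (r + 1))) (14 * 4).
Proof. move=> h; apply: (below_tail h)=> t t0; below_poly t t0. Qed.
Lemma below_w2_23 r : 17 <= r -> below (r * r) 2 (23 * (4 * (r + 1))) (23 * 4).
Proof. move=> h; apply: (below_tail h)=> t t0; below_poly t t0. Qed.
Lemma below_w2_20 r : 15 <= r -> below (r * r) 2 (20 * (4 * (r + 1))) (20 * 4).
Proof. move=> h; apply: (below_tail h)=> t t0; below_poly t t0. Qed.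
Lemma below_w2_28 r : 20 <= r -> below (r * r) 2 (28 * (4 * (r + 1))) (28 * 4).
Proof. move=> h; apply: (below_tail h)=> t t0; below_poly t t0. Qed.
Lemma below_half1 r : 10 <= r -> below (r * r) 2 (20 * (2 * (r + 1))) (20 * 2).
Proof. move=> h; apply: (below_tail h) => t t0; below_poly t t0. Qed.
Lemma below_half r : 10 <= r -> below (r * r) 2 (20 * (2 * (r + 2))) (20 * 2).
Proof. move=> h; apply: (below_tail h)=> t t0; below_poly t t0. Qed.
End Growth.

Section Parametric.
Local Open Scope Z_scope.

Lemma tree_leC p C C' D g1 g2 g2' : C <= C' -> tree p C D g1 g2 g2' -> tree p C' D g1 g2 g2'.
Proof.
move=> CC [h1 [h2 h3]]; split=> //; split=> // A vA; have [lA h4] := h3 A vA.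
have le x : leF p C x -> leF p C' x by case: x => x y [/= k1 k2]; split=> /=; nia.
by split=> [|B vB]; [exact: le | have [? ? ?] := h4 B vB; split=> //; exact: le].
Qed.

Lemma okF_pair e k : okF e (4 * k, 4).
Proof. by exists (2 * k), 2, (k * k - e); split; [congr pair|]; lia. Qed.
Lemma gtF_pair e k : 0 < k -> e < k * k -> gtF e (4 * k, 4).
Proof. by move=> k0 h; split=> /=; lia. Qed.

Variables a b c : Z.
Hypothesis hg : radical_triple a b c.
Hypothesis ba : b < a.

Lemma refutation_w (w C D e0 e r : Z) g1 g2 g2' :
  b * c = e -> e0 <= e -> 0 < e -> 0 <= w -> spread a b c w -> tree (a * b) C D g1 g2 g2' ->
  4 <= C -> 0 < D -> D < w * w * e -> 0 <= r -> e < (r + 1) * (r + 1) ->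
  below e0 w (C * (4 * (r + 1))) (C * 4) -> ~ binary_universal a b c.
Proof.
move=> ee e0e epos w0 hw T C4 D0 hD r0 er hb; subst e.
have r1 : 0 < r + 1 by lia.
have okp : okF (b * c) (4 * (r + 1), 4) by exact: okF_pair.
refine (subfields_refutation hg _ _ hw T _ okp _ (gtF_pair r1 er) (below_mono e0e hb) (below_rational D0 hD)) => //; lia.
Qed.

Lemma large_tree_odd p : sqf p -> 1 < p -> Z.odd p -> p <> 3 ->
  exists g1 g2 g2', tree p 20 176 g1 g2 g2'.
Proof.
move=> hp p1 op p3; have [->|p5] := Z.eq_dec p 5.
  by exists (8, 0), (14, 2), (10, 2); apply: tree_leC tree5.
exists (8, 0), (12, 0), (20, 0); apply: tree_large => //; last by move=> e; rewrite e in op.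
have : p <> 4 by move=> e; rewrite e in op.
have : p <> 2 by move=> e; rewrite e in op.
by lia.
Qed.

Lemma radical_triple_pos : [/\ 0 < a, 0 < b, 0 < c & 1 < b * c].
Proof. by case: hg => -[? ? ?] _ [? ? ?]; split; lia. Qed.

Lemma sqf_not9 n k : sqf n -> n <> 9 * k.
Proof.
move=> hn e; have := hn 3; rewrite e => H.
by have : Z.abs 3 = 1 by apply: H; exists k; lia.
Qed.

(** Here c is distinguished, F is generated by sqrt (ab) and the element is k
+ sqrt (bc). The case ab = 3 is worse since the tree for 3 has a larger bound. *)
Lemma odd_refutation : Z.odd (a * b) ->
  (b * c) mod 4 = 2 \/ (b * c) mod 4 = 3 -> (a * c) mod 4 = 2 \/ (a * c) mod 4 = 3 ->
  14 <= b * c -> (a * b = 3 -> b * c <> 14 /\ b * c <> 26) -> ~ binary_universal a b c.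
Proof.
move=> oab hP hQ e14 exc; have hw := spread4 hg oab hP hQ.
case: (hg) => _ [sP sQ sF] [_ _ k3]; have [a0 b0 c0 _] := radical_triple_pos.
have {}k3 : 1 < a * b by lia.
have [m em] : exists m, b * c = 4 * m + 2 \/ b * c = 4 * m + 3.
  by exists (b * c / 4); have := Z.div_mod (b * c) 4; lia.
have [|r [r0 re er]] := @next_sqrt (b * c); first by lia.
have [s3|s3] := Z.eq_dec (a * b) 3.
  have [ea eb] : a = 3 /\ b = 1 by nia.
  have {}em : b * c = 4 * m + 2.
    case: em => // em; case: hQ; rewrite (_ : a * c = 3 * (b * c)); try (by rewrite ea eb; lia);
    by rewrite em (_ : 3 * (4 * m + 3) = 1 + (3 * m + 2) * 4) ?Z.mod_add //; lia.
  have T : tree (a * b) 23 344 (8, 4) (16, 4) (16, 4) by rewrite s3; exact: tree3.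
  have [n14 n26] := exc s3; have n18 : b * c <> 18 by exact: (@sqf_not9 _ 2 sP).
  have R e0 : e0 <= b * c -> below e0 4 (23 * (4 * (r + 1))) (23 * 4) -> ~ binary_universal a b c.
    by move=> h; apply: (refutation_w (erefl _) h _ _ hw T) => //; lia.
  have [r6|r6] : 6 <= r \/ r < 6 by lia.
    by apply: (R (r * r)) => //; apply: below_w4_23.
  have : (b * c = 22 /\ r = 4) \/ (b * c = 30 /\ r = 5) \/ (b * c = 34 /\ r = 5).
    have r345 : r = 3 \/ r = 4 \/ r = 5.
      have [//|r3] : (r = 3 \/ r = 4 \/ r = 5) \/ r <= 2 by lia.
      by move: r0 r3 er e14; clear; nia.
    move: e14 em n14 n18 n26 re er; case: r345 => [->|[->|->]]; clear; move: (b * c) => z; lia.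
  by case=> [[h1 h2]|[[h1 h2]|[h1 h2]]]; apply: (R (b * c)); rewrite ?h1 ?h2 //; lia.
have [g1 [g2 [g2' T]]] := large_tree_odd sF k3 oab s3.
have n18 : b * c <> 18 by exact: (@sqf_not9 _ 2 sP).
have R e0 : e0 <= b * c -> below e0 4 (20 * (4 * (r + 1))) (20 * 4) -> ~ binary_universal a b c.
  by move=> h; apply: (refutation_w (erefl _) h _ _ hw T) => //; lia.
have [r6|r6] : 5 <= r \/ r < 5 by lia.
  by apply: (R (r * r)) => //; apply: below_w4_20.
have : (b * c = 14 /\ r = 3) \/ (b * c = 15 /\ r = 3) \/ (b * c = 19 /\ r = 4) \/
  (b * c = 22 /\ r = 4) \/ (b * c = 23 /\ r = 4).
  have r34 : r = 3 \/ r = 4.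
    have [//|r3] : (r = 3 \/ r = 4) \/ r <= 2 by lia.
    by move: r0 r3 er e14; clear; nia.
  by move: e14 em n18 re er; case: r34 => ->; clear; move: (b * c) => z; lia.
by case=> [[h1 h2]|[[h1 h2]|[[h1 h2]|[[h1 h2]|[h1 h2]]]]]; apply: (R (b * c)); rewrite ?h1 ?h2 //; lia.
Qed.

(** Without the parity condition, but with c large compared to ab. *)
Lemma fixed_refutation :
  (a * b = 2 /\ 121 <= b * c) \/ (a * b = 3 /\ 289 <= b * c) \/ (a * b = 10 /\ 400 <= b * c) \/
  (6 <= a * b /\ a * b <> 10 /\ 225 <= b * c) -> ~ binary_universal a b c.
Proof.
case: (hg) => _ [sP sQ sF] _; have hw := spread2 hg.
have S n : 0 <= n -> n * n <= b * c -> exists r, [/\ 0 <= r, n <= r, r * r <= b * c & b * c < (r + 1) * (r + 1)].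
  move=> n0 hn; exists (Z.sqrt (b * c)); have := Z.sqrt_spec (b * c); have := Z.sqrt_nonneg (b * c).
  by rewrite /Z.succ; split; [ | apply/Z.sqrt_le_square | |]; lia.
case=> [[es hn]|[[es hn]|[[es hn]|[h6 [h10 hn]]]]].
- have [||r [r0 r1 er re]] := S 11; rewrite //.
  have T := tree2; rewrite -es in T.
  by apply: (refutation_w (erefl _) er _ _ hw T _ _ _ r0 re (below_w2_14 r1)) => //; lia.
- have [||r [r0 r1 er re]] := S 17; rewrite //.
  have T := tree3; rewrite -es in T.
  by apply: (refutation_w (erefl _) er _ _ hw T _ _ _ r0 re (below_w2_23 r1)) => //; lia.
- have [||r [r0 r1 er re]] := S 20; rewrite //.
  have T := tree10; rewrite -es in T.
  by apply: (refutation_w (erefl _) er _ _ hw T _ _ _ r0 re (below_w2_28 r1)) => //; lia.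
- have [||r [r0 r1 er re]] := S 15; rewrite //.
  have T := tree_large sF h6 h10.
  by apply: (refutation_w (erefl _) er _ _ hw T _ _ _ r0 re (below_w2_20 r1)) => //; lia.
Qed.

(** The element is (k + sqrt (bc)) / 2 with k odd. *)
Lemma congruent_refutation : b * c mod 4 = 1 -> a * b mod 4 = 1 -> 86 <= b * c -> ~ binary_universal a b c.
Proof.
move=> hP hF hn; case: (hg) => _ [sP sQ sF] [_ _ k3]; have hw := spread2 hg.
have {}k3 : 1 < a * b by lia.
have [m em] : exists m, b * c = 4 * m + 1.
  by exists (b * c / 4); have := Z.div_mod (b * c) 4; lia.
have [|r [r0 re er]] := @next_sqrt (b * c); first by lia.
have [g1 [g2 [g2' T]]] : exists g1 g2 g2', tree (a * b) 20 176 g1 g2 g2'.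
  apply: large_tree_odd => //; last by move=> h; rewrite h in hF.
  by rewrite (Z.div_mod (a * b) 4) // hF Z.odd_add Z.odd_mul.
have [k [ok kr hk]] : exists k, [/\ Z.odd k, r < k <= r + 2 & b * c < k * k].
  case: (boolP (Z.odd (r + 1))) => o; first by exists (r + 1); split; [|lia|].
  exists (r + 2); split; [|lia|nia].
  by move: o; rewrite !Z.odd_add; case: (Z.odd r).
have okp : okF (b * c) (2 * k, 2).
  move/Z.odd_spec: ok => [l el]; exists k, 1, (l * l + l - m); split=> //.
  by rewrite em el; lia.
have gk : gtF (b * c) (2 * k, 2) by split=> /=; lia.
have R : below (b * c) 2 (20 * (2 * k)) (20 * 2) -> ~ binary_universal a b c.
  move=> hb; refine (subfields_refutation hg _ _ hw T _ okp _ gk hb _) => //; first by lia.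
  by apply: below_rational; lia.
have [r10|r10] : 10 <= r \/ r < 10 by lia.
  apply: R; apply: (below_mono re).
  have [->|->] : k = r + 1 \/ k = r + 2 by lia.
    by apply: below_half1.
  by apply: below_half.
have : (b * c = 89 /\ k = 11) \/ (b * c = 93 /\ k = 11) \/ (b * c = 97 /\ k = 11).
  have r9 : r = 9 by nia.
  have k11 : k = 11 by move: ok; have [->|//] : k = 10 \/ k = 11 by lia.
  by lia.
by case=> [[h1 h2]|[[h1 h2]|[h1 h2]]]; apply: R; rewrite h1 h2.
Qed.
End Parametric.

(** * Finite families of fields *)

Section Finite.
Local Open Scope Z_scope.

Definition captured_test (a b c : Z) (y : quad) : bool :=
  lall (fun x => if q1 x =? 0 then q2 x =? 0 else false) (sqlist a b c y).
Definition small1 (a b c : Z) : quad := let: (u, v) := small_pair (b * c) in Quad u v 0 0.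
Definition small2 (a b c : Z) : quad := let: (u, v) := small_pair (a * c) in Quad u 0 v 0.
(** g is a totally positive integer outside F, and all integers whose square is
at most C g are in F. *)
Definition escapes (C a b c : Z) (g : quad) : bool :=
  if admissible a b c g then
    if (q1 g =? 0) && (q2 g =? 0) then false else captured_test a b c (qscale C g)
  else false.
(** The test for [F_refutation] is much cheaper than the full tree of
representations. *)
Definition settled (C D p a b c : Z) : bool :=
  if (if captured_test a b c (Quad D 0 0 0) then
        if escapes C a b c (small1 a b c) then true else escapes C a b c (small2 a b c)
      else false)
  then true else refuted p a b c.

Fixpoint zall (f : Z -> bool) (lo : Z) (n : nat) : bool :=
  if n is n'.+1 then if f lo then zall f (lo + 1) n' else false else true.

Lemma zallP f lo n : zall f lo n -> forall z, lo <= z < lo + Z.of_nat n -> f z.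
Proof.
elim: n lo => [|n IH] lo /=; first by move=> _ z; lia.
case: ifP => // flo /IH h z hz; have [->//|z1] : z = lo \/ lo + 1 <= z by lia.
by apply: h; lia.
Qed.

Definition settled_family (C D p a b lo : Z) (n : nat) : bool :=
  zall (fun c => if candidate a b c then if sqf_test c then settled C D p a b c else true else true) lo n.
Definition congruent (a b c : Z) : bool :=
  if (c - b) mod 4 =? 0 then if Z.gcd (a * b) c =? 1 then if sqf_test (b * c) then sqf_test (a * c) else false
  else false else false.
Definition congruent_family (a hi : Z) : bool :=
  zall (fun b => if if (b - a) mod 4 =? 0 then sqf_test (a * b) else false then
    zall (fun c => if congruent a b c then settled 20 176 (a * b) a b c else true)
      (b + 4) (Z.to_nat (hi - b - 3))
    else true) (a + 4) (Z.to_nat (hi - a - 3)).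

Lemma settled2 : settled_family 14 176 2 2 1 2 119.
Proof. by vm_cast_no_check (erefl true). Qed.
Lemma settled3 : settled_family 23 344 3 3 1 2 287 && settled_family 23 344 3 1 3 4 285.
Proof. by vm_cast_no_check (erefl true). Qed.
Lemma settled6 : settled_family 20 176 6 6 1 2 223 && settled_family 20 176 6 2 3 4 109.
Proof. by vm_cast_no_check (erefl true). Qed.
Lemma settled7 : settled_family 20 176 7 7 1 2 223 && settled_family 20 176 7 1 7 8 217.
Proof. by vm_cast_no_check (erefl true). Qed.
Lemma settled10 : settled_family 28 224 10 10 1 2 398 && settled_family 28 224 10 2 5 6 194.
Proof. by vm_cast_no_check (erefl true). Qed.
Lemma settled11 : settled_family 20 176 11 11 1 2 223 && settled_family 20 176 11 1 11 12 213.
Proof. by vm_cast_no_check (erefl true). Qed.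
Lemma congruent_settled1 : congruent_family 1 85.
Proof. by vm_cast_no_check (erefl true). Qed.
Lemma congruent_settled3 : congruent_family 3 28.
Proof. by vm_cast_no_check (erefl true). Qed.
Lemma congruent_settled5 : congruent_family 5 17.
Proof. by vm_cast_no_check (erefl true). Qed.
Lemma remaining : refuted 3 3 1 14 && refuted 3 3 1 26.
Proof. by vm_cast_no_check (erefl true). Qed.
End Finite.

Section Soundness.
Variables a b c : Z.
Hypothesis hg : radical_triple a b c.

Lemma captured_testP y : captured_test a b c y -> captured a b c y.
Proof.
move=> /lallP h x ix hx; have := h x (sqlistP hg ix hx).
by case: Z.eqb_spec => // h1 /Z.eqb_eq h2.
Qed.

Lemma escapesP C g : escapes C a b c g ->
  [/\ qint a b c g, forall t, sqroots a b c t -> (0 < cj t g)%R, ~ inF g & captured a b c (qscale C g)].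
Proof.
rewrite /escapes; case: ifP => // /(admissibleP hg)[ig pg]; case: ifP => // /negbT nF /captured_testP h.
by split=> // -[h1 h2]; move: nF; rewrite h1 h2.
Qed.

(** [tree_refutation] holds for all choices of elements, so nothing has to be
known about those in the certificates. *)
Lemma settled_refutation (C D p : Z) g1 g2 g2' : tree (a * b) C D g1 g2 g2' -> Z.le 4 C ->
  settled C D p a b c -> ~ binary_universal a b c.
Proof.
rewrite /settled => T C4; case: ifP => [h _ U|_ h U]; last first.
  move: h; rewrite /refuted; case: (assoc _ _) => [[[[G3 h2] h2'] h1]|].
    by apply/negP/(tree_refutation hg G3 h2 h2' h1 U).
  case: (standard_tree p) => [[h2 h2'] h1]; apply/negP.
  exact: (tree_refutation hg _ h2 h2' h1 U).
move: h; case: ifP => // /captured_testP capD h.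
have [g [ig pg gF capC]] : exists g, [/\ qint a b c g, forall t, sqroots a b c t -> (0 < cj t g)%R,
    ~ inF g & captured a b c (qscale C g)].
  by move: h; case: ifP => [/escapesP h _|_ /escapesP h]; [exists (small1 a b c) | exists (small2 a b c)].
have C4' : (4 <= C)%R by lia.
exact: (F_refutation hg U T C4' ig pg gF capC capD).
Qed.

Lemma sqf_testP n : sqf n -> sqf_test n.
Proof.
move=> hn; rewrite /sqf_test.
have H d : Z.lt 1 d -> Z.eqb (Z.modulo n (Z.mul d d)) 0 = false.
  move=> d1; apply/Z.eqb_neq => e; have := hn d => h.
  have : Z.abs d = Zpos 1 by apply: h; apply/Z.mod_divide => //; lia.
  by lia.
have h2 := H (Zpos 2) (erefl _); have h3 := H (Zpos 3) (erefl _); have h5 := H (Zpos 5) (erefl _).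
have h7 := H (Zpos 7) (erefl _); have h11 := H (Zpos 11) (erefl _); have h13 := H (Zpos 13) (erefl _).
by rewrite [Z.modulo n 4](_ : _ = Z.modulo n (Z.mul 2 2)) // h2 h3 h5 h7 h11 h13.
Qed.

Lemma sqf_div m n : Z.divide m n -> sqf n -> sqf m.
Proof. by move=> mn hn d hd; apply: hn; apply: Z.divide_trans hd mn. Qed.

Lemma sqf_gcd m n : sqf (m * n)%R -> Z.gcd m n = Zpos 1.
Proof.
move=> h; have : Z.abs (Z.gcd m n) = Zpos 1.
  apply: h; have [k ek] := Z.gcd_divide_l m n; have [l el] := Z.gcd_divide_r m n.
  by move: (Z.gcd m n) ek el => d ek el; exists (Z.mul k l); rewrite ek el; lia.
by have := Z.gcd_nonneg m n; lia.
Qed.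

Lemma radical_triple_tests : [/\ Z.gcd (Z.mul a b) c = Zpos 1, sqf_test a, sqf_test b, sqf_test c
  & [/\ sqf_test (Z.mul b c), sqf_test (Z.mul a c) & sqf_test (Z.mul a b)]].
Proof.
case: hg => _ [s1 s2 s3] _; split; last by split; apply: sqf_testP.
- apply/Zgcd_1_rel_prime/rel_prime_sym/rel_prime_mult; apply/rel_prime_sym/Zgcd_1_rel_prime; exact: sqf_gcd.
- by apply: sqf_testP; apply: sqf_div s3; exists b; lia.
- by apply: sqf_testP; apply: sqf_div s3; exists a; lia.
- by apply: sqf_testP; apply: sqf_div s2; exists a; lia.
Qed.

Lemma family_refutation C D p lo n g1 g2 g2' : Z.mul a b = p -> tree p C D g1 g2 g2' -> Z.le 4 C ->
  settled_family C D p a b lo n -> candidate a b c -> Z.le lo c -> Z.lt c (Z.add lo (Z.of_nat n)) ->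
  ~ binary_universal a b c.
Proof.
move=> ep T C4 F hc l1 l2; have [_ _ _ sc _] := radical_triple_tests.
rewrite -ep in T; apply: (settled_refutation (p := p) T C4).
by have := zallP F (conj l1 l2); rewrite hc sc.
Qed.

Lemma congruent_family_refutation hi g1 g2 g2' : congruent_family a hi ->
  tree (a * b) 20 176 g1 g2 g2' -> Z.le (Z.add a 4) b -> Z.le (Z.add b 4) c -> Z.le c hi ->
  Z.modulo (Z.sub b a) 4 = Z0 -> Z.modulo (Z.sub c b) 4 = Z0 -> ~ binary_universal a b c.
Proof.
move=> F T l1 l2 l3 m1 m2; have [hgcd _ _ sc [s1 s2 s3]] := radical_triple_tests.
apply: (settled_refutation (p := Z.mul a b) T); first by lia.
have hb : Z.lt b (Z.add (Z.add a 4) (Z.of_nat (Z.to_nat (Z.sub (Z.sub hi a) 3)))) by lia.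
have hc : Z.lt c (Z.add (Z.add b 4) (Z.of_nat (Z.to_nat (Z.sub (Z.sub hi b) 3)))) by lia.
have := zallP F (conj l1 hb); rewrite m1 s3 [Z.eqb _ _]/= => G.
have := zallP G (conj l2 hc); rewrite /congruent m2 hgcd s1 s2.
exact.
Qed.
End Soundness.

(** * Every biquadratic field *)

Section Cases.
Local Open Scope Z_scope.
Variable K : fieldExtType rat.
Hypothesis U : forall a b c, biquadratic_of K a b c -> binary_universal a b c.

(** For c below the end of the list the field was tested; beyond it the
general argument applies, with the smaller of ac and bc. *)
Lemma no_small_case a b c C D p lo n thr g1 g2 g2' : biquadratic_of K a b c -> a * b = p ->
  tree p C D g1 g2 g2' -> 4 <= C -> settled_family C D p a b lo n -> candidate a b c -> lo <= c ->
  thr <= Z.min a b * (lo + Z.of_nat n) ->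
  (p = 2 /\ thr = 121) \/ (p = 3 /\ thr = 289) \/ (p = 10 /\ thr = 400) \/
  (6 <= p /\ p <> 10 /\ thr = 225) -> a <> b -> False.
Proof.
move=> h ep T C4 F hc l1 hn ht nab; have [[a0 b0 c0] _ _] := (proj1 h).
have [l2|l2] := Z.lt_ge_cases c (lo + Z.of_nat n).
  exact: (family_refutation (proj1 h) ep T C4 F hc l1 l2 (U h)).
have {}hn : thr <= Z.min a b * c by apply: Z.le_trans hn _; apply: Z.mul_le_mono_nonneg_l; lia.
have [ba|ab] : b < a \/ a < b by lia.
  apply: (fixed_refutation (proj1 h) ba _ (U h)); rewrite Z.min_r in hn; last by lia.
  by rewrite ep; lia.
have h' := biquadratic_of_swap12 h; apply: (fixed_refutation (proj1 h') ab _ (U h')).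
by rewrite Z.min_l in hn; [rewrite Z.mul_comm ep; lia | lia].
Qed.

Lemma not_refuted a b c p : biquadratic_of K a b c -> ~~ refuted p a b c.
Proof.
move=> h; rewrite /refuted; case: (assoc _ _) => [[[[G3 h2] h2'] h1]|].
  exact: (tree_refutation (proj1 h) G3 h2 h2' h1 (U h)).
case: (standard_tree p) => [[h2 h2'] h1]; exact: (tree_refutation (proj1 h) _ h2 h2' h1 (U h)).
Qed.

(** The radicals are those of 3, 14, 42 and of 3, 26, 78. For these
two fields the inequality behind [odd_refutation] just fails. *)
Lemma no_remaining : ~ (biquadratic_of K 3 1 14 \/ biquadratic_of K 3 1 26).
Proof.
have /andP[r14 r26] := remaining.
by case=> /(@not_refuted _ _ _ 3) /negP; apply.
Qed.

(** For ab >= 14 take F generated by sqrt (bc) and the element k + sqrt (ab);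
for smaller ab take F generated by sqrt (ab). *)
Lemma no_distinguished a b c : biquadratic_of K a b c -> Z.odd b -> Z.odd c -> b < c -> candidate a b c ->
  (a * b) mod 4 = 2 \/ (a * b) mod 4 = 3 -> (a * c) mod 4 = 2 \/ (a * c) mod 4 = 3 -> False.
Proof.
move=> h ob oc bc hc mb mc; have [[a0 b0 c0] [sP sQ sF] [kP kQ kF]] := (proj1 h).
have {}a0 : 0 < a by lia. have {}b0 : 0 < b by lia. have {}kF : 1 < a * b by lia.
have [p14|p14] : 14 <= a * b \/ a * b < 14 by lia.
  have h' : biquadratic_of K c b a by apply: biquadratic_of_swap12; apply: biquadratic_of_swap23; apply: biquadratic_of_swap12.
  have e1 : b * a = a * b by lia.
  have e2 : c * a = a * c by lia.
  have R : (c * b = 3 -> b * a <> 14 /\ b * a <> 26) -> False.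
    move=> exc; apply: (odd_refutation (proj1 h') bc _ _ _ _ exc (U h')); rewrite ?e1 ?e2 //.
    by rewrite Z.odd_mul oc ob.
  apply: R => cb3; have [eb ec] : b = 1 /\ c = 3 by nia.
  split=> ea; apply: no_remaining; [left | right]; move: h'; rewrite ec eb.
    by rewrite (_ : a = 14) //; lia.
  by rewrite (_ : a = 26) //; lia.
have b13 : b <= 13 by nia.
have a13 : a <= 13 by nia.
have n4 k : a * b <> 4 * k + 1.
  by move=> e; move: mb; rewrite e Z.add_comm Z.mul_comm Z_mod_plus_full; case.
have n4' k : a * b <> 4 * k.
  by move=> e; move: mb; rewrite e Z.mul_comm Z_mod_mult; case.
have [k ek] : exists k, b = 2 * k + 1 by apply/Z.odd_spec.
have : (a = 2 /\ b = 1) \/ (a = 3 /\ b = 1) \/ (a = 1 /\ b = 3) \/ (a = 6 /\ b = 1) \/ (a = 2 /\ b = 3) \/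
  (a = 7 /\ b = 1) \/ (a = 1 /\ b = 7) \/ (a = 10 /\ b = 1) \/ (a = 2 /\ b = 5) \/
  (a = 11 /\ b = 1) \/ (a = 1 /\ b = 11).
  have m0 := n4 0; have m1 := n4 1; have m2 := n4 2; have m3 := n4 3.
  have j0 := n4' 0; have j1 := n4' 1; have j2 := n4' 2; have j3 := n4' 3.
  have : k = 0 \/ k = 1 \/ k = 2 \/ k = 3 \/ k = 4 \/ k = 5 \/ k = 6 by lia.
  by case=> [|[|[|[|[|[|]]]]]] ek'; rewrite {}ek {}ek' in kF p14 m0 m1 m2 m3 j0 j1 j2 j3 |- *; lia.
have TL p : a * b = p -> 6 <= p -> p <> 10 -> tree p 20 176 (8, 0) (12, 0) (20, 0).
  by move=> <-; apply: tree_large.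
have lo : b + 1 <= c by lia.
have S C D p l n thr g1 g2 g2' := @no_small_case a b c C D p l n thr g1 g2 g2' h.
case=> [[ea eb]|[[ea eb]|[[ea eb]|[[ea eb]|[[ea eb]|[[ea eb]|[[ea eb]|[[ea eb]|[[ea eb]|[[ea eb]|[ea eb]]]]]]]]]]]; rewrite {}ea {}eb in S hc lo bc TL *.
- by apply: (S _ _ 2 _ _ 121 _ _ _ _ tree2 _ settled2) => //; lia.
- by apply: (S _ _ 3 _ _ 289 _ _ _ _ tree3 _ (proj1 (andP settled3))) => //; lia.
- apply: (S _ _ 3 _ _ 289 _ _ _ _ tree3 _ (proj2 (andP settled3))) => //; try lia.
- by apply: (S _ _ 6 _ _ 225 _ _ _ _ (TL 6 _ _ _) _ (proj1 (andP settled6))) => //; lia.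
- apply: (S _ _ 6 _ _ 225 _ _ _ _ (TL 6 _ _ _) _ (proj2 (andP settled6))) => //; try lia.
- by apply: (S _ _ 7 _ _ 225 _ _ _ _ (TL 7 _ _ _) _ (proj1 (andP settled7))) => //; lia.
- apply: (S _ _ 7 _ _ 225 _ _ _ _ (TL 7 _ _ _) _ (proj2 (andP settled7))) => //; try lia.
- by apply: (S _ _ 10 _ _ 400 _ _ _ _ tree10 _ (proj1 (andP settled10))) => //; lia.
- apply: (S _ _ 10 _ _ 400 _ _ _ _ tree10 _ (proj2 (andP settled10))) => //; try lia.
- by apply: (S _ _ 11 _ _ 225 _ _ _ _ (TL 11 _ _ _) _ (proj1 (andP settled11))) => //; lia.
- apply: (S _ _ 11 _ _ 225 _ _ _ _ (TL 11 _ _ _) _ (proj2 (andP settled11))) => //; try lia.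
Qed.

(** F is generated by sqrt (ab), the smallest of the three radicals, and the
element is (k + sqrt (ac)) / 2. If ac < 86 then a is 1, 3 or 5 and c is
bounded. *)
Lemma no_congruent a b c : biquadratic_of K a b c -> Z.odd a -> a < b < c ->
  (b - a) mod 4 = 0 -> (c - b) mod 4 = 0 -> False.
Proof.
move=> h oa [ab bc] m1 m2; have [[a0 b0 c0] [sP sQ sF] [kP kQ kF]] := (proj1 h).
have {}kF : 1 < a * b by lia.
have {}a0 : 0 < a by lia.
have [l el] : exists l, b = a + 4 * l by exists ((b - a) / 4); have := Z.div_mod (b - a) 4; lia.
have [m em] : exists m, c = b + 4 * m by exists ((c - b) / 4); have := Z.div_mod (c - b) 4; lia.
have [k ek] : exists k, a = 2 * k + 1 by apply/Z.odd_spec.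
have M u : (1 + u * 4) mod 4 = 1 by rewrite Z_mod_plus_full.
have mab : (a * b) mod 4 = 1 by rewrite (_ : a * b = 1 + (k * k + k + a * l) * 4) // el ek; lia.
have mac : (a * c) mod 4 = 1 by rewrite (_ : a * c = 1 + (k * k + k + a * l + a * m) * 4) // em el ek; lia.
have [n|n] : 86 <= a * c \/ a * c < 86 by lia.
  have h' := biquadratic_of_swap12 h.
  by apply: (congruent_refutation (proj1 h') ab _ _ _ (U h')) => //; rewrite Z.mul_comm.
have a6 : a <= 6.
  have [//|a7] : a <= 6 \/ 7 <= a by lia.
  have : 7 * c <= a * c by apply: Z.mul_le_mono_nonneg_r; lia.
  by lia.
have [g1 [g2 [g2' T]]] : exists g1 g2 g2', tree (a * b) 20 176 g1 g2 g2'.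
  apply: large_tree_odd => //; last by move=> e; rewrite e in mab.
  by rewrite Z.odd_mul oa el Z.odd_add Z.odd_mul oa.
have S hi F := @congruent_family_refutation a b c (proj1 h) hi g1 g2 g2' F T.
have := U h; have l1 : a + 4 <= b by lia.
have l2 : b + 4 <= c by lia.
have [ea|[ea|ea]] : a = 1 \/ a = 3 \/ a = 5 by lia.
- by rewrite ea in S m1 l1 n *; apply: (S 85 congruent_settled1) => //; lia.
- by rewrite ea in S m1 l1 n *; apply: (S 28 congruent_settled3) => //; lia.
- by rewrite ea in S m1 l1 n *; apply: (S 17 congruent_settled5) => //; lia.
Qed.

(** One of a, b, c is even, or one is odd and not congruent to the other two
modulo 4, or all three are congruent. *)
Lemma no_field a b c : ~ biquadratic_of K a b c.
Proof.
have even1 x y z : biquadratic_of K x y z -> Z.even x -> y < z -> False.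
  move=> h ex yz; have [_ [sP sQ sF] _] := proj1 h.
  have [gcd _ _ _ _] := radical_triple_tests (proj1 h).
  have [k ek] : exists k, x = 2 * k by apply/Z.even_spec.
  have od w : sqf (x * w) -> Z.odd w /\ (x * w) mod 4 = 2.
    move=> s; case: (boolP (Z.odd w)) => ow; last first.
      have [l el] : exists l, w = 2 * l by apply/Z.even_spec; rewrite -Z.negb_odd.
      by case: (sqf_mod4 s); rewrite [(x * w)%R](_ : _ = k * l * 4) ?Z_mod_mult // ek el; lia.
    have [l el] : exists l, w = 2 * l + 1 by apply/Z.odd_spec.
    have [j ej] : exists j, k = 2 * j \/ k = 2 * j + 1.
      by exists (k / 2); have := Z.div_mod k 2; have := Z.mod_pos_bound k 2; lia.
    case: ej => ej.
      by case: (sqf_mod4 s); rewrite [(x * w)%R](_ : _ = j * w * 4) ?Z_mod_mult // ek ej; lia.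
    by split=> //; rewrite (_ : x * w = 2 + (j * (2 * l + 1) + l) * 4) ?Z_mod_plus_full // ek ej el; lia.
  have [oy my] := od _ sF; have [oz mz] := od _ sQ.
  apply: (no_distinguished h oy oz yz _ (or_introl my) (or_introl mz)).
  by rewrite /candidate oz gcd -Z.negb_even ex.
have odd1 x y z i j : biquadratic_of K x y z -> Z.odd x -> Z.odd y -> Z.odd z -> y < z ->
    x = y + 4 * i + 2 -> z = y + 4 * j -> False.
  move=> h ox oy oz yz ex ez; have [gcd _ _ _ _] := radical_triple_tests (proj1 h).
  have [k ek] : exists k, y = 2 * k + 1 by apply/Z.odd_spec.
  have my : (x * y) mod 4 = 3.
    rewrite (_ : x * y = 3 + ((2 * k + 1) * i + k * k + 2 * k) * 4) ?Z_mod_plus_full //.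
    by rewrite ex ek; lia.
  have mz : (x * z) mod 4 = 3 by rewrite (_ : x * z = x * y + (x * j) * 4) ?Z_mod_plus_full // ez; lia.
  apply: (no_distinguished h oy oz yz _ (or_intror my) (or_intror mz)).
  rewrite /candidate oz gcd /= ox; apply/Z.eqb_eq.
  by rewrite (_ : y - z = - j * 4) ?Z_mod_mult // ez; lia.
move=> h; have [[a0 b0 c0] [sP sQ sF] [kP kQ kF]] := proj1 h.
have ne x y : (0 < x)%R -> sqf (x * y) -> (1 < x * y)%R -> x <> y.
  move=> x0 s x1 e; have : Z.abs y = 1 by apply: s; exists 1; rewrite e; lia.
  by move=> y1; move: x1; rewrite e; nia.
have nbc := ne _ _ b0 sP kP; have nac := ne _ _ a0 sQ kQ; have nab := ne _ _ a0 sF kF.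
have h213 := biquadratic_of_swap12 h; have h132 := biquadratic_of_swap23 h; have h231 := biquadratic_of_swap23 h213.
have h312 := biquadratic_of_swap12 h132; have h321 := biquadratic_of_swap23 h312.
have [ea|oa] := boolP (Z.even a).
  have [l|l] : b < c \/ c < b by lia.
    by apply: (even1 _ _ _ h).
  by apply: (even1 _ _ _ h132).
have [eb|ob] := boolP (Z.even b).
  have [l|l] : a < c \/ c < a by lia.
    by apply: (even1 _ _ _ h213).
  by apply: (even1 _ _ _ h231).
have [ec|oc] := boolP (Z.even c).
  have [l|l] : a < b \/ b < a by lia.
    by apply: (even1 _ _ _ h312).
  by apply: (even1 _ _ _ h321).
rewrite !Z.negb_even in oa ob oc.
have [a' ea] : exists u, a = 2 * u + 1 by apply/Z.odd_spec.
have [b' eb] : exists u, b = 2 * u + 1 by apply/Z.odd_spec.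
have [c' ec] : exists u, c = 2 * u + 1 by apply/Z.odd_spec.
have half x : exists u, x = 2 * u \/ x = 2 * u + 1.
  by exists (x / 2); have := Z.div_mod x 2; have := Z.mod_pos_bound x 2; lia.
have [u eu] := half (a' - b'); have [v ev] := half (c' - b').
case: eu => eu; case: ev => ev.
- have C x y z i j : biquadratic_of K x y z -> Z.odd x -> x < y < z -> y = x + 4 * i -> z = y + 4 * j -> False.
    move=> hh ox xyz ey ez; apply: (no_congruent hh ox xyz).
      by rewrite (_ : y - x = i * 4) ?Z_mod_mult //; lia.
    by rewrite (_ : z - y = j * 4) ?Z_mod_mult //; lia.
  have : a < b < c \/ a < c < b \/ b < a < c \/ b < c < a \/ c < a < b \/ c < b < a by lia.
  case=> [l|[l|[l|[l|[l|l]]]]].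
  + by apply: (C _ _ _ (- u) v h) => //; lia.
  + by apply: (C _ _ _ (v - u) (- v) h132) => //; lia.
  + by apply: (C _ _ _ u (v - u) h213) => //; lia.
  + by apply: (C _ _ _ v (u - v) h231) => //; lia.
  + by apply: (C _ _ _ (u - v) (- u) h312) => //; lia.
  + by apply: (C _ _ _ (- v) u h321) => //; lia.
- have [l|l] : a < b \/ b < a by lia.
    by apply: (odd1 _ _ _ (v - u) (- u) h312) => //; lia.
  by apply: (odd1 _ _ _ v u h321) => //; lia.
- have [l|l] : b < c \/ c < b by lia.
    by apply: (odd1 _ _ _ u v h) => //; lia.
  by apply: (odd1 _ _ _ (u - v) (- v) h132) => //; lia.
- have [l|l] : a < c \/ c < a by lia.
    by apply: (odd1 _ _ _ (- u - 1) (v - u) h213) => //; lia.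
  by apply: (odd1 _ _ _ (- v - 1) (u - v) h231) => //; lia.
Qed.
End Cases.

Theorem theorem1p1 (K : fieldExtType rat) (hK : totally_real_biquadratic K) :
  ~ exists a : 'M[K]_3,
      [/\ qform_over_OK a, classical a, totally_positive_definite a
        & universal a].
Proof.
case=> A [hA hC hP hU]; have [a [b [c h]]] := totally_real_biquadratic_of hK.
have U := universal_binary hA hC hP hU.
exact: (no_field U h).
Qed.
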